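(* Let $\Psi$ be either an admissible wavelet (wavelet case) or an admissible window (time-frequency case). Fix $m\in\mathbb{N}$ and let $Y_1^\Psi,\dots,Y_m^\Psi$ be disjoint measurable subsets of $G_1$ of positive measure with $\bigcup_{k=1}^mY_k^\Psi=G_1$. Let $\Pi_k^\Psi=\{(r,s)\in G: r\in Y_k^\Psi\}$, $k=1,\dots,m$, let $$\mathcal{A}_m^\Psi=\{a_1\chi_{\Pi_1^\Psi}+\dots+a_m\chi_{\Pi_m^\Psi};\ a_k\in\mathbb{C},\ k=1,\dots,m\},$$ and let $\mathcal{T}_\Psi(\mathcal{A}_m^\Psi)$ be the $C^*$-algebra generated by the Toeplitz localization operators $T_a^\Psi$ with $a\in\mathcal{A}_m^\Psi$. Then $\mathcal{T}_\Psi(\mathcal{A}_m^\Psi)$ is isometric and isomorphic to the algebra $C(\nabla_\Psi)$, where $$\nabla_\Psi=\nabla_\Psi(Y_1^\Psi,\dots,Y_m^\Psi)=\mathrm{clos}\,\Big\{\big(\gamma^\Psi_{\chi_{Y_1^\Psi}}(\xi),\dots,\gamma^\Psi_{\chi_{Y_m^\Psi}}(\xi)\big);\ \xi\in G_2\Big\},$$ and the functions $\gamma^\Psi_{\chi_{Y_k^\Psi}}$, $k=1,\dots,m$, are given by $$\gamma^\Psi_{\chi_{Y_k^\Psi}}(\xi)=\int_{G_1}\chi_{Y_k^\Psi}(z)|\ell_\Psi(z,\xi)|^2\,\mathrm{d}\zeta_1(z)=\int_{Y_k^\Psi}|\ell_\Psi(z,\xi)|^2\,\mathrm{d}\zeta_1(z),\qquad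 \xi\in G_2.$$ The isomorphism $\tau_m^\Psi:\mathcal{T}_\Psi(\mathcal{A}_m^\Psi)\to C(\nabla_\Psi)$ is generated by the following mapping of generators $T_a^\Psi$ of the algebra $\mathcal{T}_\Psi(\mathcal{A}_m^\Psi)$: $$\tau_m^\Psi: T_a^\Psi\longmapsto a_1z_1^\Psi+\dots+a_mz_m^\Psi,\qquad z^\Psi=(z_1^\Psi,\dots,z_m^\Psi)\in\nabla_\Psi,$$ where $a=a_1\chi_{\Pi_1^\Psi}+\dots+a_m\chi_{\Pi_m^\Psi}\in\mathcal{A}_m^\Psi$.
   Context: $\chi_S$ denotes the characteristic function of a set $S$. The Fourier transform on $L_2(\mathbb{R})$ is $\hat f(\xi)=\int_{\mathbb{R}}f(x)\mathrm{e}^{-2\pi\mathrm{i}x\xi}\,\mathrm{d}x$. Two cases are treated in parallel. Wavelet case: $\Psi=\psi\in L_2(\mathbb{R})$ is a real-valued admissible wavelet, i.e. $\int_{\mathbb{R}_+}|\hat\psi(t\xi)|^2\frac{\mathrm{d}t}{t}=1$ for almost every $\xi\in\mathbb{R}$; $G=G_1\times G_2$ with $G_1=\mathbb{R}_+$, $G_2=\mathbb{R}$, $\mathrm{d}\zeta_1=u^{-2}\mathrm{d}u$, $\mathrm{d}\zeta_2=\mathrm{d}v$, $\mathrm{d}\zeta=u^{-2}\mathrm{d}u\,\mathrm{d}v$; for $\zeta=(u,v)\in G$, $\Psi_\zeta(x)=u^{-1/2}\psi((x-v)/u)$; and $\ell_\psi(u,\omega)=\sqrt{u}\,\overline{\hat\psi(u\omega)}$.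 Time-frequency case: $\Psi=\phi\in L_2(\mathbb{R})$ is an admissible window, i.e. $\|\phi\|_{L_2(\mathbb{R})}=1$; $G=G_1\times G_2$ with $G_1=G_2=\mathbb{R}$, $\mathrm{d}\zeta_1=\mathrm{d}q$, $\mathrm{d}\zeta_2=\mathrm{d}p$, $\mathrm{d}\zeta=\mathrm{d}q\,\mathrm{d}p$; for $\zeta=(q,p)\in G$, $\Psi_\zeta(x)=\mathrm{e}^{2\pi\mathrm{i}px}\phi(x-q)$; and $\ell_\phi(q,\omega)=\overline{\phi(\omega-q)}$. In both cases $(W_\Psi f)(\zeta)=\langle f,\Psi_\zeta\rangle$ for $f\in L_2(\mathbb{R})$; $W_\Psi: L_2(\mathbb{R})\to L_2(G,\mathrm{d}\zeta)$ is an isometry with range $W_\Psi(L_2(\mathbb{R}))$, and $P_\Psi$ is the orthogonal projection of $L_2(G,\mathrm{d}\zeta)$ onto this range. For $a\in L_\infty(G,\mathrm{d}\zeta)$, the Toeplitz localization operator is $T_a^\Psi: F\in W_\Psi(L_2(\mathbb{R}))\mapsto P_\Psi(aF)\in W_\Psi(L_2(\mathbb{R}))$.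
   Formalization: In the wavelet case the closure defining ∇ is taken over ξ ≠ 0 only: at ξ = 0 the function γ is ill-defined or zero, and including that point makes the claim false (m = 1 would give ∇ = {0,1}). Measurable sets are Borel sets. *)

(* Defs.v *)
From HB Require Import structures.
From mathcomp Require Import all_boot all_order all_algebra complex ring_quotient.
From mathcomp Require Import all_classical all_reals all_analysis.
From mathcomp Require Import measurable_realfun.

Set Implicit Arguments.
Unset Strict Implicit.
Unset Printing Implicit Defensive.
Import Order.TTheory GRing.Theory Num.Theory.
Import numFieldNormedType.Exports.
Local Open Scope classical_set_scope.
Local Open Scope ring_scope.
Local Open Scope complex_scope.
Local Open Scope quotient_scope.

Local Notation Re := (@complex.Re _).
Local Notation Im := (@complex.Im _).
Local Notation normc := ComplexField.Normc.normc.

Section complex_L2.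
Context (d : measure_display) (T : measurableType d) (R : realType).
Variable mu : {measure set T -> \bar R}.

Definition square_integrable : {pred T -> R[i]} :=
  [pred f : T -> R[i] | (Re \o f \in Lfun mu 2%:E) &&
                        (Im \o f \in Lfun mu 2%:E)].

Lemma square_integrable_submod_closed : submod_closed square_integrable.
Proof.
have two : (1 <= 2%:E :> \bar R)%E by rewrite lee_fin ler1n.
have [L0 LD] := Lfun_submod_closed mu two.
split=> [|c f g]; rewrite ![_ \in square_integrable]inE.
  by apply/andP; split; exact: L0.
move=> /andP[fr fi] /andP[gr gi]; apply/andP; split.
  have -> : Re \o (c *: f + g) = Re c *: (Re \o f) +
      (- Im c *: (Im \o f) + (Re \o g)).
    apply/funext => x; rewrite /GRing.scale/= !fctE /=.
    case: c => ? ?; case: (f x) => ? ?; case: (g x) => ? ? /=.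
    by rewrite /GRing.scale/= mulNr addrA.
  by apply: (LD) => //; exact: LD.
have -> : Im \o (c *: f + g) = Re c *: (Im \o f) +
    (Im c *: (Re \o f) + (Im \o g)).
  apply/funext => x; rewrite /GRing.scale/= !fctE /=.
  case: c => ? ?; case: (f x) => ? ?; case: (g x) => ? ? /=.
  by rewrite /GRing.scale/= addrA.
by apply: (LD) => //; exact: LD.
Qed.

HB.instance Definition _ := GRing.isSubmodClosed.Build _ _ square_integrable
  square_integrable_submod_closed.

Record L2fun := MkL2fun {
  L2fun_val :> T -> R[i];
  L2fun_valP : L2fun_val \in square_integrable }.

HB.instance Definition _ := [isSub for L2fun_val].
HB.instance Definition _ := [Choice of L2fun by <:].
HB.instance Definition _ := [SubChoice_isSubLmodule of L2fun by <:].

Definition null_L2fun : {pred L2fun} :=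
  fun f => `[< (f : T -> R[i]) = cst 0 %[ae mu] >].

Lemma null_L2fun_submod_closed : submod_closed null_L2fun.
Proof.
split=> [|c f g]; first by apply/asboolP; exact: ae_eq_refl.
move=> /asboolP f0 /asboolP g0; apply/asboolP.
by apply: filterS2 f0 g0 => x fx gx Dx /=; rewrite !fctE /= (fx Dx) (gx Dx) scaler0 addr0.
Qed.

HB.instance Definition _ := GRing.isSubmodClosed.Build _ _ null_L2fun
  null_L2fun_submod_closed.

(* L2 functions modulo equality almost everywhere. *)
Definition L2 : Type := Quotient.quot null_L2fun.

HB.instance Definition _ := GRing.Zmodule.on L2.
HB.instance Definition _ := EqQuotient.on L2.

Definition scale_L2 (c : R[i]) (F : L2) : L2 := \pi_L2 (c *: repr F).

Lemma pi_L2_eq (f g : L2fun) :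
  (\pi_L2 f = \pi_L2 g) <-> ((f : T -> R[i]) = g %[ae mu]).
Proof.
rewrite (rwP eqP) -Quotient.idealrBE; split=> [/asboolP|] fg.
  by apply: filterS fg => x /= fgx Dx; apply/eqP; rewrite -subr_eq0; apply/eqP/fgx.
by apply/asboolP; apply: filterS fg => x /= fgx Dx; rewrite !fctE fgx// subrr.
Qed.

Lemma pi_scale_L2 (c : R[i]) (f : L2fun) :
  \pi_L2 (c *: f) = scale_L2 c (\pi_L2 f).
Proof.
apply/pi_L2_eq; have : \pi_L2 (repr (\pi_L2 f)) = \pi_L2 f by rewrite reprK.
by move=> /pi_L2_eq; apply: filterS => x /= fgx Dx; rewrite !fctE fgx.
Qed.

Lemma pi_add_L2 (f g : L2fun) : \pi_L2 (f + g) = \pi_L2 f + \pi_L2 g :> L2.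
Proof. exact: (@Quotient.pi_add _ null_L2fun f g). Qed.

Fact scale_L2A a b (F : L2) : scale_L2 a (scale_L2 b F) = scale_L2 (a * b) F.
Proof.
elim/quotW: F => f.
by rewrite -(pi_scale_L2 b f) -(pi_scale_L2 a (b *: f)) -pi_scale_L2 scalerA.
Qed.
Fact scale_L21 : left_id 1 scale_L2.
Proof. by elim/quotW => f; rewrite -pi_scale_L2 scale1r. Qed.
Fact scale_L2Dr : right_distributive scale_L2 +%R.
Proof.
move=> c; elim/quotW => f; elim/quotW => g.
by rewrite -pi_add_L2 -(pi_scale_L2 c (f + g)) scalerDr pi_add_L2 !pi_scale_L2.
Qed.
Fact scale_L2Dl (F : L2) : {morph scale_L2^~ F : a b / a + b}.
Proof.
elim/quotW: F => f a b.
by rewrite -(pi_scale_L2 (a + b) f) scalerDl pi_add_L2 !pi_scale_L2.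
Qed.

HB.instance Definition _ := GRing.Zmodule_isLmodule.Build R[i] L2
  scale_L2A scale_L21 scale_L2Dr scale_L2Dl.

Definition L2_repr (F : L2) : T -> R[i] := repr F.
Coercion L2_repr : L2 >-> Funclass.

(* The class of f in L2; the value for f outside L2 is irrelevant. *)
Definition classL2 (f : T -> R[i]) : L2 :=
  \pi_L2 (insubd (0 : L2fun) f).

Definition cintegral (f : T -> R[i]) : R[i] :=
  Rintegral mu setT (fun x => Re (f x)) +i* Rintegral mu setT (fun x => Im (f x)).

Definition dotL2 (F G : L2) : R[i] := cintegral (fun x => F x * (G x)^*).

Definition normL2 (F : L2) : R := Num.sqrt (Re (dotL2 F F)).

Definition mulL2 (a : T -> R[i]) (F : L2) : L2 := classL2 (fun x => a x * F x).

(* The orthogonal projection onto a closed subspace K; k0 is an irrelevant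
   default. *)
Definition orth_proj (K : set L2) (k0 : K) (F : L2) : K :=
  xget k0 [set G : K | forall H : K, dotL2 (F - set_val G) (set_val H) = 0].

End complex_L2.

Arguments null_L2fun {d T R} mu _.
Arguments classL2 {d T R} mu f.
Arguments mulL2 {d T R} mu a F.
Arguments cintegral {d T R} mu f.

(* Operators on a closed subspace K of L2: Leibniz equality on K -> K is
   equality of operators. *)
Section operators.
Context (d : measure_display) (T : measurableType d) (R : realType).
Context (mu : {measure set T -> \bar R}) (K : set (L2 mu)).
Implicit Types A B C : K -> K.

(* C = c A + B. *)
Definition lincomb_op (c : R[i]) A B C :=
  forall F : K, set_val (C F) = c *: set_val (A F) + set_val (B F).

Definition linear_op A := forall (c : R[i]) (F G H : K),
  set_val H = c *: set_val F + set_val G ->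
  set_val (A H) = c *: set_val (A F) + set_val (A G).

Definition bounded_op A := exists M : R,
  forall F : K, normL2 (set_val (A F)) <= M * normL2 (set_val F).

Definition bounded_linear_ops : set (K -> K) :=
  [set A | linear_op A /\ bounded_op A].

Definition adjoint_op A B := forall F G : K,
  dotL2 (set_val (A F)) (set_val G) = dotL2 (set_val F) (set_val (B G)).

Definition opnorm A : R :=
  sup [set normL2 (set_val (A F)) | F in [set F : K | normL2 (set_val F) <= 1]].

(* Norm-closed *-subalgebras of the bounded operators on K. *)
Record Cstar_subalgebra (S : set (K -> K)) : Prop := CstarSubalgebra {
  Cstar_bounded : S `<=` bounded_linear_ops;
  Cstar_nonempty : S !=set0;
  Cstar_lincomb : forall c A B C, S A -> S B -> lincomb_op c A B C -> S C;
  Cstar_comp : forall A B, S A -> S B -> S (A \o B);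
  Cstar_adjoint : forall A B, S A -> adjoint_op A B -> S B;
  Cstar_closed : forall A, bounded_linear_ops A ->
    (forall e : R, 0 < e -> exists2 B, S B & forall F : K,
       normL2 (set_val (A F) - set_val (B F)) <= e * normL2 (set_val F)) ->
    S A }.

Definition Cstar_generated (G : set (K -> K)) : set (K -> K) :=
  smallest Cstar_subalgebra G.

(* (R[i])^o carries the usual topology of the complex numbers. *)
Definition cont_fun (X : topologicalType) : set (X -> R[i]) :=
  [set g | continuous (g : X -> (R[i])^o)].

Definition supnorm (X : Type) (g : X -> R[i]) : R :=
  sup (range (fun x => normc (g x))).

Record isometric_star_iso (S : set (K -> K)) (X : topologicalType)
    (tau : (K -> K) -> X -> R[i]) : Prop := IsometricStarIso {
  iso_bij : set_bij S (@cont_fun X) tau;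
  iso_lincomb : forall c A B C, S A -> S B -> S C -> lincomb_op c A B C ->
    tau C = fun x => c * tau A x + tau B x;
  iso_comp : forall A B, S A -> S B ->
    tau (A \o B) = fun x => tau A x * tau B x;
  iso_adjoint : forall A B, S A -> S B -> adjoint_op A B ->
    tau B = fun x => (tau A x)^*;
  iso_norm : forall A, S A -> supnorm (tau A) = opnorm A }.

End operators.

Section scale_measure.
Context (R : realType).
Local Notation leb := (@lebesgue_measure R).

(* The measure du / u^2 on the positive half-line, as a measure on R. *)
Definition scale_measure (A : set (measurableTypeR R)) : \bar R :=
  (\int[leb]_(u in A `&` `]0%R, +oo[) (u ^- 2)%:E)%E.

Let scale_measure0 : scale_measure set0 = 0%E.
Proof. by rewrite /scale_measure set0I integral_set0. Qed.

Let scale_measure_ge0 A : (0 <= scale_measure A)%E.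
Proof. by apply: integral_ge0 => u _; rewrite lee_fin invr_ge0 sqr_ge0. Qed.

Lemma measurable_scale_density (D : set R) :
  D `<=` `]0, +oo[ ->
  measurable_fun D (EFin \o (fun u : R => u ^- 2)).
Proof.
move=> D0; apply: (measurable_funS _ D0) => //.
apply/measurable_EFinP; apply: open_continuous_measurable_fun => // u.
rewrite inE/= in_itv/= andbT => u0.
apply: (@continuousV _ _ (fun x : R => x ^+ 2)); first by rewrite sqrf_eq0 gt_eqF.
exact: exprn_continuous.
Qed.

Let scale_measure_sigma_additive : semi_sigma_additive scale_measure.
Proof.
move=> F mF tF mUF; rewrite /scale_measure; apply: cvg_toP.
  apply: ereal_nondecreasing_is_cvgn => m n mn.
  apply: lee_sum_nneg_natr => // k _ _; exact: scale_measure_ge0.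
rewrite setI_bigcupl ge0_integral_bigcup//=.
- by move=> k; apply: measurableI.
- by apply: measurable_scale_density; rewrite -setI_bigcupl; exact: subIsetr.
- by move=> u _; rewrite lee_fin invr_ge0 sqr_ge0.
- exact: trivIset_setIr.
Qed.

HB.instance Definition _ := isMeasure.Build _ _ _ scale_measure
  scale_measure0 scale_measure_ge0 scale_measure_sigma_additive.

Let scale_measure_sigma_finite : sigma_finite setT scale_measure.
Proof.
exists (fun n : nat => `]-oo, 0] `|` `[n.+1%:R^-1, n%:R])%classic.
  apply/esym; rewrite -subTset => x _ /=; have [x0|x0] := leP x 0.
    by exists 0%N => //; left; rewrite /= in_itv.
  pose n := maxn (Num.bound x) (Num.bound x^-1); exists n => //.
  right; rewrite /= in_itv/=; apply/andP; split.
    rewrite invf_ple ?posrE//; apply: le_trans (ltW (archi_boundP _)) _.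
      by rewrite invr_ge0 ltW.
    by rewrite ler_nat leqW// leq_maxr.
  by apply: le_trans (ltW (archi_boundP (ltW x0))) _; rewrite ler_nat leq_maxl.
move=> n; split; first exact: measurableU.
have sub : (`]-oo, 0] `|` `[n.+1%:R^-1, n%:R]) `&` `]0, +oo[ `<=`
    (`[n.+1%:R^-1, n%:R] : set R).
  by move=> x /= [[|//]]; rewrite !in_itv/= andbT => /le_lt_trans /[apply]; rewrite ltxx.
have pos : (`[n.+1%:R^-1, n%:R] : set R) `<=` `]0, +oo[.
  by move=> x /=; rewrite !in_itv/= andbT => /andP[+ _]; apply: lt_le_trans.
apply: (@le_lt_trans _ _
    (\int[leb]_(u in `[n.+1%:R^-1%R, n%:R%R]) (n.+1%:R ^+ 2)%:E)%E); last first.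
  by rewrite integral_cst//= lebesgue_measure_itv/=; case: ifP => _;
    rewrite -?EFinB -?EFinM ?mule0 ltry.
apply: (@le_trans _ _
    (\int[leb]_(u in `[n.+1%:R^-1%R, n%:R%R]) (u ^- 2)%:E)%E).
  apply: ge0_subset_integral => //.
  - by apply: measurableI => //; exact: measurableU.
  - exact: measurable_scale_density.
  - by move=> u _; rewrite lee_fin invr_ge0 sqr_ge0.
apply: ge0_le_integral => //.
- by move=> u _; rewrite lee_fin invr_ge0 sqr_ge0.
- exact: measurable_scale_density.
- move=> u un; rewrite lee_fin -exprVn; have := pos _ un; move: un.
  rewrite /= !in_itv/= andbT => /andP[nu _] u0.
  by rewrite ler_sqr ?nnegrE ?invr_ge0 ?(ltW u0)// invf_ple ?posrE.
Qed.

HB.instance Definition _ := Measure_isSigmaFinite.Build _ _ _ scale_measure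
  scale_measure_sigma_finite.

End scale_measure.

Inductive setting := Wavelet | TimeFreq.

Section localization.
Context (R : realType).
Local Notation leb := (@lebesgue_measure R).
Local Notation L2R := (L2 leb).

Definition expi (t : R) : R[i] := cos t +i* sin t.

Definition fourierL1 (f : R -> R[i]) (xi : R) : R[i] :=
  cintegral leb (fun x => f x * expi (- (2 * pi * x * xi))).

(* Fourier-Plancherel transform: the L2-limit of the Fourier integrals of the
   truncations of F to [-n, n]. *)
Definition fourier (F : L2R) : L2R :=
  xget 0 [set G : L2R |
    (fun n : nat => normL2
       (classL2 leb (fourierL1 (fun x => (\1_`[- n%:R, n%:R] x)%:C * F x)) - G))
    @ \oo --> (0 : R)].

Definition admissible (s : setting) (Psi : L2R) : Prop :=
  match s with
  | Wavelet => {ae leb, forall x, Im (Psi x) = 0} /\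
      {ae leb, forall xi : R,
        (\int[leb]_(t in `]0%R, +oo[)
           ((normc (fourier Psi (t * xi)) ^+ 2) / t)%:E = 1)%E}
  | TimeFreq => normL2 Psi = 1
  end.

Definition G1 (s : setting) : set R :=
  match s with Wavelet => `]0, +oo[ | TimeFreq => setT end.

(* In the wavelet case G1 = ]0, +oo[ is a proper subset of R; zeta1 does not
   charge its complement. *)
Definition zeta1 (s : setting) :
    {sigma_finite_measure set (measurableTypeR R) -> \bar R} :=
  match s with Wavelet => @scale_measure R | TimeFreq => leb end.

Definition zeta (s : setting) := (zeta1 s \x leb)%E.

(* The family Psi_zeta, for zeta = (u, v) resp. (q, p). *)
Definition atom (s : setting) (Psi : L2R) (z : R * R) : L2R :=
  match s with
  | Wavelet => classL2 leb
      (fun x => ((Num.sqrt z.1)^-1)%:C * Psi ((x - z.2) / z.1))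
  | TimeFreq => classL2 leb
      (fun x => expi (2 * pi * z.2 * x) * Psi (x - z.1))
  end.

Definition transform (s : setting) (Psi f : L2R) : L2 (zeta s) :=
  classL2 (zeta s) (fun z => dotL2 f (atom s Psi z)).

Definition transform_range (s : setting) (Psi : L2R) : set (L2 (zeta s)) :=
  range (transform s Psi).
Arguments transform_range : clear implicits.

Definition toeplitz (s : setting) (Psi : L2R) (a : R * R -> R[i])
    (F : transform_range s Psi) : transform_range s Psi :=
  orth_proj F (mulL2 (zeta s) a (set_val F)).
Arguments toeplitz : clear implicits.

Definition ell (s : setting) (Psi : L2R) (z xi : R) : R[i] :=
  match s with
  | Wavelet => (Num.sqrt z)%:C * (fourier Psi (z * xi))^*
  | TimeFreq => (Psi (xi - z))^*
  end.

Definition gamma (s : setting) (Psi : L2R) (Y : set R) (xi : R) : R :=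
  Rintegral (zeta1 s) Y (fun z => normc (ell s Psi z xi) ^+ 2).

(* Frequencies xi in G2 = R at which gamma is determined by the class of Psi.
   In the wavelet case xi = 0 is left out: gamma at 0 is |psihat 0|^2 times the
   integral of du/u over Y, which depends on the representative of psihat and
   never satisfies sum_k gamma_k = 1, as the wavelet reconstruction requires. *)
Definition frequencies (s : setting) : set R :=
  match s with Wavelet => [set xi | xi != 0] | TimeFreq => setT end.

Section partition.
Context (s : setting) (Psi : L2R) (m : nat) (Y : 'I_m -> set R).

Definition strip (k : 'I_m) : set (R * R) :=
  [set z | G1 s z.1 /\ Y k z.1].

Definition symbol (a : 'I_m -> R[i]) (z : R * R) : R[i] :=
  \sum_(k < m) a k * (\1_(strip k) z)%:C.

Definition symbols : set (R * R -> R[i]) := range symbol.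

Definition toeplitz_algebra :
    set (transform_range s Psi -> transform_range s Psi) :=
  Cstar_generated [set toeplitz s Psi a | a in symbols].

Definition nabla : set 'rV[R]_m :=
  closure [set \row_k gamma s Psi (Y k) xi | xi in frequencies s].

End partition.

End localization.

Arguments zeta1 R s : clear implicits.
Arguments G1 R s : clear implicits.
Arguments toeplitz {R} s Psi a F.
Arguments symbol {R} s {m} Y a z.
Arguments toeplitz_algebra {R} s Psi {m} Y.
Arguments nabla {R} s Psi {m} Y.

(* Main.v *)
(* For a fixed scale (resp. time) z the transform of f is, up to a sign, the
   Fourier transform of F * ell(z, .) in the remaining variable, where F is fhat
   (resp. f).  By Tonelli and Plancherel this defines an isometry U of L2(R) onto
   the range of the transform with <a U F, U G> = <gamma_a F, G> for every symbol
   a depending on z only, so U conjugates the Toeplitz operator of a to the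
   multiplication by gamma_a.  The multiplications by g o (gamma_1, ..., gamma_m),
   with g continuous on nabla, form a C*-algebra containing the generators.
   Since each gamma_k is, up to a continuous factor, the squared norm of the
   restriction to Y_k of an affine change of variable of a fixed L2 function, it
   is continuous, whence the operator norm of such a multiplication is the
   supremum of |g| on nabla.  Since the gamma_k sum to 1 the constants belong to
   the generated algebra, and the Stone-Weierstrass theorem on the compact set
   nabla shows that it contains every g.

   Plancherel's theorem is obtained by Abel summation: the integral of
   |fhat(xi)|^2 exp(-e|xi|) is a Poisson mean of the autocorrelation of f, which is
   continuous at 0. *)

Require Import Defs.
From HB Require Import structures.
From mathcomp Require Import all_boot all_order all_algebra complex ring_quotient.
From mathcomp Require Import all_classical all_reals all_analysis.
From mathcomp Require Import measurable_realfun.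
From mathcomp Require Import ring lra.
Import Order.TTheory GRing.Theory Num.Theory.
Import numFieldNormedType.Exports.

Set Implicit Arguments.
Unset Strict Implicit.
Unset Printing Implicit Defensive.
Local Open Scope complex_scope.
Local Open Scope quotient_scope.
Local Open Scope classical_set_scope.
Local Open Scope ring_scope.

Local Notation Re := (@complex.Re _).
Local Notation Im := (@complex.Im _).
Local Notation normc := ComplexField.Normc.normc.

(** * Complex-valued functions and the Hilbert space L2 *)

(** The Fourier integral inside U is taken pointwise, as an L1 integral: for almost every z the
    function F * ell(z, .) is a product of two L2 functions, hence integrable, and Tonelli with int
    |ell(z, xi)|^2 dz = 1 makes it square integrable as well. So Plancherel on L1 and L2 together is
    applied slice by slice, and joint measurability comes for free. The extension to all of L2
    passes from f to fhat in the wavelet case. There it must be onto, for the range of U to be the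
    range of the transform. Surjectivity is obtained from the adjoint, again an isometry by symmetry
    of the kernel, instead of an inversion formula. Admissibility holds for almost every frequency,
    whereas nabla is a closure of values at all nonzero frequencies. Invariance of dt/t under
    dilations closes the gap: the admissibility integral depends only on the sign of xi. That tau is
    generated by its values on the generators is the uniqueness clause of the conclusion: the
    operators on which two such maps agree form a C*-algebra. *)

Section complex_numbers.
Context (R : realType).
Implicit Types (z w : R[i]) (r : R).

Lemma conjcE z : z^* = conjc z. Proof. by []. Qed.

Lemma sqr_normcE z : normc z ^+ 2 = Re z ^+ 2 + Im z ^+ 2.
Proof. by case: z => a b /=; rewrite sqr_sqrtr// addr_ge0// sqr_ge0. Qed.

Lemma normc_ge0 z : 0 <= normc z.
Proof. by case: z => a b; exact: sqrtr_ge0. Qed.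

Lemma normcD z w : normc (z + w) <= normc z + normc w.
Proof. exact: (@complex.le_normcD R). Qed.

Lemma normcM z w : normc (z * w) = normc z * normc w.
Proof. exact: ComplexField.Normc.normcM. Qed.

Lemma normcN z : normc (- z) = normc z.
Proof. exact: (@complex.normcN R). Qed.

Lemma normcB z w : normc (z - w) <= normc z + normc w.
Proof. by rewrite -(normcN w); exact: normcD. Qed.

Lemma normc0 : normc (0 : R[i]) = 0.
Proof. exact: ComplexField.Normc.normc0. Qed.

Lemma normc1 : normc (1 : R[i]) = 1.
Proof. exact: ComplexField.Normc.normc1. Qed.

Lemma normc_eq0 z : normc z = 0 -> z = 0.
Proof. exact: ComplexField.Normc.eq0_normc. Qed.

Lemma normcJ z : normc z^* = normc z.
Proof. by rewrite conjcE; case: z => a b /=; rewrite sqrrN. Qed.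

Lemma normc_real r : normc r%:C = `|r|.
Proof. by rewrite /= expr0n/= addr0 sqrtr_sqr. Qed.

Lemma mulCJ z : z * z^* = (normc z ^+ 2)%:C.
Proof.
rewrite conjcE sqr_normcE; case: z => a b; apply/eqP; rewrite eq_complex/=.
by apply/andP; split; apply/eqP; ring.
Qed.

Lemma Re_mulc z w : Re (z * w) = Re z * Re w - Im z * Im w.
Proof. by case: z; case: w. Qed.

Lemma Im_mulc z w : Im (z * w) = Re z * Im w + Im z * Re w.
Proof. by case: z => ? ?; case: w. Qed.

Lemma Re_addc z w : Re (z + w) = Re z + Re w. Proof. by case: z; case: w. Qed.

Lemma Im_addc z w : Im (z + w) = Im z + Im w. Proof. by case: z; case: w. Qed.

Lemma Re_oppc z : Re (- z) = - Re z. Proof. by case: z. Qed.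

Lemma Im_oppc z : Im (- z) = - Im z. Proof. by case: z. Qed.

Lemma Re_conjc z : Re z^* = Re z. Proof. by rewrite conjcE; case: z. Qed.

Lemma Im_conjc z : Im z^* = - Im z. Proof. by rewrite conjcE; case: z. Qed.

Lemma conjcD z w : (z + w)^* = z^* + w^*. Proof. exact: rmorphD. Qed.

Lemma conjcM z w : (z * w)^* = z^* * w^*. Proof. exact: rmorphM. Qed.

Lemma conjcN z : (- z)^* = - z^*. Proof. exact: rmorphN. Qed.

Lemma conjcR r : (r%:C)^* = r%:C :> R[i].
Proof. by rewrite conjcE; apply/eqP; rewrite eq_complex/= oppr0 !eqxx. Qed.

Lemma normr_Re_le z : `|Re z| <= normc z.
Proof.
rewrite -(@ler_pXn2r _ 2)// ?nnegrE ?normc_ge0// real_normK ?num_real//.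
by rewrite sqr_normcE lerDl sqr_ge0.
Qed.

Lemma normr_Im_le z : `|Im z| <= normc z.
Proof.
rewrite -(@ler_pXn2r _ 2)// ?nnegrE ?normc_ge0// real_normK ?num_real//.
by rewrite sqr_normcE lerDr sqr_ge0.
Qed.

Lemma Re_le_normc z : Re z <= normc z.
Proof. exact: le_trans (ler_norm _) (normr_Re_le _). Qed.

Lemma normc_le_ReIm z : normc z <= `|Re z| + `|Im z|.
Proof.
rewrite -(@ler_pXn2r _ 2)// ?nnegrE ?normc_ge0 ?addr_ge0//.
rewrite sqr_normcE sqrrD !real_normK ?num_real// [leRHS]addrAC lerDl.
by rewrite mulrn_wge0// mulr_ge0.
Qed.

(** The difference of the two sides is the squared modulus of z - w. *)
Lemma sqr_normcD z w : normc (z + w) ^+ 2 <= 2 * normc z ^+ 2 + 2 * normc w ^+ 2.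
Proof.
rewrite !sqr_normcE Re_addc Im_addc -subr_ge0.
set a := Re z; set b := Im z; set c := Re w; set d := Im w.
have -> : 2 * (a ^+ 2 + b ^+ 2) + 2 * (c ^+ 2 + d ^+ 2) -
  ((a + c) ^+ 2 + (b + d) ^+ 2) = (a - c) ^+ 2 + (b - d) ^+ 2 by ring.
by rewrite addr_ge0// sqr_ge0.
Qed.

Lemma normc_mul_le z w : normc (z * w) <= normc z ^+ 2 + normc w ^+ 2.
Proof.
rewrite normcM; have := sqr_ge0 (normc z - normc w).
have := normc_ge0 z; have := normc_ge0 w; nra.
Qed.

Lemma scaleRC r z : r%:C * z = (r * Re z) +i* (r * Im z).
Proof. by case: z => a b; apply/eqP; rewrite eq_complex/= !mul0r subr0 addr0 !eqxx. Qed.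

Lemma complexP z w : Re z = Re w -> Im z = Im w -> z = w.
Proof. by case: z => a b; case: w => c d /= -> ->. Qed.

Lemma dist_normc z w : `|normc z - normc w| <= normc (z - w).
Proof.
rewrite ler_norml lerBlDr lerNl opprB lerBlDr; apply/andP; split.
- by rewrite -(normcN (z - w)) opprB (le_trans _ (normcD _ _))// subrK.
- by rewrite (le_trans _ (normcD _ _))// subrK.
Qed.

End complex_numbers.

(** * Measurability of complex-valued functions *)

Section complex_measurable.
Context d (T : measurableType d) (R : realType).
Implicit Types f g : T -> R[i].

(** Componentwise, in line with [cintegral] and [square_integrable], which are also defined through
    the real and imaginary parts. *)
Definition cmeasurable f := measurable_fun setT (fun x => Re (f x)) /\
  measurable_fun setT (fun x => Im (f x)).

Lemma cmeasurable_cst c : cmeasurable (fun=> c).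
Proof. by split; exact: measurable_cst. Qed.

Lemma cmeasurableD f g : cmeasurable f -> cmeasurable g ->
  cmeasurable (fun x => f x + g x).
Proof.
move=> [f1 f2] [g1 g2]; split.
- by under eq_fun do rewrite Re_addc; exact: measurable_funD.
- by under eq_fun do rewrite Im_addc; exact: measurable_funD.
Qed.

Lemma cmeasurableM f g : cmeasurable f -> cmeasurable g ->
  cmeasurable (fun x => f x * g x).
Proof.
move=> [f1 f2] [g1 g2]; split.
- by under eq_fun do rewrite Re_mulc; apply: measurable_funB; exact: measurable_funM.
- by under eq_fun do rewrite Im_mulc; apply: measurable_funD; exact: measurable_funM.
Qed.

Lemma cmeasurableJ f : cmeasurable f -> cmeasurable (fun x => (f x)^*).
Proof.
move=> [f1 f2]; split; first by under eq_fun do rewrite Re_conjc.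
by under eq_fun do rewrite Im_conjc; exact: measurable_funN.
Qed.

Lemma cmeasurableN f : cmeasurable f -> cmeasurable (fun x => - f x).
Proof.
move=> [f1 f2]; split.
- by under eq_fun do rewrite Re_oppc; exact: measurable_funN.
- by under eq_fun do rewrite Im_oppc; exact: measurable_funN.
Qed.

Lemma cmeasurableB f g : cmeasurable f -> cmeasurable g ->
  cmeasurable (fun x => f x - g x).
Proof. by move=> mf mg; exact: (cmeasurableD mf (cmeasurableN mg)). Qed.

Lemma cmeasurableR (r : T -> R) : measurable_fun setT r ->
  cmeasurable (fun x => (r x)%:C).
Proof. by move=> mr; split => //=; exact: measurable_cst. Qed.

Lemma measurable_sqr_normc f : cmeasurable f ->
  measurable_fun setT (fun x => normc (f x) ^+ 2).
Proof.
move=> [f1 f2]; under eq_fun do rewrite sqr_normcE.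
by apply: measurable_funD; exact: measurable_funX.
Qed.

Lemma measurable_normc f : cmeasurable f ->
  measurable_fun setT (fun x => normc (f x)).
Proof.
move=> mf.
rewrite (_ : (fun _ => _) = (@Num.sqrt R) \o (fun x => normc (f x) ^+ 2)); last first.
  by apply/funext => x /=; rewrite sqrtr_sqr ger0_norm// normc_ge0.
apply: measurableT_comp; last exact: measurable_sqr_normc.
by apply: continuous_measurable_fun; exact: sqrt_continuous.
Qed.

End complex_measurable.

Lemma cmeasurable_comp d1 d2 (T1 : measurableType d1) (T2 : measurableType d2)
    (R : realType) (f : T2 -> R[i]) (h : T1 -> T2) :
  cmeasurable f -> measurable_fun setT h -> cmeasurable (fun x => f (h x)).
Proof.
by move=> [f1 f2] mh; split;
  [exact: (measurableT_comp f1 mh)|exact: (measurableT_comp f2 mh)].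
Qed.

(** * Integrable and square-integrable complex functions *)

Section complex_integral.
Context d (T : measurableType d) (R : realType) (mu : {measure set T -> \bar R}).
Implicit Types (f g : T -> R[i]) (c : R[i]).

Definition cL1 f := cmeasurable f /\
  mu.-integrable setT (fun x => (normc (f x))%:E).

(** The working form of [square_integrable] (see [cL2P]): one bound on the squared modulus replaces
    two membership conditions, which suits arguments by domination. *)
Definition cL2 f := cmeasurable f /\
  mu.-integrable setT (fun x => (normc (f x) ^+ 2)%:E).

Lemma le_ge0_integrable (u v : T -> R) : measurable_fun setT u ->
  (forall x, `|u x| <= v x) -> mu.-integrable setT (EFin \o v) ->
  mu.-integrable setT (EFin \o u).
Proof.
move=> mu_ uv iv; apply: (@le_integrable _ _ _ mu _ measurableT (EFin \o u) (EFin \o v)) => //.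
  exact/measurable_EFinP.
move=> x _ /=; rewrite lee_fin.
by rewrite [leRHS]ger0_norm// (le_trans _ (uv x)).
Qed.

Lemma integrableRD (u v : T -> R) : mu.-integrable setT (EFin \o u) ->
  mu.-integrable setT (EFin \o v) ->
  mu.-integrable setT (EFin \o (fun x => u x + v x)).
Proof. by move=> iu iv; apply: eq_integrable (integrableD measurableT iu iv). Qed.

Lemma integrableRZ (k : R) (u : T -> R) : mu.-integrable setT (EFin \o u) ->
  mu.-integrable setT (EFin \o (fun x => k * u x)).
Proof. by move=> iu; apply: eq_integrable (integrableZl measurableT k iu). Qed.

Lemma le_cL1 f (v : T -> R) : cmeasurable f -> (forall x, normc (f x) <= v x) ->
  mu.-integrable setT (EFin \o v) -> cL1 f.
Proof.
move=> mf fv iv; split => //; apply: le_ge0_integrable iv.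
  exact: measurable_normc.
by move=> x; rewrite ger0_norm ?normc_ge0.
Qed.

Lemma cL1_Re f : cL1 f -> mu.-integrable setT (EFin \o (fun x => Re (f x))).
Proof.
move=> [[f1 f2] fi]; apply: le_ge0_integrable fi => // x.
exact: normr_Re_le.
Qed.

Lemma cL1_Im f : cL1 f -> mu.-integrable setT (EFin \o (fun x => Im (f x))).
Proof.
move=> [[f1 f2] fi]; apply: le_ge0_integrable fi => // x.
exact: normr_Im_le.
Qed.

Lemma cL1_ReIm f : mu.-integrable setT (EFin \o (fun x => Re (f x))) ->
  mu.-integrable setT (EFin \o (fun x => Im (f x))) -> cL1 f.
Proof.
move=> f1 f2.
have mf : cmeasurable f.
  by split; [exact/measurable_EFinP/(measurable_int _ f1)|
    exact/measurable_EFinP/(measurable_int _ f2)].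
have := integrableRD (integrable_norm f1) (integrable_norm f2).
by apply: le_cL1 => // x; exact: normc_le_ReIm.
Qed.

Lemma cL1_0 : cL1 (fun=> 0).
Proof. by apply: cL1_ReIm => /=; exact: integrable0. Qed.

Lemma cL1D f g : cL1 f -> cL1 g -> cL1 (fun x => f x + g x).
Proof.
move=> [mf fi] [mg gi]; apply: le_cL1 (integrableRD fi gi).
- exact: cmeasurableD.
- by move=> x; exact: normcD.
Qed.

Lemma cL1Z c f : cL1 f -> cL1 (fun x => c * f x).
Proof.
move=> [mf fi]; apply: le_cL1 (integrableRZ (normc c) fi).
- by apply: cmeasurableM => //; exact: cmeasurable_cst.
- by move=> x; rewrite normcM.
Qed.

Lemma cL1N f : cL1 f -> cL1 (fun x => - f x).
Proof. by move=> /(cL1Z (-1)); under eq_fun do rewrite mulN1r. Qed.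

Lemma cL1B f g : cL1 f -> cL1 g -> cL1 (fun x => f x - g x).
Proof. by move=> fi gi; exact: (cL1D fi (cL1N gi)). Qed.

Lemma cL1J f : cL1 f -> cL1 (fun x => (f x)^*).
Proof.
move=> [mf fi]; apply: le_cL1 fi; first exact: cmeasurableJ.
by move=> x; rewrite normcJ.
Qed.

Lemma cL1R (r : T -> R) : mu.-integrable setT (EFin \o r) ->
  cL1 (fun x => (r x)%:C).
Proof. by move=> ri; apply: cL1_ReIm => //=; exact: integrable0. Qed.

Lemma eq_cintegral f g : (forall x, f x = g x) ->
  cintegral mu f = cintegral mu g.
Proof. by move=> fg; congr cintegral; exact/funext. Qed.

Lemma cintegralD f g : cL1 f -> cL1 g ->
  cintegral mu (fun x => f x + g x) = cintegral mu f + cintegral mu g.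
Proof.
move=> fi gi; apply: complexP; rewrite ?Re_addc ?Im_addc /=.
- under eq_Rintegral do rewrite Re_addc.
  by rewrite RintegralD//; exact: cL1_Re.
- under eq_Rintegral do rewrite Im_addc.
  by rewrite RintegralD//; exact: cL1_Im.
Qed.

Lemma cintegralZ c f : cL1 f ->
  cintegral mu (fun x => c * f x) = c * cintegral mu f.
Proof.
move=> fi; have f1 := cL1_Re fi; have f2 := cL1_Im fi.
apply: complexP; rewrite ?Re_mulc ?Im_mulc /=.
- under eq_Rintegral do rewrite Re_mulc.
  rewrite RintegralB//; [|exact: integrableRZ..].
  by rewrite !RintegralZl.
- under eq_Rintegral do rewrite Im_mulc.
  rewrite RintegralD//; [|exact: integrableRZ..].
  by rewrite !RintegralZl.
Qed.

Lemma cintegralN f : cL1 f ->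
  cintegral mu (fun x => - f x) = - cintegral mu f.
Proof.
by move=> fi; under eq_cintegral do rewrite -mulN1r; rewrite cintegralZ// mulN1r.
Qed.

Lemma cintegralB f g : cL1 f -> cL1 g ->
  cintegral mu (fun x => f x - g x) = cintegral mu f - cintegral mu g.
Proof. by move=> fi gi; rewrite cintegralD ?cintegralN//; exact: cL1N. Qed.

Lemma cintegralJ f : cL1 f ->
  cintegral mu (fun x => (f x)^*) = (cintegral mu f)^*.
Proof.
move=> fi; have f2 := cL1_Im fi.
apply: complexP; rewrite ?Re_conjc ?Im_conjc /=.
- by under eq_Rintegral do rewrite Re_conjc.
- under eq_Rintegral do rewrite Im_conjc -mulN1r.
  by rewrite RintegralZl// mulN1r.
Qed.

Lemma cintegralR (r : T -> R) :
  cintegral mu (fun x => (r x)%:C) = (Rintegral mu setT r)%:C.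
Proof.
apply: complexP => //=.
by rewrite Rintegral_cst// mul0r.
Qed.

Lemma cintegral0 : cintegral mu (fun=> 0) = 0.
Proof. by rewrite (@cintegralR (fun=> 0)) Rintegral_cst// mul0r. Qed.

(* Rotating the integral onto the positive axis reduces to the real case. *)
Lemma normc_cintegral_le f : cL1 f ->
  normc (cintegral mu f) <= Rintegral mu setT (fun x => normc (f x)).
Proof.
move=> fi; set I := cintegral mu f.
have [->|I0] := eqVneq I 0.
  by rewrite normc0; apply: Rintegral_ge0 => x _; exact: normc_ge0.
have nI0 : 0 < normc I.
  by rewrite lt_neqAle normc_ge0 andbT eq_sym; apply: contra I0 => /eqP/normc_eq0/eqP.
pose c := ((normc I)^-1)%:C * I^*.
have nc : normc c = 1.
  by rewrite /c normcM normc_real normcJ ger0_norm ?invr_ge0 ?normc_ge0// mulVf// gt_eqF.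
have -> : normc I = Re (c * I).
  rewrite /c -mulrA (mulrC _ I) mulCJ Re_mulc/= mulr0 subr0.
  by rewrite expr2 mulrA mulVf ?mul1r// gt_eqF.
rewrite -cintegralZ//=; apply: le_Rintegral => //.
- exact/cL1_Re/cL1Z.
- by case: fi.
- by move=> x _; rewrite (le_trans (Re_le_normc _))// normcM nc mul1r.
Qed.

Lemma ae_eq_cintegral f g : cmeasurable f -> cmeasurable g ->
  f = g %[ae mu] -> cintegral mu f = cintegral mu g.
Proof.
move=> [f1 f2] [g1 g2] fg; apply: complexP => /=; rewrite /Rintegral; congr fine;
  apply: ae_eq_integral => //; try exact/measurable_EFinP;
  by apply: filterS fg => x /= fgx /fgx ->.
Qed.

Lemma ae_eq_integrable (u v : T -> R) : measurable_fun setT v ->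
  u = v %[ae mu] -> mu.-integrable setT (EFin \o u) ->
  mu.-integrable setT (EFin \o v).
Proof.
move=> mv uv /integrableP[mu_ ui]; apply/integrableP; split.
  exact/measurable_EFinP.
rewrite (le_lt_trans _ ui)//; apply: ae_ge0_le_integral => //.
- by apply: measurableT_comp => //; exact/measurable_EFinP.
- exact: measurableT_comp.
- by apply: filterS uv => x /= uvx /uvx ->.
Qed.

Lemma ae_eq_cL1 f g : cmeasurable g -> f = g %[ae mu] -> cL1 f -> cL1 g.
Proof.
move=> mg fg [mf fi]; split => //.
apply: ae_eq_integrable fi; first exact: measurable_normc.
by apply: filterS fg => x /= fgx /fgx ->.
Qed.

Lemma ae_eq_cL2 f g : cmeasurable g -> f = g %[ae mu] -> cL2 f -> cL2 g.
Proof.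
move=> mg fg [mf fi]; split => //.
apply: ae_eq_integrable fi; first exact: measurable_sqr_normc.
by apply: filterS fg => x /= fgx /fgx ->.
Qed.

Lemma le_cL2 f (v : T -> R) : cmeasurable f ->
  (forall x, normc (f x) ^+ 2 <= v x) ->
  mu.-integrable setT (EFin \o v) -> cL2 f.
Proof.
move=> mf fv iv; split => //; apply: le_ge0_integrable iv.
  exact: measurable_sqr_normc.
by move=> x; rewrite ger0_norm ?sqr_ge0.
Qed.

Lemma cL2D f g : cL2 f -> cL2 g -> cL2 (fun x => f x + g x).
Proof.
move=> [mf fi] [mg gi].
apply: le_cL2 (integrableRD (integrableRZ 2 fi) (integrableRZ 2 gi)).
- exact: cmeasurableD.
- by move=> x; exact: sqr_normcD.
Qed.

Lemma cL2Z c f : cL2 f -> cL2 (fun x => c * f x).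
Proof.
move=> [mf fi]; apply: le_cL2 (integrableRZ (normc c ^+ 2) fi).
- by apply: cmeasurableM => //; exact: cmeasurable_cst.
- by move=> x; rewrite normcM exprMn.
Qed.

Lemma cL2B f g : cL2 f -> cL2 g -> cL2 (fun x => f x - g x).
Proof.
move=> fL /(cL2Z (-1)) gL.
by have := cL2D fL gL; under eq_fun do rewrite mulN1r.
Qed.

Lemma cL2J f : cL2 f -> cL2 (fun x => (f x)^*).
Proof.
move=> [mf fi]; apply: le_cL2 fi; first exact: cmeasurableJ.
by move=> x; rewrite normcJ.
Qed.

Lemma cL2_cL1M f g : cL2 f -> cL2 g -> cL1 (fun x => f x * g x).
Proof.
move=> [mf fi] [mg gi]; apply: le_cL1 (integrableRD fi gi).
- exact: cmeasurableM.
- by move=> x; exact: normc_mul_le.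
Qed.

Lemma cL2_bounded_mul f g (M : R) : cmeasurable g ->
  (forall x, normc (g x) <= M) -> cL2 f -> cL2 (fun x => g x * f x).
Proof.
move=> mg gM [mf fi]; apply: le_cL2 (integrableRZ (M ^+ 2) fi).
- exact: cmeasurableM.
- move=> x; rewrite normcM exprMn ler_wpM2r ?sqr_ge0//.
  have g0 := normc_ge0 (g x).
  by rewrite ler_pXn2r// ?nnegrE//; exact: le_trans (gM x).
Qed.

Lemma Lfun2P (u : T -> R) : u \in Lfun mu 2%:E <->
  measurable_fun setT u /\ mu.-integrable setT (EFin \o (fun x => u x ^+ 2)).
Proof.
split=> [uL|[mu_ ui]].
  split; last exact: Lfun2_integrable_sqr.
  by move: uL; rewrite inE => /andP[/[!inE]].
rewrite inE; apply/andP; split; first by rewrite inE.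
rewrite inE/= /finite_norm unlock poweR_lty//.
case/integrableP : ui => _; apply: le_lt_trans; apply: ge0_le_integral => //.
- by move=> x _ /=; rewrite lee_fin powR_ge0.
- apply/measurable_EFinP/(@measurableT_comp _ _ _ _ _ _ (fun x : R => x `^ 2)%R) => //.
  exact/measurableT_comp.
- apply: measurableT_comp => //; apply/measurable_EFinP; exact: measurable_funX.
- by move=> x _; rewrite lee_fin normrX powR_mulrn.
Qed.

Lemma cL2P f : cL2 f <-> f \in square_integrable mu.
Proof.
split=> [[[f1 f2] fi]|].
  apply/andP; split; apply/Lfun2P; split => //.
  - apply: le_ge0_integrable fi; first exact: measurable_funX.
    by move=> x; rewrite sqr_normcE ger0_norm ?sqr_ge0// lerDl sqr_ge0.
  - apply: le_ge0_integrable fi; first exact: measurable_funX.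
    by move=> x; rewrite sqr_normcE ger0_norm ?sqr_ge0// lerDr sqr_ge0.
move=> /andP[/Lfun2P[f1 f1i] /Lfun2P[f2 f2i]].
apply: le_cL2 (integrableRD f1i f2i) => //.
by move=> x; rewrite sqr_normcE.
Qed.

Lemma L2_cL2 (F : L2 mu) : cL2 F.
Proof. by apply/cL2P; exact: L2fun_valP. Qed.

Lemma L2_cmeasurable (F : L2 mu) : cmeasurable F.
Proof. by case: (L2_cL2 F). Qed.

Lemma L2P (F G : L2 mu) : (F : T -> R[i]) = G %[ae mu] <-> F = G.
Proof.
split=> [FG|-> //]; last exact: ae_eq_refl.
by rewrite -(reprK F) -(reprK G); apply/pi_L2_eq.
Qed.

(** The choices hidden in the quotient, the default of [insubd] in [classL2] and the representative
    picked by the coercion, disappear up to a null set. *)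
Lemma classL2K f : cL2 f -> (classL2 mu f : T -> R[i]) = f %[ae mu].
Proof.
move=> /cL2P fL.
have : \pi_(L2 mu) (repr (classL2 mu f)) = classL2 mu f by rewrite reprK.
by move=> /pi_L2_eq; rewrite insubdK.
Qed.

Lemma eq_classL2 f g : cL2 f -> cL2 g -> f = g %[ae mu] ->
  classL2 mu f = classL2 mu g.
Proof.
move=> fL gL fg; apply/L2P.
apply: ae_eq_trans (classL2K fL) _; apply: ae_eq_trans fg _.
exact/ae_eq_sym/classL2K.
Qed.

Lemma classL2_repr (F : L2 mu) : classL2 mu F = F.
Proof. by apply/L2P/classL2K; exact: L2_cL2. Qed.

Lemma L2_addE (F G : L2 mu) :
  ((F + G : L2 mu) : T -> R[i]) = (fun x => F x + G x) %[ae mu].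
Proof.
have : \pi_(L2 mu) (repr (F + G)) = \pi_(L2 mu) (repr F + repr G).
  by rewrite reprK pi_add_L2 !reprK.
by move=> /pi_L2_eq; apply: filterS => x /= h /h; rewrite /L2_repr => ->.
Qed.

Lemma L2_scaleE c (F : L2 mu) :
  ((c *: F : L2 mu) : T -> R[i]) = (fun x => c * F x) %[ae mu].
Proof.
have : \pi_(L2 mu) (repr (c *: F)) = \pi_(L2 mu) (c *: repr F).
  by rewrite reprK.
by move=> /pi_L2_eq; apply: filterS => x /= h /h; rewrite /L2_repr => ->.
Qed.

Lemma L2_oppE (F : L2 mu) :
  ((- F : L2 mu) : T -> R[i]) = (fun x => - F x) %[ae mu].
Proof.
have := L2_scaleE (-1) F; rewrite scaleN1r.
by apply: filterS => x /= h /h ->; rewrite mulN1r.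
Qed.

Lemma L2_subE (F G : L2 mu) :
  ((F - G : L2 mu) : T -> R[i]) = (fun x => F x - G x) %[ae mu].
Proof.
have := L2_addE F (- G); have := L2_oppE G.
by apply: filterS2 => x /= h1 h2 _; rewrite h2// h1.
Qed.

Lemma L2_0E : ((0 : L2 mu) : T -> R[i]) = (fun=> 0) %[ae mu].
Proof.
have := L2_scaleE 0 0; rewrite scale0r.
by apply: filterS => x /= h /h ->; rewrite mul0r.
Qed.

Lemma classL2D f g : cL2 f -> cL2 g ->
  classL2 mu (fun x => f x + g x) = classL2 mu f + classL2 mu g.
Proof.
move=> fL gL; apply/L2P; apply: ae_eq_trans (classL2K (cL2D fL gL)) _.
apply: ae_eq_sym; apply: ae_eq_trans (L2_addE _ _) _.
have := classL2K fL; have := classL2K gL.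
by apply: filterS2 => x /= h1 h2 _; rewrite h1// h2.
Qed.

Lemma classL2Z c f : cL2 f ->
  classL2 mu (fun x => c * f x) = c *: classL2 mu f.
Proof.
move=> fL; apply/L2P; apply: ae_eq_trans (classL2K (cL2Z c fL)) _.
apply: ae_eq_sym; apply: ae_eq_trans (L2_scaleE _ _) _.
by have := classL2K fL; apply: filterS => x /= h1 _; rewrite h1.
Qed.

Lemma classL2B f g : cL2 f -> cL2 g ->
  classL2 mu (fun x => f x - g x) = classL2 mu f - classL2 mu g.
Proof.
move=> fL gL; rewrite -scaleN1r -classL2Z// -classL2D//; last exact: cL2Z.
by congr classL2; apply/funext => x; rewrite mulN1r.
Qed.

Lemma dot_classL2 f g : cL2 f -> cL2 g ->
  dotL2 (classL2 mu f) (classL2 mu g) = cintegral mu (fun x => f x * (g x)^*).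
Proof.
move=> fL gL; apply: ae_eq_cintegral.
- by apply: cmeasurableM; [|apply: cmeasurableJ]; exact: L2_cmeasurable.
- by case: fL gL => mf _ [mg _]; apply: cmeasurableM => //; exact: cmeasurableJ.
- have := classL2K fL; have := classL2K gL.
  by apply: filterS2 => x /= h1 h2 _; rewrite h1// h2.
Qed.

(** * Inner product and norm *)

Local Notation dot := (@dotL2 _ _ _ mu).
Local Notation norm := (@normL2 _ _ _ mu).
Implicit Types F G H : L2 mu.

Lemma cL2_dot F G : cL1 (fun x => F x * (G x)^*).
Proof. by apply: cL2_cL1M; [|apply: cL2J]; exact: L2_cL2. Qed.

Lemma dotDl F G H : dot (F + G) H = dot F H + dot G H.
Proof.
rewrite /dotL2 -cintegralD//; [|exact: cL2_dot..]; apply: ae_eq_cintegral.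
- by case: (cL2_dot (F + G) H).
- by case: (cL1D (cL2_dot F H) (cL2_dot G H)).
- by have := L2_addE F G; apply: filterS => x /= h _; rewrite h// mulrDl.
Qed.

Lemma dotZl c F G : dot (c *: F) G = c * dot F G.
Proof.
rewrite /dotL2 -cintegralZ//; [|exact: cL2_dot..]; apply: ae_eq_cintegral.
- by case: (cL2_dot (c *: F) G).
- by case: (cL1Z c (cL2_dot F G)).
- by have := L2_scaleE c F; apply: filterS => x /= h _; rewrite h// mulrA.
Qed.

Lemma dotC F G : dot F G = (dot G F)^*.
Proof.
rewrite /dotL2 -cintegralJ; last exact: cL2_dot.
by apply: eq_cintegral => x; rewrite conjcM conjCK mulrC.
Qed.

Lemma dotDr F G H : dot F (G + H) = dot F G + dot F H.
Proof. by rewrite dotC dotDl conjcD -!dotC. Qed.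

Lemma dotZr c F G : dot F (c *: G) = c^* * dot F G.
Proof. by rewrite dotC dotZl conjcM -dotC. Qed.

Lemma dotNl F G : dot (- F) G = - dot F G.
Proof. by rewrite -scaleN1r dotZl mulN1r. Qed.

Lemma dotNr F G : dot F (- G) = - dot F G.
Proof. by rewrite dotC dotNl conjcN -dotC. Qed.

Lemma dotBl F G H : dot (F - G) H = dot F H - dot G H.
Proof. by rewrite dotDl dotNl. Qed.

Lemma dotBr F G H : dot F (G - H) = dot F G - dot F H.
Proof. by rewrite dotDr dotNr. Qed.

Lemma dot0l F : dot 0 F = 0.
Proof. by rewrite -(scale0r 0) dotZl mul0r. Qed.

Lemma dot0r F : dot F 0 = 0.
Proof. by rewrite dotC dot0l conjC0. Qed.

Lemma dot_sqr F : dot F F = (Rintegral mu setT (fun x => normc (F x) ^+ 2))%:C.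
Proof. by rewrite /dotL2 -cintegralR; apply: eq_cintegral => x; rewrite mulCJ. Qed.

Lemma normL2_ge0 F : 0 <= norm F. Proof. exact: sqrtr_ge0. Qed.

Lemma sqr_normL2 F : norm F ^+ 2 = Rintegral mu setT (fun x => normc (F x) ^+ 2).
Proof.
rewrite /normL2 dot_sqr/= sqr_sqrtr//.
by apply: Rintegral_ge0 => x _; rewrite sqr_ge0.
Qed.

Lemma dot_normL2 F : dot F F = (norm F ^+ 2)%:C.
Proof. by rewrite sqr_normL2 dot_sqr. Qed.

(** In extended-real form, so that Tonelli and the comparison of nonnegative integrals apply to
    norms without integrability side conditions. *)
Lemma sqr_normL2E F :
  ((norm F ^+ 2)%:E = \int[mu]_x (normc (F x) ^+ 2)%:E)%E.
Proof.
rewrite sqr_normL2 /Rintegral fineK//.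
by apply: integrable_fin_num => //; case: (L2_cL2 F).
Qed.

Lemma sqr_norm_classL2 (f : T -> R[i]) : cL2 f ->
  ((norm (classL2 mu f) ^+ 2)%:E = \int[mu]_x (normc (f x) ^+ 2)%:E)%E.
Proof.
move=> fL; rewrite sqr_normL2E; apply: ae_eq_integral => //.
- apply/measurable_EFinP; apply: measurable_sqr_normc; exact: L2_cmeasurable.
- by apply/measurable_EFinP; apply: measurable_sqr_normc; case: fL.
- by have := classL2K fL; apply: filterS => x /= h _; rewrite h.
Qed.

Lemma normL2_0 : norm 0 = 0.
Proof. by rewrite /normL2 dot0l/= sqrtr0. Qed.

Lemma normL2_eq0 F : norm F = 0 -> F = 0.
Proof.
move=> F0; apply/L2P; apply: ae_eq_trans (ae_eq_sym (L2_0E)).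
have /esym := sqr_normL2E F; rewrite F0 expr0n/=.
have mF := measurable_sqr_normc (L2_cmeasurable F).
have -> : (\int[mu]_x (normc (F x) ^+ 2)%:E =
   \int[mu]_x `|(normc (F x) ^+ 2)%:E|)%E.
  by apply: eq_integral => x _; rewrite gee0_abs// lee_fin sqr_ge0.
move=> /(ae_eq_integral_abs mu measurableT _).1 h.
have {}h := h (proj2 (measurable_EFinP _ _) mF).
apply: filterS h => x /= h _; apply: normc_eq0; have [/eqP] := h I.
by rewrite sqrf_eq0 => /eqP.
Qed.
Lemma normL2Z c F : norm (c *: F) = normc c * norm F.
Proof.
apply/eqP; rewrite -(@eqrXn2 _ 2)// ?mulr_ge0 ?normL2_ge0 ?normc_ge0//.
apply/eqP/(@complexI R).
by rewrite -dot_normL2 dotZl dotZr mulrA mulCJ dot_normL2 exprMn -rmorphM.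
Qed.

Lemma normL2N F : norm (- F) = norm F.
Proof. by rewrite -scaleN1r normL2Z normcN normc1 mul1r. Qed.

Lemma normL2BC F G : norm (F - G) = norm (G - F).
Proof. by rewrite -normL2N opprB. Qed.

Lemma normL2_sqrD F G :
  norm (F + G) ^+ 2 = norm F ^+ 2 + 2 * Re (dot F G) + norm G ^+ 2.
Proof.
have h A : norm A ^+ 2 = Re (dot A A) by rewrite dot_normL2.
rewrite !h !dotDl !dotDr !Re_addc (dotC G F) Re_conjc; ring.
Qed.

Lemma normc_dot_le F G : normc (dot F G) <= norm F * norm G.
Proof.
have nF := normL2_ge0 F; have nG := normL2_ge0 G.
have [G0|G0] := eqVneq (norm G) 0.
  by rewrite (normL2_eq0 G0) dot0r normc0 mulr_ge0// normL2_ge0.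
have Gp : 0 < norm G by rewrite lt_neqAle eq_sym G0.
rewrite -(@ler_pXn2r _ 2)// ?nnegrE ?mulr_ge0 ?normc_ge0// exprMn.
(* F + t G is the component of F orthogonal to G; expanding its nonnegative squared norm gives the
   inequality. *)
pose t : R[i] := - (dot F G * ((norm G ^+ 2)^-1)%:C).
have := sqr_ge0 (norm (F + t *: G)).
rewrite normL2_sqrD normL2Z exprMn dotZr /t conjcN conjcM conjcR normcN normcM.
rewrite normc_real ger0_norm ?invr_ge0 ?sqr_ge0// mulNr Re_oppc.
rewrite mulrAC (mulrC _^*) mulCJ [Re _]/= mulr0 subr0.
set a := normc _ ^+ 2; set b := norm G ^+ 2; set c := norm F ^+ 2.
rewrite exprMn -/a.
have b0 : 0 < b by rewrite exprn_gt0.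
have -> : c + 2 * - (a * b^-1) + a * b^-1 ^+ 2 * b = c - a / b.
  by field; rewrite gt_eqF.
by rewrite subr_ge0 ler_pdivrMr.
Qed.

Lemma normL2D F G : norm (F + G) <= norm F + norm G.
Proof.
rewrite -(@ler_pXn2r _ 2)// ?nnegrE ?addr_ge0 ?normL2_ge0// normL2_sqrD sqrrD.
rewrite lerD2r lerD2l -(mulr_natl (_ * _)) ler_wpM2l//.
by rewrite (le_trans (Re_le_normc _))// normc_dot_le.
Qed.

Lemma normL2_dist F G H : norm (F - H) <= norm (F - G) + norm (G - H).
Proof. by rewrite (_ : F - H = F - G + (G - H)) ?normL2D// addrA subrK. Qed.

Lemma dist_normL2 F G : `|norm F - norm G| <= norm (F - G).
Proof.
rewrite ler_norml lerBlDr lerNl opprB lerBlDr; apply/andP; split.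
- by rewrite normL2BC (le_trans _ (normL2D _ _))// subrK.
- by rewrite (le_trans _ (normL2D _ _))// subrK.
Qed.

Lemma normL2_sub_eq0 F G : norm (F - G) = 0 -> F = G.
Proof. by move=> /normL2_eq0/eqP; rewrite subr_eq0 => /eqP. Qed.

Lemma dot_sqr_inj F G : (forall H, dot F H = dot G H) -> F = G.
Proof.
move=> FG; apply/normL2_sub_eq0; rewrite /normL2 dotBl FG subrr/=.
by rewrite sqrtr0.
Qed.

End complex_integral.

(** * Completeness of L2 *)

Section complete.
Context (R : realType).

(** Subtracting or adding the tail 2 C / 2^k of the geometric bound turns x into an increasing and a
    decreasing sequence that enclose the limit; existence and rate come together. *)
Lemma geometric_cauchy_cvg (x : nat -> R) (C : R) : 0 <= C ->
  (forall k, `|x k.+1 - x k| <= C / 2 ^+ k) ->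
  exists l, forall k, `|x k - l| <= 2 * C / 2 ^+ k.
Proof.
move=> C0 xC.
have h2 k : C / 2 ^+ k = 2 * C / 2 ^+ k - 2 * C / 2 ^+ k.+1 :> R.
  by rewrite exprS; field; rewrite expf_neq0.
pose y k := x k - 2 * C / 2 ^+ k; pose z k := x k + 2 * C / 2 ^+ k.
have yS : nondecreasing_seq y.
  apply/nondecreasing_seqP => k; rewrite /y.
  by have := xC k; rewrite h2 ler_norml => /andP[+ _]; lra.
have zS : nonincreasing_seq z.
  apply/nonincreasing_seqP => k; rewrite /z.
  by have := xC k; rewrite h2 ler_norml => /andP[_]; lra.
have yz k : y k <= z k.
  rewrite /y /z lerD2l ge0_cp// divr_ge0// ?mulr_ge0// ?exprn_ge0//.
have yz2 k j : y k <= z j.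
  apply: (@le_trans _ _ (y (maxn k j))); first exact/yS/leq_maxl.
  by apply: le_trans (yz _) _; exact/zS/leq_maxr.
exists (sup (range y)) => k.
have h1 : y k <= sup (range y).
  by apply: ub_le_sup; [exists (z 0%N) => _ [j _ <-]; exact: yz2|exists k].
have h3 : sup (range y) <= z k.
  by apply: ge_sup; [exists (y 0%N), 0%N|move=> _ [j _ <-]; exact: yz2].
by rewrite ler_norml; move: h1 h3; rewrite /y /z; lra.
Qed.

(** The constant doubles from 2 to 4 because the errors of the real and imaginary parts are
    added. *)
Lemma geometric_ccauchy_cvg (x : nat -> R[i]) (C : R) : 0 <= C ->
  (forall k, normc (x k.+1 - x k) <= C / 2 ^+ k) ->
  exists l, forall k, normc (x k - l) <= 4 * C / 2 ^+ k.
Proof.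
move=> C0 xC.
have [|a aP] := @geometric_cauchy_cvg (fun k => Re (x k)) _ C0.
  by move=> k; apply: le_trans (xC k); rewrite -Re_oppc -Re_addc; exact: normr_Re_le.
have [|b bP] := @geometric_cauchy_cvg (fun k => Im (x k)) _ C0.
  by move=> k; apply: le_trans (xC k); rewrite -Im_oppc -Im_addc; exact: normr_Im_le.
exists (a +i* b) => k; apply: le_trans (normc_le_ReIm _) _.
by rewrite Re_addc Re_oppc Im_addc Im_oppc /=; have := aP k; have := bP k; lra.
Qed.

Lemma cvg_half_pow (C : R) : C / 2 ^+ k @[k --> \oo] --> (0 : R).
Proof.
have -> : (fun k => C / 2 ^+ k) = geometric C (2^-1 : R).
  by apply/funext => k; rewrite /geometric/= exprVn.
by apply: cvg_geometric; rewrite ger0_norm ?invr_ge0// invf_lt1// ltr1n.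
Qed.

Lemma exp4n k : 4 ^+ k = (2 ^+ k) ^+ 2 :> R.
Proof. by rewrite expr2 -exprMn -natrM. Qed.

Context d (T : measurableType d) (mu : {measure set T -> \bar R}).
Local Notation norm := (@normL2 _ _ _ mu).

Lemma cvg_normL2_unique (F_ : nat -> L2 mu) (F G : L2 mu) :
  norm (F_ n - F) @[n --> \oo] --> (0 : R) ->
  norm (F_ n - G) @[n --> \oo] --> (0 : R) -> F = G.
Proof.
move=> cF cG; apply/normL2_sub_eq0/eqP; rewrite eq_le normL2_ge0 andbT.
have c0 : norm (F_ n - F) + norm (F_ n - G) @[n --> \oo] --> (0 + 0 : R).
  exact: cvgD.
rewrite addr0 in c0; apply: ler_cvg_to (cvg_cst (norm (F - G))) c0 _.
by apply: nearW => n; rewrite (normL2BC (F_ n) F) normL2_dist.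
Qed.

(* A subsequence with summable increments converges almost everywhere, with
   an error controlled by a single integrable function. *)
Lemma L2_fast_cauchy_cvg (F_ : nat -> L2 mu) :
  (forall k, norm (F_ k.+1 - F_ k) <= 1 / 4 ^+ k) ->
  exists G : L2 mu, exists C : R,
    forall k, norm (F_ k - G) <= C / 2 ^+ k.
Proof.
move=> Fk.
pose D k x := normc (F_ k.+1 x - F_ k x) ^+ 2.
have mD k : measurable_fun setT (D k).
  by apply: measurable_sqr_normc; apply: cmeasurableB; exact: L2_cmeasurable.
(* Each increment has energy at most 16^-k. With the weight 4^k the series remains integrable, and
   its sum S bounds the k-th squared increment by S / 4^k pointwise. *)
pose u k x := (4 ^+ k * D k x)%:E.
have mu_ k : measurable_fun setT (u k).
  by apply/measurable_EFinP; exact: measurable_funM.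
have u0 k x : (0 <= u k x)%E by rewrite lee_fin mulr_ge0 ?exprn_ge0// normc_ge0.
have iu k : (\int[mu]_x u k x <= (1 / 4 ^+ k)%:E)%E.
  rewrite /u; under eq_integral do rewrite EFinM.
  rewrite ge0_integralZl_EFin//; last 2 first.
  - by move=> x _; rewrite lee_fin /D sqr_ge0.
  - exact/measurable_EFinP.
  have -> : (\int[mu]_x (D k x)%:E = (norm (F_ k.+1 - F_ k) ^+ 2)%:E)%E.
    rewrite sqr_normL2E; apply: ae_eq_integral => //.
    - exact/measurable_EFinP.
    - apply/measurable_EFinP; apply: measurable_sqr_normc; exact: L2_cmeasurable.
    - have := L2_subE (F_ k.+1) (F_ k).
      by apply: filterS => x /= h _; rewrite /D h.
  rewrite -EFinM lee_fin.
  have := Fk k; have n0 := normL2_ge0 (F_ k.+1 - F_ k).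
  have p4 : 0 < 4 ^+ k :> R by rewrite exprn_gt0.
  rewrite !ler_pdivlMr// => h.
  rewrite mulrAC -expr2 -exprMn mulrC expr_le1//.
  by rewrite mulr_ge0// ltW.
pose S x := (\sum_(k <oo) u k x)%E.
have S0 x : (0 <= S x)%E by exact: nneseries_ge0.
have mS : measurable_fun setT S.
  by apply: ge0_emeasurable_sum => // k x _ _; exact: u0.
have iS : (\int[mu]_x S x < +oo)%E.
  rewrite /S integral_nneseries//.
  apply: le_lt_trans.
    by apply: lee_nneseries => [k _ _|k _]; [exact: integral_ge0|exact: iu].
  rewrite (_ : (fun n => _) = EFin \o series (geometric 1 (4^-1 : R))); last first.
    apply/funext => n /=; rewrite sumEFin /series/=; congr EFin.
    by apply: eq_bigr => i _; rewrite exprVn.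
  have c4 : series (geometric 1 (4^-1 : R)) @ \oo --> (1 * (1 - 4^-1)^-1 : R).
    by apply: cvg_geometric_series; rewrite ger0_norm ?invr_ge0// invf_lt1// ltr1n.
  rewrite EFin_lim ?ltry//.
  exact: cvgP c4.
have Sint : mu.-integrable setT S.
  apply/integrableP; split=> //.
  by under eq_integral do rewrite gee0_abs//.
pose A := [set x | (S x < +oo)%E].
have mA : measurable A.
  by rewrite -[A]setTI; apply: emeasurable_fun_infty_o.
have AE : {ae mu, forall x, A x}.
  have := integrable_ae measurableT Sint.
  by apply: filterS => x /(_ I); rewrite ge0_fin_numE.
(* Cutting to the conull set where S is finite makes the sequence converge everywhere, so that its
   limit is defined and measurable without exception. *)
pose f k x := (\1_A x)%:C * F_ k x.
have mf k : cmeasurable (f k).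
  apply: cmeasurableM; last exact: L2_cmeasurable.
  apply: cmeasurableR; exact: measurable_indic.
pose M x := 2 ^+ 0 * Num.sqrt (fine (S x)).
have fM x k : normc (f k.+1 x - f k x) <= M x / 2 ^+ k.
  rewrite /f /M expr0 mul1r indicE; case: (boolP (x \in A)) => [|_].
    rewrite inE /A/= => Sx; rewrite !mul1r.
    rewrite ler_pdivlMr ?exprn_gt0//.
    rewrite -(@ler_pXn2r _ 2)// ?nnegrE ?mulr_ge0 ?normc_ge0 ?exprn_ge0//.
    rewrite sqr_sqrtr ?fine_ge0// exprMn -exprM mulnC exprM.
    rewrite (_ : 2 ^+ 2 = 4 :> R); last by rewrite -natrX.
    rewrite mulrC -lee_fin fineK ?ge0_fin_numE//.
    apply: le_trans (nneseries_lim_ge (m := 0%N) k.+1 _); last by [].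
    by rewrite big_nat_recr//= leeDr// sume_ge0.
  by rewrite !mul0r subrr normc0 divr_ge0 ?exprn_ge0.
have M0 x : 0 <= M x by rewrite mulr_ge0// ?sqrtr_ge0.
have [g gP] : {g : T -> R[i] & forall x k, normc (f k x - g x) <= 4 * M x / 2 ^+ k}.
  have gx x : {l | forall k, normc (f k x - l) <= 4 * M x / 2 ^+ k}.
    by apply/cid/geometric_ccauchy_cvg; [exact: M0|exact: fM].
  by exists (fun x => sval (gx x)) => x; case: (gx x).
have cg x : normc (f k x - g x) @[k --> \oo] --> (0 : R).
  apply: (@squeeze_cvgr _ _ _ _ (fun=> 0) (fun k => 4 * M x / 2 ^+ k)).
  - by apply: nearW => k; rewrite normc_ge0 gP.
  - exact: cvg_cst.
  - exact: cvg_half_pow.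
have mg : cmeasurable g.
  split.
  - apply: (@measurable_fun_cvg _ _ _ _ (fun k x => Re (f k x))) => [k|x _].
      by case: (mf k).
    apply/cvgrPdist_le => e e0; have /cvgrPdist_le/(_ e e0) := cg x.
    apply: filterS => k; rewrite sub0r normrN ger0_norm ?normc_ge0// => h.
    rewrite distrC -Re_oppc -Re_addc (le_trans _ h)//; exact: normr_Re_le.
  - apply: (@measurable_fun_cvg _ _ _ _ (fun k x => Im (f k x))) => [k|x _].
      by case: (mf k).
    apply/cvgrPdist_le => e e0; have /cvgrPdist_le/(_ e e0) := cg x.
    apply: filterS => k; rewrite sub0r normrN ger0_norm ?normc_ge0// => h.
    rewrite distrC -Im_oppc -Im_addc (le_trans _ h)//; exact: normr_Im_le.
pose v x := fine (S x).
have vint : mu.-integrable setT (EFin \o v).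
  apply/integrableP; split.
    by apply/measurable_EFinP; apply: measurableT_comp mS.
  rewrite (le_lt_trans _ iS)//; apply: ge0_le_integral => //.
  - by apply: measurableT_comp => //; apply/measurable_EFinP/measurableT_comp.
  - move=> x _ /=; rewrite ger0_norm ?fine_ge0// /v.
    by have := S0 x; case: (S x) => //= r _; exact: lexx.
have sqM x : M x ^+ 2 = v x.
  by rewrite /M expr0 mul1r sqr_sqrtr// fine_ge0.
(* The square of the pointwise error 4 M / 2^k. The integrable function v serves for all k at once:
   it puts g in L2 and gives the rate. *)
have bd k x : normc (f k x - g x) ^+ 2 <= 16 / 4 ^+ k * v x.
  rewrite -sqM; have := gP x k; have := normc_ge0 (f k x - g x).
  move=> n0 /(fun h => lerXn2r 2 _ _ h); rewrite !nnegrE n0.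
  move=> /(_ isT (le_trans n0 (gP x k))) h; apply: le_trans h _.
  rewrite le_eqVlt; apply/orP; left; apply/eqP.
  rewrite exp4n.
  by field; rewrite expf_neq0.
have fgL k : cL2 mu (fun x => f k x - g x).
  apply: le_cL2 (integrableRZ (16 / 4 ^+ k) vint) => //.
  exact: cmeasurableB.
have fae k : (f k : T -> R[i]) = F_ k %[ae mu].
  by apply: filterS AE => x Ax _; rewrite /f indicE mem_set//= mul1r.
have fL k : cL2 mu (f k).
  exact: ae_eq_cL2 (mf k) (ae_eq_sym (fae k)) (L2_cL2 _).
have gL : cL2 mu g.
  apply: ae_eq_cL2 (cL2D (fL 0%N) (cL2Z (-1) (fgL 0%N))) => //.
  by apply: aeW => x _; ring.
exists (classL2 mu g); exists (4 * Num.sqrt (Rintegral mu setT v)) => k.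
have v0 : 0 <= Rintegral mu setT v.
  by apply: Rintegral_ge0 => x _; rewrite fine_ge0.
have -> : F_ k - classL2 mu g = classL2 mu (fun x => f k x - g x).
  rewrite classL2B//; congr (_ - _); rewrite -[LHS]classL2_repr.
  exact: eq_classL2 (L2_cL2 _) (fL k) (ae_eq_sym (fae k)).
rewrite -(@ler_pXn2r _ 2)// ?nnegrE ?normL2_ge0 ?mulr_ge0 ?invr_ge0 ?exprn_ge0 ?sqrtr_ge0//.
rewrite -lee_fin sqr_norm_classL2//.
apply: (@le_trans _ _ (\int[mu]_x (16 / 4 ^+ k * v x)%:E)%E).
  apply: ge0_le_integral => //.
  - by move=> x _; rewrite lee_fin sqr_ge0.
  - by apply/measurable_EFinP; apply: measurable_sqr_normc; exact: cmeasurableB.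
  - by case/integrableP: (integrableRZ (16 / 4 ^+ k) vint).
  - by move=> x _; rewrite lee_fin.
under eq_integral do rewrite EFinM.
rewrite integralZl//.
rewrite -[X in (_ * X)%E]fineK; last exact: integrable_fin_num.
rewrite -EFinM lee_fin -/(Rintegral mu setT v) exprMn exprVn exprMn sqr_sqrtr//.
rewrite exp4n.
by rewrite (_ : 4 ^+ 2 = 16 :> R) 1?mulrAC// -natrX.
Qed.

Lemma L2_complete (F_ : nat -> L2 mu) :
  (forall e : R, 0 < e -> exists N, forall n m, (N <= n)%N -> (N <= m)%N ->
    norm (F_ n - F_ m) <= e) ->
  exists G : L2 mu, norm (F_ n - G) @[n --> \oo] --> (0 : R).
Proof.
move=> FC.
have p4 k : 0 < 1 / 4 ^+ k :> R by rewrite divr_gt0// exprn_gt0.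
have [N NP] : {N : nat -> nat & forall k n m, (N k <= n)%N -> (N k <= m)%N ->
    norm (F_ n - F_ m) <= 1 / 4 ^+ k}.
  have h k : {N | forall n m, (N <= n)%N -> (N <= m)%N ->
      norm (F_ n - F_ m) <= 1 / 4 ^+ k} by exact/cid/FC.
  by exists (fun k => sval (h k)) => k; case: (h k).
(* A running maximum, so that phi k and phi (k + 1) both lie beyond N k. *)
pose phi k := (\max_(j < k.+1) N j)%N.
have Nphi k : (N k <= phi k)%N.
  exact: (@leq_bigmax _ (fun j : 'I_k.+1 => N j) ord_max).
have phiS k : (N k <= phi k.+1)%N.
  exact: (@leq_bigmax _ (fun j : 'I_k.+2 => N j) (inord k)) || 
  by rewrite /phi big_ord_recr/= leq_max Nphi.
have [|G [C GP]] := @L2_fast_cauchy_cvg (fun k => F_ (phi k)).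
  by move=> k; apply: NP.
exists G; apply/cvgrPdist_le => e e0.
have e2 : 0 < e / 2 by rewrite divr_gt0.
have [k1 _ k1P] := (cvgrPdist_le _ _).1 (cvg_half_pow C) _ e2.
have [k2 _ k2P] := (cvgrPdist_le _ _).1 (cvg_half_pow 1) _ e2.
pose k := maxn k1 k2.
exists (N k) => // n /= kn; rewrite sub0r normrN ger0_norm ?normL2_ge0//.
apply: le_trans (normL2_dist _ (F_ (phi k)) _) _.
rewrite (splitr e) lerD//.
  apply: le_trans (NP k _ _ kn (Nphi k)) _.
  have := k2P k (leq_maxr _ _); rewrite sub0r normrN ger0_norm; last first.
    by rewrite divr_ge0 ?exprn_ge0.
  apply: le_trans; rewrite !div1r lef_pV2 ?posrE ?exprn_gt0//.
  by rewrite lerXn2r ?nnegrE// ler_nat.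
apply: le_trans (GP k) _.
have := k1P k (leq_maxl _ _); rewrite sub0r normrN; apply: le_trans.
exact: ler_norm.
Qed.

End complete.

(** * Affine changes of variable *)

Section dominated.
Context d (T : measurableType d) (R : realType) (mu : {measure set T -> \bar R}).
Local Notation norm := (@normL2 _ _ _ mu).

Lemma cvg_sqrt0 (u : nat -> R) : (forall n, 0 <= u n) ->
  u n ^+ 2 @[n --> \oo] --> (0 : R) -> u n @[n --> \oo] --> (0 : R).
Proof.
move=> u0 cu.
rewrite (_ : u = fun n => Num.sqrt (u n ^+ 2)); last first.
  by apply/funext => n; rewrite sqrtr_sqr ger0_norm.
rewrite -[X in _ --> X]sqrtr0.
by apply: continuous_cvg => //; exact: sqrt_continuous.
Qed.

Lemma cvg_normL2_dominated (f_ : nat -> T -> R[i]) (f : T -> R[i]) (h : T -> R) :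
  (forall n, cL2 mu (f_ n)) -> cL2 mu f ->
  (forall x, normc (f_ n x - f x) @[n --> \oo] --> (0 : R)) ->
  (forall n x, normc (f_ n x - f x) ^+ 2 <= h x) ->
  mu.-integrable setT (EFin \o h) ->
  norm (classL2 mu (f_ n) - classL2 mu f) @[n --> \oo] --> (0 : R).
Proof.
move=> f_L fL cf bf hi; apply: cvg_sqrt0 => [n|]; first exact: normL2_ge0.
pose g n x := (normc (f_ n x - f x) ^+ 2)%:E.
have mg n : measurable_fun setT (g n).
  apply/measurable_EFinP; apply: measurable_sqr_normc.
  by apply: cmeasurableB; [case: (f_L n)|case: fL].
have [||||_ _] := @dominated_convergence _ _ _ mu _ measurableT g (cst 0%E)
  (EFin \o h) mg.
- exact: measurable_cst.
- apply: aeW => x _; apply: cvg_EFin; first exact: nearW.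
  rewrite -(mulr0 (0 : R)) /g/=; under eq_fun do rewrite expr2.
  by apply: cvgM; exact: cf.
- exact: hi.
- by apply: aeW => x n _ /=; rewrite lee_fin ger0_norm ?sqr_ge0.
rewrite integral0 => cg.
apply: (@cvg_trans _ (fine \o (fun n => \int[mu]_x g n x)%E @ \oo)); last first.
  exact: fine_cvg.
apply: near_eq_cvg; apply: nearW => n /=.
have fgL : cL2 mu (fun x => f_ n x - f x).
  apply: le_cL2 (hi) => //; first by apply: cmeasurableB; [case: (f_L n)|case: fL].
by rewrite -classL2B// -[RHS]/(fine (_%:E)) sqr_norm_classL2.
Qed.

End dominated.

Section affine.
Context (R : realType).
Local Notation leb := (@lebesgue_measure R).
Implicit Types (a t : R).

Lemma measurable_affine a t :
  measurable_fun [set: measurableTypeR R]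
    ((fun x : R => a * x + t) : measurableTypeR R -> measurableTypeR R).
Proof.
have : measurable_fun [set: measurableTypeR R] (fun x : R => a * x + t).
  by apply: measurable_funD => //; exact: measurable_funM.
exact.
Qed.

Let nu a t : {measure set (measurableTypeR R) -> \bar R} :=
  measure_function_pushforward__canonical__measure_function_Measure leb
    (measurable_affine a t).

(** The two measures agree on half-open intervals, which determines Lebesgue measure. *)
Lemma lebesgue_measure_affine a t (A : set (measurableTypeR R)) : a != 0 ->
  measurable A -> leb A = mscale (NngNum (normr_ge0 a)) (nu a t) A.
Proof.
move=> a0.
apply: (@lebesgue_measure_unique _ (mscale (NngNum (normr_ge0 a)) (nu a t))).
move=> _ [[c d] _ <-] /=.
rewrite /mscale/= /pushforward.
have [a_gt0|a_lt0] := ltrP 0 a.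
  have -> : (fun x => a * x + t) @^-1` `]c, d] = `](c - t) / a, (d - t) / a]%classic.
    apply/seteqP; split=> x /=; rewrite !in_itv/= ltr_pdivrMr// ler_pdivlMr//;
      by rewrite ltrBlDr lerBrDr (mulrC x).
  rewrite !lebesgue_measure_itv/= !lte_fin ltr_pM2r ?invr_gt0// ltrD2r.
  case: ifPn => _; last by rewrite mule0.
  rewrite -!EFinB -EFinM; congr EFin; rewrite gtr0_norm//.
  by field; rewrite gt_eqF.
have {}a_lt0 : a < 0 by rewrite lt_neqAle a_lt0 andbT.
(* A negative slope exchanges the two ends: the preimage is closed on the left and open on the
   right, with the same length. *)
have -> : (fun x => a * x + t) @^-1` `]c, d] = `[(d - t) / a, (c - t) / a[%classic.
  apply/seteqP; split=> x /=; rewrite !in_itv/= ltr_ndivlMr// ler_ndivrMr//;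
    by rewrite lerBrDr ltrBlDr (mulrC x) andbC.
rewrite !lebesgue_measure_itv/= !lte_fin ltr_nM2r ?invr_lt0// ltrD2r.
case: ifPn => _; last by rewrite mule0.
rewrite -!EFinB -EFinM; congr EFin; rewrite ltr0_norm//.
by field; rewrite lt_eqF.
Qed.

Lemma ge0_integral_affine a t (f : R -> \bar R) : a != 0 ->
  measurable_fun [set: measurableTypeR R] f -> (forall x, 0 <= f x)%E ->
  (\int[leb]_x f (a * x + t)%R = (`|a|^-1)%:E * \int[leb]_x f x)%E.
Proof.
move=> a0 mf f0; have ma := measurable_affine a t.
have na0 : 0 < `|a| by rewrite normr_gt0.
rewrite [in RHS](eq_measure_integral (mscale (NngNum (normr_ge0 a)) (nu a t))); last first.
  by move=> A mA _; exact: lebesgue_measure_affine.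
rewrite ge0_integral_mscale//= ge0_integral_pushforward//.
by rewrite muleA -EFinM mulVf ?gt_eqF// mul1e.
Qed.

Lemma integral_affine a t (f : R -> R) : a != 0 ->
  leb.-integrable setT (EFin \o f) ->
  leb.-integrable setT (EFin \o (fun x => f (a * x + t))) /\
  Rintegral leb setT (fun x => f (a * x + t)) = `|a|^-1 * Rintegral leb setT f.
Proof.
move=> a0 fi; have ma := measurable_affine a t.
have mf : measurable_fun [set: measurableTypeR R] (EFin \o f).
  exact: measurable_int fi.
have fai : leb.-integrable setT (EFin \o (fun x => f (a * x + t))).
  apply/integrableP; split.
    exact: (measurableT_comp mf ma).
  have := @ge0_integral_affine a t (abse \o (EFin \o f)) a0 => /= ->//.
    by case/integrableP: fi => _ ?; rewrite lte_mul_pinfty// ?lee_fin ?invr_ge0.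
  exact: measurableT_comp.
split => //; rewrite /Rintegral.
have na0 : 0 < `|a| by rewrite normr_gt0.
rewrite [in RHS]integralE [in LHS]integralE.
have fp : (\int[leb]_x ((fun x => (f (a * x + t))%:E)^\+ x) =
    (`|a|^-1)%:E * \int[leb]_x ((EFin \o f)^\+ x))%E.
  rewrite -(ge0_integral_affine t a0 (measurable_funepos mf)) => [|x].
    by apply: eq_integral => x _; rewrite ?funeposE ?funenegE.
  exact: funepos_ge0.
have fn : (\int[leb]_x ((fun x => (f (a * x + t))%:E)^\- x) =
    (`|a|^-1)%:E * \int[leb]_x ((EFin \o f)^\- x))%E.
  rewrite -(ge0_integral_affine t a0 (measurable_funeneg mf)) => [|x].
    by apply: eq_integral => x _; rewrite ?funeposE ?funenegE.
  exact: funeneg_ge0.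
rewrite fp fn -muleBr//; last first.
  rewrite fin_num_adde_defl//; rewrite fin_numN.
  exact: integrable_neg_fin_num fi.
rewrite -integralE fineM//.
exact: integrable_fin_num.
Qed.

Lemma cL1_affine a t (f : R -> R[i]) : a != 0 -> cL1 leb f ->
  cL1 leb (fun x => f (a * x + t)) /\
  cintegral leb (fun x => f (a * x + t)) = (`|a|^-1)%:C * cintegral leb f.
Proof.
move=> a0 fi.
have [i1 e1] := integral_affine t a0 (cL1_Re fi).
have [i2 e2] := integral_affine t a0 (cL1_Im fi).
split; first exact: cL1_ReIm.
by rewrite scaleRC; apply: complexP.
Qed.

Lemma cL2_affine a t (f : R -> R[i]) : a != 0 -> cL2 leb f ->
  cL2 leb (fun x => f (a * x + t)).
Proof.
move=> a0 [mf fi]; split; first exact: (cmeasurable_comp mf (measurable_affine a t)).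
by have [] := integral_affine t a0 fi.
Qed.

End affine.

(** * Density of interval indicators *)

Section indicators.
Context d (T : measurableType d) (R : realType) (mu : {measure set T -> \bar R}).

Lemma cmeasurable_indic (A : set T) : measurable A ->
  cmeasurable (fun x => (\1_A x : R)%:C).
Proof. by move=> mA; apply: cmeasurableR; exact: measurable_indic. Qed.

Lemma integrable_indic_lty (A : set T) : measurable A -> (mu A < +oo)%E ->
  mu.-integrable setT (EFin \o \1_A).
Proof.
move=> mA Aoo; apply/integrableP; split; first exact/measurable_EFinP.
rewrite (eq_integral (fun x => (\1_A x)%:E)); last first.
  by move=> t _; rewrite gee0_abs// lee_fin.
by rewrite integral_indic// setIT.
Qed.

Lemma cL2_indic (A : set T) : measurable A -> (mu A < +oo)%E ->
  cL2 mu (fun x => (\1_A x : R)%:C).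
Proof.
move=> mA Aoo; apply: (@le_cL2 _ _ _ _ _ (\1_A)) => //.
- exact: cmeasurable_indic.
- move=> x; rewrite normc_real indicE.
  by case: (x \in A); rewrite ?normr1 ?expr1n// normr0 expr0n.
- exact: integrable_indic_lty.
Qed.

End indicators.

Section density.
Context (R : realType).
Local Notation leb := (@lebesgue_measure R).
Local Notation norm := (@normL2 _ _ _ leb).
Variable P : set (L2 leb).
Hypothesis P_itv : forall a b : R,
  P (classL2 leb (fun x => (\1_`]a, b] x)%:C)).
Hypothesis P_lin : forall (c : R[i]) F G, P F -> P G -> P (c *: F + G).
Hypothesis P_lim : forall (F_ : nat -> L2 leb) F, (forall n, P (F_ n)) ->
  norm (F_ n - F) @[n --> \oo] --> (0 : R) -> P F.

Let P0 : P 0.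
Proof.
rewrite -[0](addNr (classL2 leb (fun x => (\1_`](0:R), 0] x)%:C))) -scaleN1r.
exact: P_lin.
Qed.

Let PD F G : P F -> P G -> P (F + G).
Proof. by move=> PF PG; rewrite -[F]scale1r; exact: P_lin. Qed.

(** Windows of finite measure. Intersecting with [I n] keeps the indicator of every Borel set in L2
    and lets the Dynkin argument take complements inside [I n]. *)
Let I (n : nat) : set (measurableTypeR R) := `]- n%:R, n%:R]%classic.

Let Ioo n : (leb (I n) < +oo)%E.
Proof. by rewrite /I lebesgue_measure_itv/=; case: ifP => _; rewrite ?ltry// -EFinB ltry. Qed.

Let mI n : measurable (I n). Proof. exact: measurable_itv. Qed.

Let ind (A : set (measurableTypeR R)) (x : R) : R[i] := (\1_A x)%:C.

Let ind_cL2 n A : measurable A -> cL2 leb (ind (A `&` I n)).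
Proof.
move=> mA; apply: cL2_indic; first exact: measurableI.
apply: le_lt_trans (Ioo n); apply: le_measure; rewrite ?inE//.
exact: measurableI.
Qed.

Let cvg_ind_dominated n (A_ : nat -> set (measurableTypeR R)) A :
  (forall k, measurable (A_ k)) -> measurable A ->
  (forall x, \forall k \near \oo, (A_ k x <-> A x)) ->
  norm (classL2 leb (ind (A_ k `&` I n)) - classL2 leb (ind (A `&` I n)))
    @[k --> \oo] --> (0 : R).
Proof.
move=> mA_ mA cA.
apply: (cvg_normL2_dominated (h := \1_(I n))) => //.
- by move=> k; exact: ind_cL2.
- exact: ind_cL2.
- move=> x; apply: (@cvg_trans _ ((fun=> 0) @ \oo : set_system R)); last exact: cvg_cst.
  apply: near_eq_cvg; have := cA x; apply: filterS => k Ak.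
  rewrite /ind !indicE (_ : (x \in A_ k `&` I n) = (x \in A `&` I n)) ?subrr ?normc0//.
  by apply/idP/idP; rewrite !inE => -[/Ak].
- move=> k x; rewrite /ind -rmorphB normc_real !indicE !in_setI.
  case: (x \in I n); rewrite ?andbF ?andbT ?subrr ?normr0 ?expr0n//.
  by case: (x \in A_ k); case: (x \in A);
    rewrite ?subrr ?normr0 ?expr0n ?subr0 ?sub0r ?normrN ?normr1 ?expr1n.
- by apply: integrable_indic_lty (mI n) (Ioo n).
Qed.

(** A pi-lambda argument: half-open intervals are stable under intersection and generate the Borel
    sets; complements use linearity, and disjoint countable unions are L2 limits of finite ones. *)
Let P_ind n A : measurable A -> P (classL2 leb (ind (A `&` I n))).
Proof.
move=> mA; have : <<s (@ocitv R) >> A by [].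
apply: (dynkin_induction (T := measurableTypeR R) (G := @ocitv R)
  (P := fun A => P (classL2 leb (ind (A `&` I n))))) => //.
- exact: ocitvI.
- by rewrite setTI; exact: P_itv.
- move=> X oX; have : ocitv (X `&` I n) by apply: ocitvI => //; exact: is_ocitv.
  by move=> [[a b] _ <-]; exact: P_itv.
- move=> S mS PS.
  rewrite (_ : classL2 _ _ = classL2 leb (ind (I n)) - classL2 leb (ind (S `&` I n))).
    rewrite addrC -scaleN1r; apply: P_lin => //; exact: P_itv.
  rewrite -classL2B; last 2 first.
  - by rewrite -[I n]setTI; exact: ind_cL2.
  - exact: ind_cL2.
  congr classL2; apply/funext => x; rewrite /ind -rmorphB !indicE !in_setI in_setC.
  by case: (x \in S); case: (x \in I n); rewrite /= ?subrr ?subr0.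
- move=> F mF tF PF.
  pose U N := \big[setU/set0]_(k < N) F k.
  have mU N : measurable (U N) by exact: bigsetU_measurable.
  have mF' : measurable (\bigcup_k F k) by exact: bigcup_measurable.
  apply: (P_lim (F_ := fun N => classL2 leb (ind (U N `&` I n)))); last first.
    apply: cvg_ind_dominated => // x.
    have [[k _ Fkx]|nF] := pselect ((\bigcup_k F k) x).
      exists k.+1 => // N /= kN; split=> [_|_]; first by exists k.
      by rewrite /U -bigcup_mkord; exists k.
    apply: nearW => N; split => //; rewrite /U -bigcup_mkord => -[k _ Fkx].
    by exfalso; apply: nF; exists k.
  elim=> [|N IH].
    rewrite /U big_ord0 set0I (_ : classL2 _ _ = 0); first exact: P0.
    rewrite (_ : ind set0 = fun=> 0); last by apply/funext => x; rewrite /ind indic0.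
    apply/L2P; apply: ae_eq_trans (ae_eq_sym (L2_0E _)); apply: classL2K.
    split; first exact: cmeasurable_cst.
    by under eq_fun do rewrite normc0 expr0n; exact: integrable0.
  rewrite (_ : classL2 _ _ = classL2 leb (ind (U N `&` I n)) + classL2 leb (ind (F N `&` I n))).
    exact: PD.
  rewrite -classL2D; [|exact: ind_cL2..].
  congr classL2; apply/funext => x; rewrite /ind -rmorphD /U big_ord_recr/= !indicE.
  rewrite !in_setI in_setU.
  case: (x \in I n); rewrite ?andbF ?andbT ?addr0//.
  have [xU|] := boolP (x \in \big[setU/set0]_(k < N) F k); last by rewrite add0r.
  rewrite (_ : (x \in F N) = false) ?addr0//.
  apply/negbTE; rewrite notin_setE => FN; move: xU; rewrite inE -bigcup_mkord => -[k /= kN Fk].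
  move/trivIsetP : tF => /(_ k N Logic.I Logic.I (negbT (ltn_eqF kN))).
  by move=> /seteqP[/(_ x) + _]; apply.
Qed.

Let P_sum n (s : seq R) (A : R -> set (measurableTypeR R)) :
  (forall r, measurable (A r)) ->
  cL2 leb (fun x => \sum_(r <- s) (r%:C * ind (A r `&` I n) x)) /\
  P (classL2 leb (fun x => \sum_(r <- s) (r%:C * ind (A r `&` I n) x))).
Proof.
move=> mA; elim: s => [|r s [IH1 IH2]].
  under eq_fun do rewrite big_nil.
  have c0 : cL2 leb (fun=> 0 : R[i]).
    split; first exact: cmeasurable_cst.
    by under eq_fun do rewrite normc0 expr0n; exact: integrable0.
  split=> //; rewrite (_ : classL2 _ _ = 0); first exact: P0.
  by apply/L2P; apply: ae_eq_trans (ae_eq_sym (L2_0E _)); exact: classL2K.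
under eq_fun do rewrite big_cons.
have c1 : cL2 leb (fun x => r%:C * ind (A r `&` I n) x).
  by apply: cL2Z; exact: ind_cL2.
split; first exact: cL2D.
rewrite classL2D// classL2Z; last exact: ind_cL2.
by apply: P_lin => //; exact: P_ind.
Qed.

Import HBNNSimple.

Let P_ge0 (f : R -> R) : measurable_fun [set: measurableTypeR R] f ->
  (forall x, 0 <= f x) -> cL2 leb (fun x => (f x)%:C) ->
  P (classL2 leb (fun x => (f x)%:C)).
Proof.
move=> mf f0 fL.
have mf' : measurable_fun [set: measurableTypeR R] (EFin \o f) by exact/measurable_EFinP.
pose s_ := nnsfun_approx measurableT mf'.
(* The n-th simple approximation is also cut to [I n], so that its level sets have finite measure;
   at a given point the cut has no effect for large n. *)
pose f_ n x := \sum_(r <- finmap.enum_fset (fset_set (range (s_ n : R -> R)))) (r%:C * ind (s_ n @^-1` [set r] `&` I n) x).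
have mA n r : measurable (s_ n @^-1` [set r]).
  by rewrite -[X in measurable X]setTI; exact: measurable_funP.
have f_E n x : f_ n x = (s_ n x * \1_(I n) x)%:C.
  rewrite fimfunE fsbig_finite//= mulr_suml rmorph_sum; apply: eq_bigr => r _.
  by rewrite /ind -rmorphM indicI mulrA.
have cs x : s_ n x @[n --> \oo] --> f x.
  have h y : [set: measurableTypeR R] y -> (0 <= (EFin \o f) y)%E.
    by move=> _; rewrite lee_fin.
  exact: (fine_cvg (cvg_nnsfun_approx measurableT mf' h (x := x) Logic.I)).
have s_le n x : s_ n x <= f x.
  rewrite -(cvg_lim _ (cs x))//; apply: (nondecreasing_cvgn_le (u_ := fun n => s_ n x)).
  - by move=> i j ij; exact/lefP/nd_nnsfun_approx.
  - by apply: cvgP; exact: cs.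
apply: (P_lim (F_ := fun n => classL2 leb (f_ n))).
  by move=> n; apply: (P_sum n (finmap.enum_fset (fset_set (range (s_ n : R -> R)))) (mA n)).2.
apply: (cvg_normL2_dominated (mu := leb) (f_ := f_) (f := fun x => (f x)%:C)
  (h := fun x => f x ^+ 2) _ fL).
- by move=> n; apply: (P_sum n (finmap.enum_fset (fset_set (range (s_ n : R -> R)))) (mA n)).1.
- move=> x.
  have : normc ((s_ n x)%:C - (f x)%:C) @[n --> \oo] --> (0 : R).
    under eq_fun do rewrite -rmorphB normc_real.
    rewrite -(normr0 R); apply: cvg_norm; rewrite -(subrr (f x)).
    by apply: cvgB; [exact: cs|exact: cvg_cst].
  apply: cvg_trans; apply: near_eq_cvg.
  exists (Num.bound `|x|).+1 => // n /= bn; rewrite f_E indicE mem_set ?mulr1//.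
  have xn : `|x| < n%:R.
    apply: lt_le_trans (archi_boundP (normr_ge0 x)) _.
    by rewrite ler_nat ltnW.
  by rewrite /I/= in_itv/=; move: xn; rewrite ltr_norml => /andP[-> /ltW ->].
- move=> n x; rewrite f_E -rmorphB normc_real.
  rewrite real_normK ?num_real// -[leRHS]sqrrN -[leLHS]sqrrN opprB.
  have h0 : 0 <= s_ n x * \1_(I n) x by rewrite mulr_ge0//; rewrite indicE; case: (_ \in _).
  have h1 : s_ n x * \1_(I n) x <= f x.
    by rewrite indicE; case: (_ \in _); rewrite ?mulr1 ?mulr0 ?s_le.
  by rewrite sqrrN ler_sqr ?nnegrE ?subr_ge0// lerBlDr lerDl.
- case: fL => _; apply: eq_integrable => // x _ /=.
  by rewrite expr0n addr0 sqr_sqrtr ?sqr_ge0.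
Qed.

Let P_real (f : R -> R) : measurable_fun [set: measurableTypeR R] f ->
  cL2 leb (fun x => (f x)%:C) -> P (classL2 leb (fun x => (f x)%:C)).
Proof.
move=> mf fL.
have h (g : R -> R) : measurable_fun [set: measurableTypeR R] g ->
    (forall x, normc ((Num.max (g x) 0)%:C : R[i]) ^+ 2 <= normc ((f x)%:C : R[i]) ^+ 2) ->
    cL2 leb (fun x => (Num.max (g x) 0)%:C) /\
    P (classL2 leb (fun x => (Num.max (g x) 0)%:C)).
  move=> mg gf.
  have mm : measurable_fun [set: measurableTypeR R] (fun x => Num.max (g x) 0).
    by apply: measurable_maxr => //; exact: measurable_cst.
  have gL : cL2 leb (fun x => (Num.max (g x) 0)%:C).
    by case: fL => _; apply: le_cL2 => //; exact: cmeasurableR.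
  by split => //; apply: P_ge0 => // x; rewrite le_max lexx orbT.
have [pL pP] : cL2 leb (fun x => (Num.max (f x) 0)%:C) /\
    P (classL2 leb (fun x => (Num.max (f x) 0)%:C)).
  apply: h => // x; rewrite !normc_real !real_normK ?num_real//.
  by have [fx|fx] := leP (f x) 0; rewrite ?expr0n ?sqr_ge0.
have [nL nP] : cL2 leb (fun x => (Num.max (- f x) 0)%:C) /\
    P (classL2 leb (fun x => (Num.max (- f x) 0)%:C)).
  apply: h => [|x]; first exact: measurable_funN.
  rewrite !normc_real !real_normK ?num_real//.
  by have [fx|fx] := leP (- f x) 0; rewrite ?expr0n ?sqr_ge0 ?sqrrN.
rewrite (_ : (fun x => (f x)%:C) = fun x => (Num.max (f x) 0)%:C - (Num.max (- f x) 0)%:C).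
  by rewrite classL2B// addrC -scaleN1r; exact: P_lin.
apply/funext => x; rewrite -rmorphB; congr (_%:C).
have [fx|fx] := leP (f x) 0.
  by rewrite max_l ?oppr_ge0// sub0r opprK.
by rewrite max_r ?subr0// oppr_le0 ltW.
Qed.

(** The induction principle of the section: from intervals to Borel sets inside a window, to simple
    functions by linearity, to nonnegative functions by dominated limits, then to real and complex
    functions by decomposition. *)
Lemma L2_density F : P F.
Proof.
have [[m1 m2] Fi] := L2_cL2 F.
have L1 : cL2 leb (fun x => (Re (F x))%:C).
  apply: le_cL2 (Fi) => // x.
  by rewrite normc_real real_normK ?num_real// sqr_normcE lerDl sqr_ge0.
have L2 : cL2 leb (fun x => (Im (F x))%:C).
  apply: le_cL2 (Fi) => // x.
  by rewrite normc_real real_normK ?num_real// sqr_normcE lerDr sqr_ge0.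
rewrite -(classL2_repr F).
rewrite (_ : L2_repr F = fun x => 'i * (Im (F x))%:C + (Re (F x))%:C).
  by rewrite classL2D ?classL2Z//; [apply: P_lin; exact: P_real|exact: cL2Z].
by apply/funext => x; rewrite addrC [LHS]complexE.
Qed.

End density.

Section almost_everywhere.
Context d (T : measurableType d) (R : realType) (mu : {measure set T -> \bar R}).
Implicit Types P Q S : T -> Prop.

Lemma ae_imp P Q : (forall x, P x -> Q x) ->
  (\forall x \ae mu, P x) -> \forall x \ae mu, Q x.
Proof. by move=> PQ; exact: filterS. Qed.

Lemma ae_imp2 P Q S : (forall x, P x -> Q x -> S x) ->
  (\forall x \ae mu, P x) -> (\forall x \ae mu, Q x) -> \forall x \ae mu, S x.
Proof. by move=> PQ; exact: filterS2. Qed.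

End almost_everywhere.

(** * Continuity of affine changes of variable in L2 *)

Section affine_L2.
Context (R : realType).
Local Notation leb := (@lebesgue_measure R).
Local Notation norm := (@normL2 _ _ _ leb).
Implicit Types (a t : R) (F G : L2 leb).

Lemma ae_affine a t (Q : measurableTypeR R -> Prop) : a != 0 ->
  (\forall x \ae leb, Q x) ->
  \forall x \ae leb, Q (a * (x : R) + t : measurableTypeR R).
Proof.
move=> a0 [N [mN N0 NQ]]; exists ((fun x : R => a * x + t) @^-1` N); split.
- by rewrite -[X in measurable X]setTI; exact: (measurable_affine a t).
- have := lebesgue_measure_affine t a0 mN; rewrite N0 /mscale/= /pushforward.
  move=> /esym/eqP; rewrite mule_eq0 eqe normr_eq0 (negbTE a0)/= => /eqP.
  exact.
- by move=> x nQ; apply: NQ => h; apply: nQ.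
Qed.

Definition affL2 a t F : L2 leb := classL2 leb (fun x => F (a * x + t)).

Lemma affL2_class a t (f : R -> R[i]) : a != 0 -> cL2 leb f ->
  affL2 a t (classL2 leb f) = classL2 leb (fun x => f (a * x + t)).
Proof.
move=> a0 fL; apply: eq_classL2; [exact: cL2_affine (L2_cL2 _)|exact: cL2_affine|].
have := ae_affine t a0 (classL2K fL).
by apply: ae_imp => x /= h _; exact: h.
Qed.

Lemma norm_affL2 a t F : a != 0 -> norm (affL2 a t F) = Num.sqrt (`|a|^-1) * norm F.
Proof.
move=> a0; apply/eqP; rewrite -(@eqrXn2 _ 2)// ?mulr_ge0 ?normL2_ge0 ?sqrtr_ge0//.
rewrite exprMn (@sqr_sqrtr _ (`|a|^-1)) ?invr_ge0//; apply/eqP/EFin_inj.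
rewrite sqr_norm_classL2; last first.
  exact: cL2_affine (L2_cL2 _).
rewrite EFinM sqr_normL2E.
rewrite -(@ge0_integral_affine _ a t (fun x => (normc (F x) ^+ 2)%:E))//.
- apply/measurable_EFinP; apply: measurable_sqr_normc; exact: L2_cmeasurable.
- by move=> x; rewrite lee_fin sqr_ge0.
Qed.

Lemma affL2_linear a t c F G : a != 0 ->
  affL2 a t (c *: F + G) = c *: affL2 a t F + affL2 a t G.
Proof.
move=> a0; rewrite /affL2 -classL2Z; last exact: cL2_affine (L2_cL2 _).
rewrite -classL2D; last 2 first.
- by apply: cL2Z; exact: cL2_affine (L2_cL2 _).
- exact: cL2_affine (L2_cL2 _).
apply: eq_classL2.
- exact: cL2_affine (L2_cL2 _).
- apply: cL2D; first apply: cL2Z; exact: cL2_affine (L2_cL2 _).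
have := ae_affine t a0 (L2_addE (c *: F) G).
have := ae_affine t a0 (L2_scaleE c F).
apply: ae_imp2 => x /= h1 h2 _; rewrite h2//.
by congr (_ + _); exact: h1.
Qed.

Lemma affL2B a t F G : a != 0 -> affL2 a t (F - G) = affL2 a t F - affL2 a t G.
Proof.
by move=> a0; rewrite addrC -scaleN1r affL2_linear// scaleN1r addrC.
Qed.

(** The segment between y and z crosses an endpoint of ]c, d], and a point of a segment is no
    farther from either end than the ends are from each other. *)
Let jump (c d y z : R) : y \in `]c, d] -> z \notin `]c, d] ->
  `|y - c| <= `|y - z| /\ `|z - c| <= `|y - z| \/
  `|y - d| <= `|y - z| /\ `|z - d| <= `|y - z|.
Proof.
rewrite !in_itv/= => /andP[cy yd]; rewrite negb_and -leNgt -ltNge => /orP[zc|dz].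
  left; rewrite (@ger0_norm _ (y - z)) ?subr_ge0 ?(le_trans zc (ltW cy))//.
  by rewrite ger0_norm ?subr_ge0 ?(ltW cy)// ler0_norm ?subr_le0//; lra.
right; rewrite (@ler0_norm _ (y - z)) ?subr_le0 ?(ltW (le_lt_trans yd dz))//.
by rewrite ler0_norm ?subr_le0// ger0_norm ?subr_ge0 ?(ltW dz)//; lra.
Qed.

(** Joint continuity in slope and shift at every nonzero slope: the property to which [L2_density]
    is applied. *)
Let cont F := forall a0 t0, a0 != 0 -> forall e, 0 < e ->
  exists2 d, 0 < d & forall a t, `|a - a0| <= d -> `|t - t0| <= d ->
    norm (affL2 a t F - affL2 a0 t0 F) <= e.

Let half_bound a a0 d : d <= `|a0| / 2 -> `|a - a0| <= d -> `|a0| / 2 <= `|a|.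
Proof.
move=> da ad; have := ler_normD (a0 - a) a; rewrite subrK distrC.
by have := le_trans ad da; lra.
Qed.

(** The two indicators differ at x only if c or d separates a x + t from a0 x + t0. Then x is within
    r of the point that a0 x + t0 sends to that endpoint, and such x form a set of measure of order
    [dl]. *)
Let cont_itv (c d : R) : cont (classL2 leb (fun x => (\1_`]c, d] x)%:C)).
Proof.
move=> a0 t0 a0N0 e e0.
have na0 : 0 < `|a0| by rewrite normr_gt0.
(* Bounds |x| as soon as a x + t lies in ]c, d] with |a| >= |a0| / 2 and |t| <= |t0| + 1. *)
pose B := 2 * (`|c| + `|d| + `|t0| + 1) / `|a0|.
have B0 : 0 <= B by rewrite divr_ge0 ?mulr_ge0 ?addr_ge0.
(* The last term makes the total length 4 dl (B + 1) / |a0| of the two exceptional intervals at most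
   e^2. *)
pose dl := Num.min (Num.min 1 (`|a0| / 2)) (e ^+ 2 * `|a0| / (4 * (B + 1))).
have dl0 : 0 < dl.
  by rewrite !lt_min ltr01 !divr_gt0// ?mulr_gt0 ?exprn_gt0//; lra.
have dl1 : dl <= 1 by rewrite !ge_min lexx.
have dl2 : dl <= `|a0| / 2 by rewrite !ge_min lexx orbT.
have dl3 : dl <= e ^+ 2 * `|a0| / (4 * (B + 1)) by rewrite ge_min lexx orbT.
exists dl => // a t aa0 tt0.
have ha : `|a0| / 2 <= `|a| by exact: half_bound aa0.
have a_neq0 : a != 0 by rewrite -normr_gt0; apply: lt_le_trans ha; rewrite divr_gt0.
pose I : set (measurableTypeR R) := `]c, d]%classic.
have mI : measurable I by exact: measurable_itv.
have II y : (y \in I) = (y \in `]c, d]) by apply/idP/idP; rewrite inE.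
have IL : cL2 leb (fun x => (\1_I x)%:C).
  have lI : (leb I < +oo)%E.
    by rewrite /I lebesgue_measure_itv/=; case: ifP => _; rewrite ?ltry// -EFinB ltry.
  exact: cL2_indic.
rewrite (affL2_class t a_neq0 IL) (affL2_class t0 a0N0 IL).
have IaL := cL2_affine t a_neq0 IL; have Ia0L := cL2_affine t0 a0N0 IL.
rewrite -classL2B; [|exact: IaL|exact: Ia0L].
rewrite -(@ler_pXn2r _ 2)// ?nnegrE ?normL2_ge0 ?(ltW e0)//.
rewrite -lee_fin sqr_norm_classL2; last first.
  exact: cL2B IaL Ia0L.
(* For |x| <= B the two images differ by at most dl (B + 1); division by the slope |a0| transports
   this to the variable x. *)
pose r := dl * (B + 1) / `|a0|.
have r0 : 0 <= r by rewrite divr_ge0// mulr_ge0 ?(ltW dl0)//; lra.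
pose J (p : R) : set (measurableTypeR R) := `[(p - t0) / a0 - r, (p - t0) / a0 + r]%classic.
have lJ p : leb (J p) = (2 * r)%:E.
  rewrite /J lebesgue_measure_itv/= lte_fin.
  case: ltP => h; rewrite -?EFinB; last by congr EFin; lra.
  by congr EFin; lra.
have mJ p : measurable (J p) by exact: measurable_itv.
have key x : normc ((\1_I (a * x + t))%:C - (\1_I (a0 * x + t0))%:C : R[i]) ^+ 2 <=
    \1_(J c) x + \1_(J d) x.
  rewrite -rmorphB normc_real.
  have ind0 (S : set R) : 0 <= \1_S x :> R by rewrite indicE; case: (_ \in _).
  have [xeq|xne] := eqVneq (a * x + t \in I) (a0 * x + t0 \in I).
    by rewrite !indicE xeq subrr normr0 expr0n addr_ge0// -indicE.
  have -> : `|\1_I (a * x + t) - \1_I (a0 * x + t0)| ^+ 2 = 1 :> R.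
    move: xne; rewrite !indicE.
    by case: (_ \in _); case: (_ \in _) => //; rewrite ?subr0 ?sub0r ?normrN normr1 expr1n.
  have bound a' t' : `|a0| / 2 <= `|a'| -> `|t'| <= `|t0| + 1 ->
      a' * x + t' \in I -> `|x| <= B.
    move=> ha' ht'; rewrite inE /I/= in_itv/= => /andP[h1 h2].
    have h3 : `|a' * x + t'| <= `|c| + `|d|.
      rewrite ler_norml; apply/andP; split.
        rewrite lerNl (le_trans (_ : _ <= `|c|)) ?lerDl//.
        by have := ler_norm (- c); rewrite normrN; lra.
      by rewrite (le_trans h2)// (le_trans (ler_norm _))// lerDr.
    have h4 : `|a'| * `|x| <= `|c| + `|d| + `|t0| + 1.
      by rewrite -normrM; have := ler_normB (a' * x + t') t'; rewrite addrK; lra.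
    rewrite /B ler_pdivlMr//.
    have := ler_wpM2r (normr_ge0 x) ha'; lra.
  have xB : `|x| <= B.
    have [xI|xI] := boolP (a * x + t \in I).
      apply: (bound a t) => //.
      by have := ler_normD (t - t0) t0; rewrite subrK; lra.
    apply: (bound a0 t0) => //; [by lra|by lra|].
    by move: xne; rewrite (negbTE xI); case: (_ \in I).
  have dist : `|(a * x + t) - (a0 * x + t0)| <= dl * (B + 1).
    rewrite (_ : _ - _ = (a - a0) * x + (t - t0)); last by ring.
    apply: le_trans (ler_normD _ _) _; rewrite normrM mulrDr mulr1 lerD//.
    by apply: ler_pM.
  have inJ p : `|(a0 * x + t0) - p| <= dl * (B + 1) -> x \in J p.
    move=> h; rewrite inE /J/= in_itv/=.
    have : `|x - (p - t0) / a0| <= r.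
      rewrite /r ler_pdivlMr// -normrM (_ : _ * a0 = a0 * x + t0 - p)//.
      by field.
    by rewrite ler_norml => /andP[? ?]; apply/andP; split; lra.
  have : x \in J c \/ x \in J d.
    have [xI|xI] := boolP (a * x + t \in I).
      have zI : a0 * x + t0 \notin I.
        by move: xne; rewrite xI; case: (_ \in I).
      have := @jump c d (a * x + t) (a0 * x + t0).
      rewrite -!II xI => /(_ isT zI).
      by move=> [[_ h]|[_ h]]; [left|right]; apply: inJ; exact: le_trans h dist.
    have zI : a0 * x + t0 \in I.
      by move: xne; rewrite (negbTE xI); case: (_ \in I).
    have := @jump c d (a0 * x + t0) (a * x + t).
    rewrite -!II zI => /(_ isT xI).
    by move=> [[h _]|[h _]]; [left|right]; apply: inJ; apply: le_trans h _;
      rewrite distrC.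
  by rewrite !indicE; move=> [->|->]; rewrite ?lerDl ?lerDr; case: (_ \in _).
have Joo p : (leb (J p) < +oo)%E by rewrite lJ ltry.
have iJ p : leb.-integrable setT (EFin \o \1_(J p)).
  exact: integrable_indic_lty (mJ p) (Joo p).
apply: (@le_trans _ _ (\int[leb]_x ((\1_(J c) x)%:E + (\1_(J d) x)%:E))%E).
  apply: ge0_le_integral => //.
  - by move=> x _; rewrite lee_fin sqr_ge0.
  - apply/measurable_EFinP; apply: measurable_sqr_normc; apply: cmeasurableB.
      by case: IaL.
    by case: Ia0L.
  - apply/measurable_EFinP; exact: measurable_funD.
  - by move=> x _; rewrite -EFinD lee_fin; exact: key.
rewrite ge0_integralD//; [|exact/measurable_EFinP..].
have iJE p : (\int[leb]_x (\1_(J p) x)%:E = (2 * r)%:E)%E.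
  by rewrite integral_indic// setIT; exact: lJ.
rewrite !iJE -EFinD lee_fin /r.
rewrite (_ : _ + _ = dl * (4 * (B + 1)) / `|a0|); last by field; rewrite gt_eqF.
rewrite ler_pdivrMr// -ler_pdivlMr//.
by rewrite mulr_gt0//; lra.
Qed.

Lemma affL2_continuous F a0 t0 : a0 != 0 -> forall e, 0 < e ->
  exists2 d, 0 < d & forall a t, `|a - a0| <= d -> `|t - t0| <= d ->
    norm (affL2 a t F - affL2 a0 t0 F) <= e.
Proof.
move: a0 t0; apply: (@L2_density R cont) => [c d|c {}F G cF cG|F_ {}F cF_ Fcvg].
- exact: cont_itv.
- move=> a0 t0 a0N0 e e0.
  have na0 : 0 < `|a0| by rewrite normr_gt0.
  have c1 : 0 < 2 * (normc c + 1) by have := normc_ge0 c; lra.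
  have [|d1 d10 h1] := cF a0 t0 a0N0 (e / (2 * (normc c + 1))); first exact: divr_gt0.
  have [|d2 d20 h2] := cG a0 t0 a0N0 (e / 2); first exact: divr_gt0.
  exists (Num.min (Num.min d1 d2) (`|a0| / 2)).
    by rewrite !lt_min d10 d20 divr_gt0.
  move=> a t; rewrite !le_min => /andP[/andP[A1 A2] A3] /andP[/andP[T1 T2] _].
  have ha := half_bound (lexx _) A3.
  have a_neq0 : a != 0 by rewrite -normr_gt0; apply: lt_le_trans ha; rewrite divr_gt0.
  rewrite !affL2_linear//.
  rewrite (_ : _ - _ = c *: (affL2 a t F - affL2 a0 t0 F) + (affL2 a t G - affL2 a0 t0 G)); last first.
    by rewrite scalerBr addrACA opprD.
  apply: le_trans (normL2D _ _) _; rewrite normL2Z (splitr e) lerD//; last exact: h2.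
  apply: (@le_trans _ _ (normc c * (e / (2 * (normc c + 1))))).
    by apply: ler_wpM2l; [exact: normc_ge0|exact: h1].
  rewrite mulrA ler_pdivrMr//.
  have := normc_ge0 c; nra.
- move=> a0 t0 a0N0 e e0.
  have na0 : 0 < `|a0| by rewrite normr_gt0.
  (* Dominates the norm |a|^(-1/2) of [affL2 a t] for all |a| >= |a0| / 2, so the approximation of F
     by [F_ n] survives uniformly near a0. *)
  pose C := Num.sqrt (2 / `|a0|) + 1.
  have C0 : 0 < C by rewrite /C ltr_pwDr// sqrtr_ge0.
  have e3 : 0 < e / 3 / C by rewrite !divr_gt0.
  have [n _ /(_ n (leqnn n))] := (cvgrPdist_le _ _).1 Fcvg _ e3.
  rewrite sub0r normrN ger0_norm ?normL2_ge0// => hn.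
  have [|d1 d10 h1] := cF_ n a0 t0 a0N0 (e / 3); first exact: divr_gt0.
  exists (Num.min d1 (`|a0| / 2)); first by rewrite !lt_min d10 divr_gt0.
  move=> a t; rewrite !le_min => /andP[A1 A2] /andP[T1 _].
  have ha := half_bound (lexx _) A2.
  have bd a' t' : `|a0| / 2 <= `|a'| -> norm (affL2 a' t' (F_ n - F)) <= e / 3.
    move=> ha'; have a'0 : a' != 0.
      by rewrite -normr_gt0; apply: lt_le_trans ha'; rewrite divr_gt0.
    rewrite norm_affL2//.
    have h : Num.sqrt (`|a'|^-1) <= C.
      rewrite /C (le_trans (_ : _ <= Num.sqrt (2 / `|a0|))) ?lerDl//.
      rewrite ler_wsqrtr// -invf_div lef_pV2// ?posrE ?divr_gt0//.
      by apply: lt_le_trans ha'; rewrite divr_gt0.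
    apply: (@le_trans _ _ (C * (e / 3 / C))).
      by apply: ler_pM => //; exact: normL2_ge0.
    by rewrite mulrC divfK// gt_eqF.
  have a_neq0 : a != 0 by rewrite -normr_gt0; apply: lt_le_trans ha; rewrite divr_gt0.
  apply: le_trans (normL2_dist _ (affL2 a t (F_ n)) _) _.
  have -> : e = e / 3 + (e / 3 + e / 3) by field.
  apply: lerD; first by rewrite -affL2B// -(normL2N _) ; rewrite normL2N affL2B// normL2BC -affL2B// bd.
  apply: le_trans (normL2_dist _ (affL2 a0 t0 (F_ n)) _) _.
  apply: lerD; first exact: h1.
  by rewrite -affL2B// bd//; lra.
Qed.

End affine_L2.

(** * Fubini and the Fourier integral *)

Section complex_fubini.
Context d1 d2 (T1 : measurableType d1) (T2 : measurableType d2) (R : realType).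
Variable m2 : {sigma_finite_measure set T2 -> \bar R}.

(** Integrability is not assumed: the section integral is the difference of two Tonelli functions,
    those of the positive and the negative part. *)
Lemma measurable_Rintegral_prod (f : T1 * T2 -> R) : measurable_fun setT f ->
  measurable_fun setT (fun x => Rintegral m2 setT (fun y => f (x, y))).
Proof.
move=> mf; apply: measurableT_comp => //.
have mf' : measurable_fun setT (EFin \o f) by exact/measurable_EFinP.
rewrite (_ : (fun _ => _) = fun x => ((\int[m2]_y (EFin \o f)^\+ (x, y))
    - (\int[m2]_y (EFin \o f)^\- (x, y)))%E); last first.
  apply/funext => x; rewrite integralE; congr (_ - _)%E;
    by apply: eq_integral => y _; rewrite ?funeposE ?funenegE.
apply: emeasurable_funB.
- have h : measurable_fun setT (fubini_F m2 (EFin \o f)^\+%E) => //.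
  by apply: measurable_fun_fubini_tonelli_F => //; exact: measurable_funepos.
- have h : measurable_fun setT (fubini_F m2 (EFin \o f)^\-%E) => //.
  by apply: measurable_fun_fubini_tonelli_F => //; exact: measurable_funeneg.
Qed.

Lemma cmeasurable_cintegral (f : T1 * T2 -> R[i]) : cmeasurable f ->
  cmeasurable (fun x => cintegral m2 (fun y => f (x, y))).
Proof.
by move=> [f1 f2]; split=> /=; [exact: (measurable_Rintegral_prod f1)|
  exact: (measurable_Rintegral_prod f2)].
Qed.

Variable m1 : {sigma_finite_measure set T1 -> \bar R}.

Lemma Rfubini (f : T1 * T2 -> R) : (m1 \x m2)%E.-integrable setT (EFin \o f) ->
  [/\ m1.-integrable setT (EFin \o (fun x => Rintegral m2 setT (fun y => f (x, y)))),
      m2.-integrable setT (EFin \o (fun y => Rintegral m1 setT (fun x => f (x, y)))) &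
      Rintegral m1 setT (fun x => Rintegral m2 setT (fun y => f (x, y))) =
      Rintegral m2 setT (fun y => Rintegral m1 setT (fun x => f (x, y)))].
Proof.
move=> fi.
have mf : measurable_fun setT f by apply/measurable_EFinP; exact: measurable_int fi.
have iF := integrable_fubini_F fi.
have mf' : measurable_fun setT (EFin \o f) by exact: measurable_int fi.
have fi' : (m2 \x m1)%E.-integrable setT (EFin \o (fun z : T2 * T1 => f (z.2, z.1))).
  apply/integrable12ltyP; last exact: ((integrable21ltyP m1 m2 mf').1 fi).
  exact: (measurableT_comp mf' (measurable_fun_pair measurable_snd measurable_fst)).
have iG : m2.-integrable setT (fubini_G m1 (EFin \o f)) := integrable_fubini_F fi'.
(* The inner integral is finite only for almost every x, and [Rintegral] turns an infinite value
   into 0; hence equality only almost everywhere. *)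
have aF : {ae m1, forall x, setT x ->
    (Rintegral m2 setT (fun y => f (x, y)))%:E = fubini_F m2 (EFin \o f) x}.
  by have := integrable_ae measurableT iF; apply: filterS => x /= h /h /fineK.
have aG : {ae m2, forall y, setT y ->
    (Rintegral m1 setT (fun x => f (x, y)))%:E = fubini_G m1 (EFin \o f) y}.
  by have := integrable_ae measurableT iG; apply: filterS => x /= h /h /fineK.
have mF : measurable_fun setT (fun x => (Rintegral m2 setT (fun y => f (x, y)))%:E).
  exact/measurable_EFinP/measurable_Rintegral_prod.
have mG : measurable_fun setT (fun y => (Rintegral m1 setT (fun x => f (x, y)))%:E).
  apply/measurable_EFinP.
  have -> : (fun y => Rintegral m1 setT (fun x => f (x, y))) =
      fine \o fubini_G m1 (EFin \o f) by [].
  by apply: measurableT_comp => //; exact: (measurable_fubini_G fi).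
have e1 : (\int[m1]_x (Rintegral m2 setT (fun y => f (x, y)))%:E =
    \int[m1]_x fubini_F m2 (EFin \o f) x)%E.
  by apply: ae_eq_integral => //; exact: measurable_int iF.
have e2 : (\int[m2]_y (Rintegral m1 setT (fun x => f (x, y)))%:E =
    \int[m2]_y fubini_G m1 (EFin \o f) y)%E.
  by apply: ae_eq_integral => //; exact: measurable_int iG.
split.
- apply/integrableP; split => //; case/integrableP : iF => mF' ; apply: le_lt_trans.
  apply: ae_ge0_le_integral => //; [exact: measurableT_comp..|].
  by apply: filterS aF => x /= h /h <-.
- apply/integrableP; split => //; case/integrableP : iG => mG' ; apply: le_lt_trans.
  apply: ae_ge0_le_integral => //; [exact: measurableT_comp..|].
  by apply: filterS aG => x /= h /h <-.
- by rewrite /Rintegral e1 e2; congr fine; exact: Fubini.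
Qed.

Lemma cfubini (f : T1 * T2 -> R[i]) : cmeasurable f ->
  (\int[m1]_x \int[m2]_y (normc (f (x, y)))%:E < +oo)%E ->
  [/\ cL1 m1 (fun x => cintegral m2 (fun y => f (x, y))),
      cL1 m2 (fun y => cintegral m1 (fun x => f (x, y))) &
      cintegral m1 (fun x => cintegral m2 (fun y => f (x, y))) =
      cintegral m2 (fun y => cintegral m1 (fun x => f (x, y)))].
Proof.
move=> mf foo.
have fi : cL1 (m1 \x m2)%E f.
  split => //; apply/integrable12ltyP.
    by apply/measurable_EFinP; exact: measurable_normc.
  by under eq_integral => x _ do
    under eq_integral => y _ do rewrite gee0_abs ?lee_fin ?normc_ge0//.
have [a1 a2 a3] := Rfubini (cL1_Re fi).
have [b1 b2 b3] := Rfubini (cL1_Im fi).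
by split; [exact: cL1_ReIm|exact: cL1_ReIm|exact: complexP].
Qed.

End complex_fubini.

(** * Unimodular exponentials *)

Section expi.
Context (R : realType).
Implicit Types a b : R.

Lemma expiD a b : expi (a + b) = expi a * expi b.
Proof. by apply: complexP; rewrite ?Re_mulc ?Im_mulc /= ?cosD ?sinD// addrC. Qed.

Lemma normc_expi a : normc (expi a) = 1.
Proof. by rewrite /expi /= cos2Dsin2 sqrtr1. Qed.

Lemma conj_expi a : (expi a)^* = expi (- a).
Proof. by apply: complexP; rewrite ?Re_conjc ?Im_conjc /= ?cosN ?sinN. Qed.

Lemma expi0 : expi 0 = 1 :> R[i].
Proof. by rewrite /expi cos0 sin0. Qed.

Lemma cmeasurable_expi d (T : measurableType d) (h : T -> R) :
  measurable_fun setT h -> cmeasurable (fun x => expi (h x)).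
Proof.
by move=> mh; split => /=; apply: measurableT_comp mh;
  apply: continuous_measurable_fun; [exact: continuous_cos|exact: continuous_sin].
Qed.

End expi.

(** * The Fourier integral of integrable functions *)

Section fourierL1.
Context (R : realType).
Local Notation leb := (@lebesgue_measure R).
Implicit Types (f g : R -> R[i]).

Lemma cL1_expi f (h : R -> R) : measurable_fun [set: measurableTypeR R] h ->
  cL1 leb f -> cL1 leb (fun x => f x * expi (h x)).
Proof.
move=> mh [mf fi]; apply: le_cL1 fi.
- by apply: cmeasurableM => //; exact: cmeasurable_expi.
- by move=> x; rewrite normcM normc_expi mulr1.
Qed.

Lemma cL1_fourier f (xi : R) : cL1 leb f ->
  cL1 leb (fun x => f x * expi (- (2 * pi * x * xi))).
Proof.
apply: cL1_expi; apply: measurable_funN => //.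
by apply: measurable_funM => //; exact: measurable_funM.
Qed.

Lemma cmeasurable_fourier_kernel d1 d2 (T1 : measurableType d1)
    (T2 : measurableType d2) (a : T1 -> R) (b : T2 -> R) :
  measurable_fun setT a -> measurable_fun setT b ->
  cmeasurable (fun z : T1 * T2 => expi (- (2 * pi * a z.1 * b z.2))).
Proof.
move=> ma mb; apply: cmeasurable_expi; apply: measurable_funN.
apply: measurable_funM; last exact: measurableT_comp mb measurable_snd.
by apply: measurable_funM => //; exact: measurableT_comp ma measurable_fst.
Qed.

Lemma cmeasurable_fourierL1 f : cL1 leb f ->
  @cmeasurable _ (measurableTypeR R) _ (fourierL1 f).
Proof.
move=> [mf fi].
pose h (z : measurableTypeR R * measurableTypeR R) :=
  f z.2 * expi (- (2 * pi * z.2 * z.1)).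
rewrite (_ : fourierL1 f = fun xi => cintegral leb (fun x => h (xi, x)))//.
apply: cmeasurable_cintegral.
apply: cmeasurableM.
  exact: (cmeasurable_comp mf measurable_snd).
apply: cmeasurable_expi; apply: measurable_funN.
apply: measurable_funM; last exact: measurable_fst.
by apply: measurable_funM => //; exact: measurable_snd.
Qed.

Lemma normc_fourierL1_le f xi : cL1 leb f ->
  normc (fourierL1 f xi) <= Rintegral leb setT (fun x => normc (f x)).
Proof.
move=> fi; apply: le_trans (normc_cintegral_le (cL1_fourier xi fi)) _.
rewrite le_eqVlt; apply/orP; left; apply/eqP.
by apply: eq_Rintegral => x _; rewrite normcM normc_expi mulr1.
Qed.

Lemma fourierL1_linear (c : R[i]) f g : cL1 leb f -> cL1 leb g ->
  fourierL1 (fun x => c * f x + g x) = (fun xi => c * fourierL1 f xi + fourierL1 g xi).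
Proof.
move=> fi gi; apply/funext => xi; rewrite /fourierL1.
rewrite -cintegralZ; last exact: cL1_fourier.
rewrite -cintegralD; [|by apply: cL1Z; exact: cL1_fourier|exact: cL1_fourier].
by apply: eq_cintegral => x; rewrite mulrDl mulrA.
Qed.

(** Fubini for f(x) exp(-2 pi i x y) g(y), whose modulus |f(x)| |g(y)| is integrable as a
    product. *)
Lemma fourierL1_mult f g : cL1 leb f -> cL1 leb g ->
  cintegral leb (fun y => fourierL1 f y * g y) =
  cintegral leb (fun x => f x * fourierL1 g x).
Proof.
move=> fi gi.
pose h (z : measurableTypeR R * measurableTypeR R) :=
  f z.1 * expi (- (2 * pi * z.1 * z.2)) * g z.2.
have mh : cmeasurable h.
  apply: cmeasurableM; last first.
    by case: gi => mg _; exact: (cmeasurable_comp mg measurable_snd).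
  apply: cmeasurableM.
    by case: fi => mf _; exact: (cmeasurable_comp mf measurable_fst).
  exact: (@cmeasurable_fourier_kernel _ _ (measurableTypeR R) (measurableTypeR R) id id).
have hoo : (\int[leb]_x \int[leb]_y (normc (h (x, y)))%:E < +oo)%E.
  rewrite (_ : (fun x => _) = fun x =>
      ((normc (f x))%:E * \int[leb]_y (normc (g y))%:E)%E); last first.
    apply/funext => x; rewrite -ge0_integralZl//.
    - by apply: eq_integral => y _; rewrite /h/= !normcM normc_expi mulr1 EFinM.
    - by apply/measurable_EFinP/measurable_normc; case: gi.
    - by move=> y _; rewrite lee_fin normc_ge0.
    - by rewrite lee_fin normc_ge0.
  rewrite ge0_integralZr//.
  - rewrite lte_mul_pinfty//.
    + by apply: integral_ge0 => y _; rewrite lee_fin normc_ge0.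
    + by case: fi => _ ?; exact: integrable_fin_num.
    + by case: gi => _ ?; exact: integrable_lty.
  - by apply/measurable_EFinP/measurable_normc; case: fi.
  - by move=> y _; rewrite lee_fin normc_ge0.
  - by apply: integral_ge0 => y _; rewrite lee_fin normc_ge0.
have [_ _ e] := cfubini mh hoo.
have -> : cintegral leb (fun x => f x * fourierL1 g x) =
    cintegral leb (fun x => cintegral leb (fun y => h (x, y))).
  apply: eq_cintegral => x; rewrite /fourierL1 -cintegralZ; last exact: cL1_fourier.
  apply: eq_cintegral => y; rewrite /h/= (_ : 2 * pi * y * x = 2 * pi * x * y); last by ring.
  by rewrite mulrA mulrAC.
rewrite e; apply: eq_cintegral => y.
rewrite mulrC /fourierL1 -cintegralZ; last exact: cL1_fourier.
by apply: eq_cintegral => x; rewrite /h/= mulrC.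
Qed.

Lemma fourierL1_affine a t f (xi : R) : a != 0 -> cL1 leb f ->
  fourierL1 (fun x => f (a * x + t)) xi =
  (`|a|^-1)%:C * (expi (2 * pi * t / a * xi) * fourierL1 f (xi / a)).
Proof.
move=> a0 fi; rewrite /fourierL1.
pose g x := f x * expi (- (2 * pi * ((x - t) / a) * xi)).
have gi : cL1 leb g.
  rewrite /g; apply: cL1_expi => //; apply: measurable_funN => //.
  apply: measurable_funM => //; apply: measurable_funM => //.
  by apply: measurable_funM => //; exact: measurable_funB.
rewrite (_ : cintegral _ _ = cintegral leb (fun x => g (a * x + t))); last first.
  apply: eq_cintegral => x; rewrite /g; congr (_ * expi (- (_ * _ * _))).
  by field.
have [_ ->] := cL1_affine t a0 gi; congr (_ * _).
rewrite -cintegralZ; last exact: cL1_fourier.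
apply: eq_cintegral => x; rewrite /g [RHS]mulrCA -expiD; congr (_ * expi _).
by field.
Qed.

Lemma fourierL1_modulate f (b xi : R) :
  fourierL1 (fun x => f x * expi (2 * pi * b * x)) xi = fourierL1 f (xi - b).
Proof.
rewrite /fourierL1; apply: eq_cintegral => x.
by rewrite -mulrA -expiD; congr (_ * expi _); ring.
Qed.

End fourierL1.

(** * The Poisson kernel *)

Section poisson.
Context (R : realType).
Local Notation leb := (@lebesgue_measure R).
Implicit Types b x y : R.

Definition abel_weight x : R := expR (- `|x|).

Lemma abel_weight_ge0 x : 0 <= abel_weight x. Proof. exact: expR_ge0. Qed.

Lemma continuous_abel_weight : continuous abel_weight.
Proof.
move=> x; apply: continuous_comp; last exact: continuous_expR.
by apply: continuousN; exact: norm_continuous.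
Qed.

(** The primitive of exp(-x) (1 + cos(b x)) that vanishes at infinity. The added 1 keeps the
    integrand nonnegative, so that its integral can be computed before integrability is known; the
    case b = 0 then allows its removal. *)
Let F b x := expR (- x) * (- 1 + (1 + b ^+ 2)^-1 * (b * sin (b * x) - cos (b * x))).

Let b1 b : 0 < 1 + b ^+ 2.
Proof. by rewrite ltr_pwDl// sqr_ge0. Qed.

Let dF b x : is_derive x 1 (F b) (expR (- x) * (1 + cos (b * x))).
Proof.
have d1 : is_derive x 1 (fun x => expR (- x)) (- expR (- x)).
  have := @is_derive1_comp _ expR (-%R) x _ _ (is_derive_expR (- x)) (is_deriveN (is_derive_id x 1)).
  by rewrite mulrN1.
have d0 : is_derive x 1 (fun x : R => b * x) b.
  by apply: is_derive_eq; rewrite /GRing.scale/= mulr1.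
have d2 : is_derive x 1 (fun x => sin (b * x)) (b * cos (b * x)).
  by have := is_derive1_comp (is_derive_sin (b * x)) d0; rewrite mulrC.
have d3 : is_derive x 1 (fun x => cos (b * x)) (- b * sin (b * x)).
  by have := is_derive1_comp (is_derive_cos (b * x)) d0; rewrite mulrC mulrN mulNr.
have d4 : is_derive x 1 (fun x => b * sin (b * x) - cos (b * x)) (b * (b * cos (b * x)) - - b * sin (b * x)).
  exact: (is_deriveB (is_deriveZ b d2) d3).
have d5 : is_derive x 1 (fun x => - 1 + (1 + b ^+ 2)^-1 * (b * sin (b * x) - cos (b * x)))
   (0 + (1 + b ^+ 2)^-1 * (b * (b * cos (b * x)) - - b * sin (b * x))).
  exact: (is_deriveD (is_derive_cst (-1 : R) x 1) (is_deriveZ (1 + b ^+ 2)^-1 d4)).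
apply: (is_derive_eq (is_deriveM d1 d5)).
rewrite /GRing.scale/= add0r; have c0 := lt0r_neq0 (b1 b).
by field.
Qed.

Let F_le b x : `|F b x| <= expR (- x) * (1 + (`|b| + 1)).
Proof.
rewrite /F normrM ger0_norm ?expR_ge0// ler_wpM2l ?expR_ge0//.
apply: le_trans (ler_normD _ _) _; rewrite normrN normr1 lerD2l normrM.
have c1 : `|(1 + b ^+ 2)^-1| <= 1.
  by rewrite ger0_norm ?invr_ge0 ?(ltW (b1 b))// invf_le1// lerDl sqr_ge0.
have c2 : `|b * sin (b * x) - cos (b * x)| <= `|b| + 1.
  apply: le_trans (ler_normB _ _) _; rewrite normrM lerD//.
    by rewrite ler_piMr// ler_norml sin_geN1 sin_le1.
  by rewrite ler_norml cos_geN1 cos_le1.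
by rewrite -[leRHS]mul1r; apply: ler_pM.
Qed.

Let F_cvg b : F b x @[x --> +oo] --> (0 : R).
Proof.
have h : expR (- x) * (1 + (`|b| + 1)) @[x --> +oo] --> (0 : R).
  rewrite -(mul0r (1 + (`|b| + 1))); apply: cvgM; [exact: cvgr_expR|exact: cvg_cst].
apply/cvgr0Pnorm_le => e e0.
have /cvgr0Pnorm_le/(_ e e0) := h; apply: filterS => x; apply: le_trans.
by apply: le_trans (F_le b x) _; exact: ler_norm.
Qed.

Let abel_cos_ge0 b x : 0 <= abel_weight x * (1 + cos (b * x)).
Proof. by rewrite mulr_ge0 ?expR_ge0// -lerBlDl sub0r cos_geN1. Qed.

Let continuous_abel_cos b : continuous (fun x => abel_weight x * (1 + cos (b * x))).
Proof.
move=> x; apply: cvgM; first exact: continuous_abel_weight.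
apply: cvgD; first exact: cvg_cst.
apply: (@continuous_comp _ _ _ (fun x : R => b * x) cos x).
  by apply: cvgM; [exact: cvg_cst|exact: cvg_id].
exact: continuous_cos.
Qed.

Let integral_abel_cos1 b : (\int[leb]_x (abel_weight x * (1 + cos (b * x)))%:E =
  (2 * (1 + (1 + b ^+ 2)^-1))%:E)%E.
Proof.
rewrite ge0_symfun_integralT//; last first.
  by move=> x /=; rewrite /abel_weight normrN mulrN cosN.
rewrite -set_itvcy EFinM; congr (_ * _)%E.
transitivity (\int[leb]_(x in `[0%R, +oo[) (expR (- x) * (1 + cos (b * x)))%:E)%E.
  apply: eq_integral => x; rewrite inE/= in_itv/= andbT => x0.
  by rewrite /abel_weight ger0_norm.
rewrite (ge0_continuous_FTC2y _ _ (F_cvg b)).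
- rewrite -EFinB /F oppr0 expR0 mulr0 sin0 cos0; congr EFin; ring.
- by move=> x _; rewrite mulr_ge0 ?expR_ge0// -lerBlDl sub0r cos_geN1.
- apply: continuous_subspaceT => x; apply: cvgM.
    apply: continuous_comp; last exact: continuous_expR.
    by apply: continuousN; exact: cvg_id.
  apply: cvgD; first exact: cvg_cst.
  apply: (@continuous_comp _ _ _ (fun x : R => b * x) cos x).
    by apply: cvgM; [exact: cvg_cst|exact: cvg_id].
  exact: continuous_cos.
- by move=> x _; have [] := dF b x.
- apply: cvg_at_right_filter.
  by apply/differentiable_continuous/derivable1_diffP; have [] := dF b 0.
- by move=> x _; rewrite derive1E; have [] := dF b x.
Qed.

Let measurable_abel_cos b :
  measurable_fun [set: measurableTypeR R] (fun x => abel_weight x * (1 + cos (b * x))).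
Proof. by apply: continuous_measurable_fun; exact: continuous_abel_cos. Qed.

Let integrable_abel_cos1 b : leb.-integrable setT
  (EFin \o (fun x => abel_weight x * (1 + cos (b * x)))).
Proof.
apply/integrableP; split.
  by apply/measurable_EFinP; exact: measurable_abel_cos.
under eq_integral do rewrite gee0_abs ?lee_fin ?abel_cos_ge0//.
by rewrite integral_abel_cos1 ltry.
Qed.

Let Rintegral_abel_cos1 b :
  Rintegral leb setT (fun x => abel_weight x * (1 + cos (b * x))) =
  2 * (1 + (1 + b ^+ 2)^-1).
Proof. by rewrite /Rintegral integral_abel_cos1. Qed.

Lemma integrable_abel_weight : leb.-integrable setT (EFin \o abel_weight).
Proof.
apply: eq_integrable (integrableRZ 2^-1 (integrable_abel_cos1 0)) => // x _ /=.
rewrite mul0r cos0; congr EFin; lra.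
Qed.

Lemma Rintegral_abel_weight : Rintegral leb setT abel_weight = 2.
Proof.
rewrite (_ : abel_weight = fun x => 2^-1 * (abel_weight x * (1 + cos (0 * x)))); last first.
  by apply/funext => x; rewrite mul0r cos0; lra.
rewrite RintegralZl//.
rewrite Rintegral_abel_cos1 expr0n/= addr0 invr1; lra.
Qed.

Lemma Rintegral_abel_cos b :
  Rintegral leb setT (fun x => abel_weight x * cos (b * x)) = 2 / (1 + b ^+ 2).
Proof.
have -> : (fun x => abel_weight x * cos (b * x)) =
    (fun x => abel_weight x * (1 + cos (b * x)) - abel_weight x).
  by apply/funext => x; ring.
rewrite RintegralB//; last exact: integrable_abel_weight.
rewrite Rintegral_abel_weight Rintegral_abel_cos1; ring.
Qed.

Lemma cL1_abel_weight : cL1 leb (fun x => (abel_weight x)%:C).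
Proof. exact: cL1R integrable_abel_weight. Qed.

(** The Poisson kernel of the upper half-plane at height 1 / (2 pi), which is the Fourier transform
    of exp(-|x|). *)
Definition poisson y : R := 2 / (1 + (2 * pi * y) ^+ 2).

Lemma fourierL1_abel_weight y :
  fourierL1 (fun x => (abel_weight x)%:C) y = (poisson y)%:C.
Proof.
have L1 := cL1_fourier y cL1_abel_weight.
apply: complexP => /=.
  rewrite /poisson -(Rintegral_abel_cos (2 * pi * y)).
  apply: eq_Rintegral => x _; rewrite mul0r subr0 cosN; congr (_ * cos _).
  ring.
have m10 : -1 != 0 :> R by rewrite oppr_eq0 oner_neq0.
(* The imaginary part is odd, so the change of variable x -> -x equates its integral with its
   opposite. *)
have [_] := integral_affine 0 m10 (cL1_Im L1).
rewrite normrN normr1 invr1 mul1r => e.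
have {}e : Rintegral leb setT (fun x => -1 * Im ((abel_weight x)%:C * expi (- (2 * pi * x * y)))) =
    Rintegral leb setT (fun x => Im ((abel_weight x)%:C * expi (- (2 * pi * x * y)))).
  rewrite -e; apply: eq_Rintegral => x _; rewrite !Im_mulc/= !mul0r !addr0 /abel_weight.
  by rewrite mulN1r mulN1r normrN -mulrN -sinN; congr (_ * sin _); ring.
move: e; rewrite RintegralZl//; last exact: cL1_Im L1.
by rewrite /=; lra.
Qed.

Lemma poisson_ge0 y : 0 <= poisson y.
Proof. by rewrite divr_ge0// addr_ge0// sqr_ge0. Qed.

Lemma poisson_le2 y : poisson y <= 2.
Proof.
by rewrite /poisson ler_pdivrMr ?ltr_pwDl ?sqr_ge0// ler_peMr// lerDl sqr_ge0.
Qed.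

Let oneDsqrV_sym : (\int[leb]_x ((oneDsqr x)^-1)%:E = pi%:E)%E.
Proof.
rewrite ge0_symfun_integralT.
- rewrite -set_itvcy.
  transitivity (2%:E * \int[leb]_(x in `[0%R, +oo[) ((oneDsqr x)^-1)%:E)%E => //.
  by rewrite integral0y_oneDsqr -EFinM; congr EFin; field.
- by move=> x; rewrite invr_ge0 (le_trans ler01 (oneDsqr_ge1 _)).
- exact: continuous_oneDsqrV.
- by move=> x /=; rewrite /oneDsqr sqrrN.
Qed.

Lemma integral_poisson : (\int[leb]_y (poisson y)%:E = 1)%E.
Proof.
have p0 : 2 * pi != 0 :> R by rewrite mulf_neq0// gt_eqF// pi_gt0.
have mo : measurable_fun [set: measurableTypeR R] (fun x => (2 * (oneDsqr x)^-1)%:E).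
  apply/measurable_EFinP; apply: measurable_funM => //.
  by apply: continuous_measurable_fun; exact: continuous_oneDsqrV.
have := @ge0_integral_affine _ (2 * pi) 0 (fun x => (2 * (oneDsqr x)^-1)%:E) p0 mo.
move=> h; transitivity (\int[leb]_x (2 * (oneDsqr (2 * pi * x + 0))^-1)%:E)%E.
  by apply: eq_integral => y _; rewrite addr0 /poisson /oneDsqr.
rewrite h => [|x]; last by rewrite lee_fin mulr_ge0// invr_ge0 (le_trans ler01 (oneDsqr_ge1 _)).
under eq_integral do rewrite EFinM.
rewrite ge0_integralZl_EFin//.
- rewrite oneDsqrV_sym -!EFinM; congr EFin.
  rewrite ger0_norm ?mulr_ge0 ?pi_ge0//.
  have := @pi_gt0 R; move: (pi : R) => p p_gt0; field.
  by rewrite gt_eqF.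
- apply/measurable_EFinP.
  by apply: continuous_measurable_fun; exact: continuous_oneDsqrV.
Qed.

Lemma measurable_poisson : measurable_fun [set: measurableTypeR R] poisson.
Proof.
have [mP _] := cmeasurable_fourierL1 cL1_abel_weight.
by move: mP; under eq_fun do rewrite fourierL1_abel_weight/=.
Qed.

Lemma integrable_poisson : leb.-integrable setT (EFin \o poisson).
Proof.
apply/integrableP; split; first by apply/measurable_EFinP; exact: measurable_poisson.
under eq_integral do rewrite gee0_abs ?lee_fin ?poisson_ge0//.
by rewrite integral_poisson ltry.
Qed.

End poisson.

(** * Plancherel on the intersection of L1 and L2 *)

Lemma cvg_Rintegral0_dominated d (T : measurableType d) (R : realType)
  (mu : {measure set T -> \bar R}) (g : nat -> T -> R) (h : T -> R) :
  (forall n, measurable_fun setT (g n)) ->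
  (forall x, g n x @[n --> \oo] --> (0 : R)) ->
  (forall n x, `|g n x| <= h x) -> mu.-integrable setT (EFin \o h) ->
  Rintegral mu setT (g n) @[n --> \oo] --> (0 : R).
Proof.
move=> mg cg gh hi.
have mg' n : measurable_fun setT (EFin \o g n) by exact/measurable_EFinP.
have cg' : {ae mu, forall x, setT x -> (EFin \o g n) x @[n --> \oo] --> 0%E}.
  by apply: aeW => x _; apply: cvg_EFin; [exact: nearW|exact: cg].
have gh' : {ae mu, forall x n, setT x -> (`|(EFin \o g n) x| <= (EFin \o h) x)%E}.
  by apply: aeW => x n _ /=; rewrite lee_fin.
have [_ _] := dominated_convergence measurableT mg' (measurable_cst 0%E) cg' hi gh'.
by rewrite integral0 => cI; exact: (fine_cvg cI).
Qed.

Lemma cL2_lty d (T : measurableType d) (R : realType)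
  (mu : {measure set T -> \bar R}) (f : T -> R[i]) : cmeasurable f ->
  (\int[mu]_x (normc (f x) ^+ 2)%:E < +oo)%E -> cL2 mu f.
Proof.
move=> mf foo; split => //; apply/integrableP; split.
  by apply/measurable_EFinP; exact: measurable_sqr_normc.
apply: le_lt_trans foo; rewrite le_eqVlt; apply/orP; left; apply/eqP.
by apply: eq_integral => x _; rewrite abse_EFin ger0_norm ?sqr_ge0.
Qed.

Section plancherel_L1.
Context (R : realType).
Local Notation leb := (@lebesgue_measure R).
Local Notation norm := (@normL2 _ _ _ leb).
Variable f : R -> R[i].
Hypothesis (f1 : cL1 leb f) (f2 : cL2 leb f).

Let one0 : (1 : R) != 0. Proof. exact: oner_neq0. Qed.

Let mf : @cmeasurable _ (measurableTypeR R) _ f. Proof. by case: f1. Qed.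

Let F := classL2 leb f.

Let auto t := cintegral leb (fun x => f (x + t) * (f x)^*).

Let shift_cL2 t : cL2 leb (fun x => f (x + t)).
Proof.
by have := cL2_affine t one0 f2; under eq_fun do rewrite mul1r.
Qed.

Let autoE t : auto t = dotL2 (affL2 1 t F) F.
Proof.
rewrite (affL2_class t one0 f2) (dot_classL2 (cL2_affine t one0 f2) f2).
by apply: eq_cintegral => x; rewrite mul1r.
Qed.

Let auto0 : auto 0 = (norm F ^+ 2)%:C.
Proof.
rewrite autoE -dot_normL2 (affL2_class 0 one0 f2); congr dotL2.
by congr classL2; apply/funext => x; rewrite mul1r addr0.
Qed.

Let auto_le t : normc (auto t) <= norm F ^+ 2.
Proof.
rewrite autoE; apply: le_trans (normc_dot_le _ _) _; rewrite (norm_affL2 t F one0).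
by rewrite normr1 invr1 sqrtr1 mul1r expr2.
Qed.

(** Cauchy-Schwarz reduces continuity at 0 to the continuity of translations in L2. *)
Let auto_cvg (u : nat -> R) : u n @[n --> \oo] --> (0 : R) ->
  normc (auto (u n) - auto 0) @[n --> \oo] --> (0 : R).
Proof.
move=> cu; apply/cvgr0Pnorm_le => e e0.
have C0 : 0 < norm F + 1 by have := normL2_ge0 F; lra.
have [d d0 h] := affL2_continuous F 0 one0 (divr_gt0 e0 C0).
have /cvgr0Pnorm_le/(_ d d0) := cu; apply: filterS => n un.
rewrite ger0_norm ?normc_ge0// !autoE -dotBl.
apply: le_trans (normc_dot_le _ _) _.
have := h 1 (u n); rewrite !subrr normr0 subr0 => /(_ (ltW d0) un) {}h.
apply: (@le_trans _ _ (e / (norm F + 1) * (norm F + 1))).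
  by apply: ler_pM; rewrite ?normL2_ge0 ?lerDl.
by rewrite divfK// gt_eqF.
Qed.

Let mshift : @cmeasurable _ (measurableTypeR R * measurableTypeR R)%type _
  (fun z => f (z.1 + z.2)).
Proof.
have m : measurable_fun [set: measurableTypeR R * measurableTypeR R]
    ((fun z => (z.1 : R) + (z.2 : R)) :
       measurableTypeR R * measurableTypeR R -> measurableTypeR R).
  have : measurable_fun [set: measurableTypeR R * measurableTypeR R]
      (fun z : measurableTypeR R * measurableTypeR R => (z.1 : R) + (z.2 : R)).
    by apply: measurable_funD; [exact: measurable_fst|exact: measurable_snd].
  exact.
exact: (cmeasurable_comp mf m).
Qed.

Let mauto : @cmeasurable _ (measurableTypeR R) _ auto.
Proof.
pose h (z : measurableTypeR R * measurableTypeR R) := f (z.2 + z.1) * (f z.2)^*.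
rewrite (_ : auto = fun t => cintegral leb (fun x => h (t, x)))//.
apply: cmeasurable_cintegral; apply: cmeasurableM; last first.
  by apply: cmeasurableJ; exact: (cmeasurable_comp mf measurable_snd).
exact: (cmeasurable_comp mshift (measurable_fun_pair measurable_snd measurable_fst)).
Qed.

Let w (e x : R) : R[i] := (abel_weight (e * x))%:C.

Let cL1w e : 0 < e -> cL1 leb (w e).
Proof.
move=> e0; have [+ _] := cL1_affine 0 (lt0r_neq0 e0) (@cL1_abel_weight R).
by under eq_fun do rewrite addr0.
Qed.

Let fourier_w e y : 0 < e -> fourierL1 (w e) y = (e^-1 * poisson (e^-1 * y))%:C.
Proof.
move=> e0; have h := fourierL1_affine 0 y (lt0r_neq0 e0) (@cL1_abel_weight R).
rewrite (_ : w e = fun x => (abel_weight (e * x + 0))%:C); last first.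
  by apply/funext => x; rewrite addr0.
rewrite h fourierL1_abel_weight mulr0 !mul0r expi0 mul1r gtr0_norm// -rmorphM.
by rewrite (mulrC y).
Qed.

(* Abel summation of the energy of the Fourier transform, computed by two
   applications of the multiplication formula. *)
Let abel_energy e : 0 < e ->
  (cintegral leb (fun xi => fourierL1 f xi * (fourierL1 f xi)^* * w e xi))^* =
  cintegral leb (fun s => (poisson s)%:C * auto (e * s)).
Proof.
move=> e0; have e_neq0 := lt0r_neq0 e0.
(* The Fourier transform of [w e]: a kernel of mass 1 that concentrates at 0 as e tends to 0. *)
pose P (t : R) : R[i] := (e^-1 * poisson (e^-1 * t))%:C.
have mP : @cmeasurable _ (measurableTypeR R) _ P.
  have := cmeasurable_fourierL1 (cL1w e0).
  by rewrite (_ : fourierL1 (w e) = P)//; apply/funext => t; rewrite fourier_w.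
have P_le t : normc (P t) <= e^-1 * 2.
  have ei : 0 <= e^-1 by rewrite invr_ge0 ltW.
  rewrite /P normc_real ger0_norm; last exact: mulr_ge0 ei (poisson_ge0 _).
  exact: ler_wpM2l ei _ _ (poisson_le2 _).
have P1 : cL1 leb P.
  have ei0 : e^-1 != 0 by rewrite invr_eq0.
  have [+ _] := cL1_affine 0 ei0 (cL1R (integrableRZ e^-1 (integrable_poisson R))).
  by under eq_fun do rewrite addr0.
have we_real x : (w e x)^* = w e x by rewrite /w conjcR.
have fb x := normc_fourierL1_le x f1.
have mfour := cmeasurable_fourierL1 f1.
pose g xi := (fourierL1 f xi)^* * w e xi.
have mg : @cmeasurable _ (measurableTypeR R) _ g.
  by apply: cmeasurableM; [exact: cmeasurableJ|case: (cL1w e0)].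
have g1 : cL1 leb g.
  apply: le_cL1 (integrableRZ (Rintegral leb setT (fun x => normc (f x))) (cL1w e0).2) => // x.
  by rewrite normcM normcJ; apply: ler_wpM2r; [exact: normc_ge0|exact: fb].
(* The left side is the inverse Fourier integral of fhat weighted by [w e]; the multiplication
   formula turns it into a Poisson mean of f around x. *)
have ghat x : (fourierL1 g x)^* = cintegral leb (fun t => f (x + t) * P t).
  transitivity (cintegral leb (fun xi => fourierL1 f xi * (w e xi * expi (2 * pi * x * xi)))).
    rewrite /fourierL1 -/(fourierL1 f _) -cintegralJ; last exact: cL1_fourier.
    apply: eq_cintegral => xi; rewrite /g !conjcM conj_expi opprK conjCK we_real.
    by rewrite -mulrA; congr (_ * (_ * expi _)); ring.
  rewrite fourierL1_mult//; last first.
    by apply: cL1_expi => //; exact: cL1w.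
  pose k y := f y * P (y - x).
  have Px1 : cL1 leb (fun y => P (y - x)).
    have [+ _] := cL1_affine (- x) one0 P1.
    by under eq_fun do rewrite mul1r.
  have k1 : cL1 leb k.
    apply: le_cL1 (integrableRZ (e^-1 * 2) f1.2).
    - by apply: cmeasurableM => //; case: Px1.
    - move=> y; rewrite normcM mulrC; apply: ler_wpM2r; [exact: normc_ge0|exact: P_le].
  have [_] := cL1_affine x one0 k1.
  rewrite normr1 invr1 mul1r => e1.
  transitivity (cintegral leb k).
    apply: eq_cintegral => y; rewrite /k /P -(fourier_w (y - x) e0); congr (_ * _).
    exact: fourierL1_modulate.
  by rewrite -e1; apply: eq_cintegral => t; rewrite /k mul1r addrK addrC.
have -> : cintegral leb (fun xi => fourierL1 f xi * (fourierL1 f xi)^* * w e xi) =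
    cintegral leb (fun x => f x * fourierL1 g x).
  by rewrite -fourierL1_mult//; apply: eq_cintegral => xi; rewrite /g mulrA.
have g_bd x := normc_fourierL1_le x g1.
have fg1 : cL1 leb (fun x => f x * fourierL1 g x).
  apply: le_cL1 (integrableRZ (Rintegral leb setT (fun x => normc (g x))) f1.2).
  - by apply: cmeasurableM => //; exact: cmeasurable_fourierL1.
  - by move=> x; rewrite normcM mulrC; apply: ler_wpM2r; [exact: normc_ge0|exact: g_bd].
rewrite -cintegralJ//.
pose h (z : measurableTypeR R * measurableTypeR R) :=
  (f z.1)^* * (f (z.1 + z.2) * P z.2).
have mh : cmeasurable h.
  apply: cmeasurableM.
    by apply: cmeasurableJ; exact: (cmeasurable_comp mf measurable_fst).
  by apply: cmeasurableM => //; exact: (cmeasurable_comp mP measurable_snd).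
pose n (z : measurableTypeR R * measurableTypeR R) := (normc (h z))%:E.
have mn : measurable_fun setT n by apply/measurable_EFinP; exact: measurable_normc.
have n0 z : (0 <= n z)%E by rewrite lee_fin normc_ge0.
have hG : measurable_fun setT (fubini_G leb n).
  by apply: measurable_fun_fubini_tonelli_G => //.
(* Tonelli with the integral in t outside: for fixed t, |f(x) f(x + t)| integrates to at most the
   squared norm of f, and P is integrable. *)
have hoo : (\int[leb]_x \int[leb]_y (normc (h (x, y)))%:E < +oo)%E.
  rewrite -[X in (X < _)%E]/(\int[leb]_x \int[leb]_y n (x, y))%E.
  rewrite fubini_tonelli//.
  apply: (@le_lt_trans _ _ (\int[leb]_y ((norm F ^+ 2 * normc (P y))%:E))%E); last first.
    exact: integrable_lty (integrableRZ _ P1.2).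
  apply: ge0_le_integral => //.
  - by move=> y _; apply: integral_ge0 => x _; exact: n0.
  - by apply/measurable_EFinP; apply: measurable_funM => //; exact: measurable_normc.
  - move=> t _.
    rewrite (_ : (fun x => n (x, t)) = fun x =>
        ((normc (P t))%:E * (normc ((f x)^* * f (x + t)))%:E)%E); last first.
      apply/funext => x; rewrite -EFinM; congr EFin.
      rewrite -[h (x, t)]/((f x)^* * (f (x + t) * P t)) !normcM.
      by rewrite mulrA mulrC.
    rewrite ge0_integralZl//; last 3 first.
    - apply/measurable_EFinP/measurable_normc/cmeasurableM; first exact: cmeasurableJ.
      by case: (shift_cL2 t).
    - by move=> x _; rewrite lee_fin normc_ge0.
    - by rewrite lee_fin normc_ge0.
    rewrite mulrC EFinM lee_wpmul2l ?lee_fin ?normc_ge0//.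
    apply: (@le_trans _ _ (\int[leb]_x ((2^-1 * normc (f x) ^+ 2)%:E +
        (2^-1 * normc (f (x + t)) ^+ 2)%:E))%E).
      apply: ge0_le_integral => //.
      - by move=> x _; rewrite lee_fin normc_ge0.
      - apply/measurable_EFinP/measurable_normc/cmeasurableM; first exact: cmeasurableJ.
        by case: (shift_cL2 t).
      - apply/measurable_EFinP; apply: measurable_funD; apply: measurable_funM => //;
          apply: measurable_sqr_normc => //.
        by case: (shift_cL2 t).
      - move=> x _; rewrite -EFinD lee_fin normcM normcJ.
        by have := sqr_ge0 (normc (f x) - normc (f (x + t))); nra.
    rewrite integralD_EFin//; last 2 first.
    - exact: (integrableRZ _ f2.2).
    - exact: (integrableRZ _ (shift_cL2 t).2).
    have e1 : (\int[leb]_x (2^-1 * normc (f x) ^+ 2)%:E = (2^-1 * norm F ^+ 2)%:E)%E.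
      under eq_integral do rewrite EFinM.
      by rewrite integralZl//; [rewrite -sqr_norm_classL2|exact: f2.2].
    have e2 : (\int[leb]_x (2^-1 * normc (f (x + t)) ^+ 2)%:E = (2^-1 * norm F ^+ 2)%:E)%E.
      under eq_integral do rewrite EFinM.
      rewrite (integralZl _ (shift_cL2 t).2)// -(sqr_norm_classL2 (shift_cL2 t)).
      have -> : classL2 leb (fun x => f (x + t)) = affL2 1 t F.
        rewrite (affL2_class t one0 f2); congr classL2.
        by apply/funext => x; rewrite mul1r.
      by rewrite (norm_affL2 t F one0) normr1 invr1 sqrtr1 mul1r.
    rewrite e1 e2 -EFinD lee_fin; lra.
have [_ h1 he] := cfubini mh hoo.
transitivity (cintegral leb (fun x => cintegral leb (fun t => h (x, t)))).
  apply: eq_cintegral => x; rewrite conjcM ghat -cintegralZ; first by [].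
  have Pt : cL1 leb (fun t => f (x + t) * P t).
    have [+ _] := cL1_affine x one0 f1.
    under eq_fun do rewrite mul1r addrC.
    move=> fx1; apply: le_cL1 (integrableRZ (e^-1 * 2) fx1.2).
    - exact: cmeasurableM fx1.1 mP.
    - move=> y; rewrite normcM mulrC; apply: ler_wpM2r; [exact: normc_ge0|exact: P_le].
  exact: Pt.
rewrite he.
have inner t : cintegral leb (fun x => h (x, t)) = P t * auto t.
  rewrite /auto -cintegralZ; last exact: cL2_cL1M (shift_cL2 t) (cL2J f2).
  by apply: eq_cintegral => x; rewrite /h/=; ring.
have h1' : cL1 leb (fun t => P t * auto t).
  by move: h1; under eq_fun do rewrite inner.
rewrite (eq_cintegral leb inner).
(* The substitution t = e s brings P back to the kernel of unit scale and moves the parameter into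
   the autocorrelation. *)
have [_] := cL1_affine 0 e_neq0 h1'.
rewrite (gtr0_norm e0) => /(congr1 (fun z => e%:C * z)).
rewrite mulrA -rmorphM (mulfV e_neq0) rmorph1 mul1r => <-.
rewrite -cintegralZ; last by have [] := cL1_affine 0 e_neq0 h1'.
by apply: eq_cintegral => s; rewrite /P addr0 mulrA -rmorphM mulrA (mulfV e_neq0) mul1r mulKf.
Qed.

(** The kernel has mass 1 and the autocorrelation is bounded and continuous at 0, so the difference
    is an integral to which dominated convergence applies. *)
Let energy_cvg (u : nat -> R) : (forall n, 0 < u n) -> u n @[n --> \oo] --> (0 : R) ->
  normc (cintegral leb (fun s => (poisson s)%:C * auto (u n * s)) - auto 0) @[n --> \oo]
    --> (0 : R).
Proof.
move=> u0 cu.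
have mp : @cmeasurable _ (measurableTypeR R) _ (fun s => (poisson s)%:C).
  exact: (cL1R (integrable_poisson R)).1.
have mu_ n : @cmeasurable _ (measurableTypeR R) _ (fun s => auto (u n * s)).
  have m : measurable_fun [set: measurableTypeR R] (( *%R (u n)) :
      measurableTypeR R -> measurableTypeR R).
    have : measurable_fun [set: measurableTypeR R] (fun x : R => u n * x).
      by apply: measurable_funM.
    exact.
  exact: (cmeasurable_comp mauto m).
pose C := 2 * norm F ^+ 2.
have C0 : 0 <= C by rewrite mulr_ge0// sqr_ge0.
have dif_le n s : normc (auto (u n * s) - auto 0) <= C.
  rewrite /C mulr_natl mulr2n; apply: le_trans (normcB _ _) _.
  by apply: lerD; exact: auto_le.
pose D n (s : R) : R := poisson s * normc (auto (u n * s) - auto 0).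
have mD n : measurable_fun [set: measurableTypeR R] (D n).
  apply: measurable_funM; first exact: measurable_poisson.
  by apply: measurable_normc; apply: cmeasurableB => //; exact: cmeasurable_cst.
have D0 n s : 0 <= D n s by rewrite mulr_ge0 ?poisson_ge0 ?normc_ge0.
have D_le n s : D n s <= C * poisson s.
  rewrite [leRHS]mulrC; apply: ler_wpM2l; [exact: poisson_ge0|exact: dif_le].
have Di n : leb.-integrable setT (EFin \o D n).
  apply: (le_ge0_integrable (mD n) _ (integrableRZ C (integrable_poisson R))) => s.
  by rewrite ger0_norm.
have ce s : u n * s @[n --> \oo] --> (0 : R).
  by rewrite -(mul0r s); apply: cvgM => //; exact: cvg_cst.
have cD s : D n s @[n --> \oo] --> (0 : R).
  rewrite -(mulr0 (poisson s)); apply: cvgM; first exact: cvg_cst.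
  exact: (auto_cvg (ce s)).
have key n : normc (cintegral leb (fun s => (poisson s)%:C * auto (u n * s)) - auto 0) <=
    Rintegral leb setT (D n).
  have A1 c : cL1 leb (fun s => (poisson s)%:C * c).
    by have := cL1Z c (cL1R (integrable_poisson R)); under eq_fun do rewrite mulrC.
  have A2 : cL1 leb (fun s => (poisson s)%:C * (auto (u n * s) - auto 0)).
    apply: le_cL1 (Di n) => [|s].
      by apply: cmeasurableM => //; apply: cmeasurableB => //; exact: cmeasurable_cst.
    by rewrite normcM normc_real ger0_norm ?poisson_ge0.
  have -> : auto 0 = cintegral leb (fun s => (poisson s)%:C * auto 0).
    under eq_cintegral do rewrite mulrC.
    rewrite cintegralZ; last exact: cL1R (integrable_poisson R).
    by rewrite cintegralR /Rintegral integral_poisson mulr1.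
  rewrite -cintegralB//; last first.
    have := cL1D A2 (A1 (auto 0)); under eq_fun do rewrite -mulrDr subrK.
    exact.
  under eq_cintegral do rewrite -mulrBr.
  apply: le_trans (normc_cintegral_le A2) _.
  rewrite le_eqVlt; apply/orP; left; apply/eqP.
  apply: eq_Rintegral => s _.
  by rewrite normcM normc_real ger0_norm ?poisson_ge0.
have cI : Rintegral leb setT (D n) @[n --> \oo] --> (0 : R).
  apply: (cvg_Rintegral0_dominated _ _ _ (integrableRZ C (integrable_poisson R))) => //.
  by move=> n s; rewrite ger0_norm.
apply: (squeeze_cvgr _ (cvg_cst 0) cI).
by near=> n; rewrite normc_ge0 key.
Unshelve. all: by end_near.
Qed.

Theorem plancherel_L1 :
  cL2 leb (fourierL1 f) /\ norm (classL2 leb (fourierL1 f)) = norm (classL2 leb f).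
Proof.
pose u (n : nat) : R := n.+1%:R^-1.
have u0 n : 0 < u n by rewrite invr_gt0.
have cu : u n @[n --> \oo] --> (0 : R) by exact: cvg_harmonic.
have mfour := cmeasurable_fourierL1 f1.
pose s xi := normc (fourierL1 f xi) ^+ 2.
have ms : measurable_fun [set: measurableTypeR R] s by exact: measurable_sqr_normc.
pose g n xi := s xi * abel_weight (u n * xi).
have g0 n xi : 0 <= g n xi by rewrite mulr_ge0 ?sqr_ge0 ?expR_ge0.
have gC n xi : fourierL1 f xi * (fourierL1 f xi)^* * w (u n) xi = (g n xi)%:C.
  by rewrite mulCJ -rmorphM.
have gi n : leb.-integrable setT (EFin \o g n).
  apply: (le_ge0_integrable _ _
    (integrableRZ (Rintegral leb setT (fun x => normc (f x)) ^+ 2) (cL1w (u0 n)).2)).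
    apply: measurable_funM ms _.
    have := measurable_normc (cL1w (u0 n)).1; congr measurable_fun; apply/funext => x.
    by rewrite /w normc_real ger0_norm ?abel_weight_ge0.
  move=> xi; rewrite /w normc_real (ger0_norm (g0 n xi)) ger0_norm ?abel_weight_ge0//.
  apply: ler_wpM2r; first exact: abel_weight_ge0.
  by rewrite ler_sqr ?nnegrE ?normc_ge0 ?(le_trans (normc_ge0 _) (normc_fourierL1_le xi f1)) ?normc_fourierL1_le.
have e1 n : (\int[leb]_xi (g n xi)%:E)%E =
    (Re (cintegral leb (fun s => (poisson s)%:C * auto (u n * s))))%:E.
  rewrite -(abel_energy (u0 n)) Re_conjc (eq_cintegral leb (gC n)) cintegralR.
  rewrite -[Re _]/(Rintegral leb setT (g n)) fineK//; exact: integrable_fin_num (gi n).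
(* Read as a Poisson mean, the damped energy tends to the squared norm of f. *)
have c1 : (\int[leb]_xi (g n xi)%:E)%E @[n --> \oo] --> (norm F ^+ 2)%:E.
  under eq_cvg do rewrite e1; apply: cvg_EFin; first exact: nearW.
  apply/subr_cvg0; apply/norm_cvg0P.
  apply: (squeeze_cvgr _ (cvg_cst 0) (energy_cvg u0 cu)).
  have zn z : `|Re z - norm F ^+ 2| <= normc (z - auto 0).
    rewrite -[norm F ^+ 2]/(Re (norm F ^+ 2)%:C) -auto0 -Re_oppc -Re_addc.
    exact: normr_Re_le.
  by near=> n; apply/andP; split; [exact: normr_ge0|exact: zn].
(* The weights increase to 1, so monotone convergence applies while the energy of the transform may
   still be infinite; comparison with [c1] then makes it finite. *)
have c2 : (\int[leb]_xi (g n xi)%:E)%E @[n --> \oo] --> (\int[leb]_xi (s xi)%:E)%E.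
  have nd xi : {homo (fun n => g n xi) : m n / (m <= n)%N >-> m <= n}.
    move=> m n mn; apply: ler_wpM2l; first exact: sqr_ge0.
    rewrite /abel_weight ler_expR lerN2 !normrM; apply: ler_wpM2r => //.
    by rewrite !ger0_norm ?invr_ge0// lef_pV2 ?posrE// ler_nat.
  have cg xi : g n xi @[n --> \oo] --> s xi.
    have <- : s xi * abel_weight (0 * xi) = s xi.
      by rewrite mul0r /abel_weight normr0 oppr0 expR0 mulr1.
    have cx : u n * xi @[n --> \oo] --> (0 * xi : R).
      by apply: cvgM; [exact: cu|exact: cvg_cst].
    apply: cvgM; first exact: cvg_cst.
    exact: (cvg_comp _ _ cx (@continuous_abel_weight R (0 * xi))).
  have mg n : measurable_fun [set: measurableTypeR R] (fun x => (g n x)%:E).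
    exact: measurable_int (gi n).
  have g0' n x : setT x -> (0 <= (g n x)%:E)%E by rewrite lee_fin.
  have nd' x : setT x -> nondecreasing_seq (fun n => (g n x)%:E).
    by move=> _ m n mn; rewrite lee_fin; exact: nd.
  rewrite (_ : (\int[leb]_xi (s xi)%:E)%E =
      (\int[leb]_xi limn (fun n => (g n xi)%:E))%E); last first.
    apply: eq_integral => xi _; apply/esym/cvg_lim => //.
    by apply: cvg_EFin; [exact: nearW|exact: cg].
  exact: (cvg_monotone_convergence measurableT mg g0' nd').
have e : (\int[leb]_xi (s xi)%:E = (norm F ^+ 2)%:E)%E.
  exact: (cvg_unique _ c2 c1).
have L2f : cL2 leb (fourierL1 f).
  by apply: cL2_lty => //; rewrite -/(s _) e ltry.
split; first exact: L2f.
apply/eqP; rewrite -(@eqrXn2 _ 2) ?normL2_ge0//; apply/eqP/EFin_inj.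
by rewrite (sqr_norm_classL2 L2f) e.
Unshelve. all: by end_near.
Qed.

End plancherel_L1.

(** * Multiplication operators *)

Section hilbert.
Context d (T : measurableType d) (R : realType) (mu : {measure set T -> \bar R}).
Local Notation dot := (@dotL2 _ _ _ mu).
Local Notation norm := (@normL2 _ _ _ mu).
Implicit Types (F G : L2 mu).

Lemma cvg_normc_unique (x : nat -> R[i]) a b :
  normc (x n - a) @[n --> \oo] --> (0 : R) ->
  normc (x n - b) @[n --> \oo] --> (0 : R) -> a = b.
Proof.
move=> xa xb; apply/eqP; rewrite -subr_eq0; apply/eqP/normc_eq0.
have h : normc (x n - a) + normc (x n - b) @[n --> \oo] --> (0 + 0 : R) by exact: cvgD.
have c0 : (fun=> normc (a - b)) @ \oo --> (0 : R).
  rewrite addr0 in h; apply: (squeeze_cvgr _ (cvg_cst 0) h).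
  near=> n; apply/andP; split; first exact: normc_ge0.
  have -> : a - b = (x n - b) - (x n - a) by ring.
  by rewrite [leRHS]addrC; exact: normcB.
by rewrite -(cvg_lim _ c0)// lim_cst.
Unshelve. all: by end_near.
Qed.

Lemma cvg_normL2_norm (F_ : nat -> L2 mu) F : norm (F_ n - F) @[n --> \oo] --> (0 : R) ->
  norm (F_ n) @[n --> \oo] --> norm F.
Proof.
move=> cF; apply/subr_cvg0/norm_cvg0P.
apply: (squeeze_cvgr _ (cvg_cst 0) cF).
by near=> n; rewrite normr_ge0 dist_normL2.
Unshelve. all: by end_near.
Qed.

Lemma cvg_normL2_cauchy (F_ : nat -> L2 mu) F : norm (F_ n - F) @[n --> \oo] --> (0 : R) ->
  forall e : R, 0 < e -> exists N, forall n m, (N <= n)%N -> (N <= m)%N ->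
    norm (F_ n - F_ m) <= e.
Proof.
move=> /cvgr0Pnorm_le cF e e0.
have /cF[N _ hN] : 0 < e / 2 by lra.
exists N => n m Nn Nm; apply: le_trans (normL2_dist _ F _) _.
have := hN n Nn; have := hN m Nm.
by rewrite /= !ger0_norm ?normL2_ge0// (normL2BC F); lra.
Qed.

Lemma cvg_normL2_dot (F_ G_ : nat -> L2 mu) F G : norm (F_ n - F) @[n --> \oo] --> (0 : R) ->
  norm (G_ n - G) @[n --> \oo] --> (0 : R) ->
  normc (dot (F_ n) (G_ n) - dot F G) @[n --> \oo] --> (0 : R).
Proof.
move=> cF cG.
have h : norm (F_ n - F) * (norm (G_ n - G) + norm G) + norm F * norm (G_ n - G)
    @[n --> \oo] --> (0 * (0 + norm G) + norm F * 0 : R).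
  apply: cvgD; apply: cvgM => //; last exact: cvg_cst.
  by apply: cvgD => //; exact: cvg_cst.
rewrite mul0r mulr0 addr0 in h.
apply: (squeeze_cvgr _ (cvg_cst 0) h).
near=> n; apply/andP; split; first exact: normc_ge0.
have -> : dot (F_ n) (G_ n) - dot F G = dot (F_ n - F) (G_ n) + dot F (G_ n - G).
  by rewrite dotBl dotBr; ring.
apply: le_trans (normcD _ _) (lerD _ (normc_dot_le _ _)).
apply: le_trans (normc_dot_le _ _) (ler_wpM2l (normL2_ge0 _) _).
by rewrite -{1}(subrK G (G_ n)); exact: normL2D.
Unshelve. all: by end_near.
Qed.

Lemma cvg_normL2_lin (c : R[i]) (F_ G_ : nat -> L2 mu) F G :
  norm (F_ n - F) @[n --> \oo] --> (0 : R) -> norm (G_ n - G) @[n --> \oo] --> (0 : R) ->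
  norm (c *: F_ n + G_ n - (c *: F + G)) @[n --> \oo] --> (0 : R).
Proof.
move=> cF cG.
have h : normc c * norm (F_ n - F) + norm (G_ n - G) @[n --> \oo] --> (normc c * 0 + 0 : R).
  by apply: cvgD => //; apply: cvgM => //; exact: cvg_cst.
rewrite mulr0 addr0 in h.
apply: (squeeze_cvgr _ (cvg_cst 0) h).
near=> n; apply/andP; split; first exact: normL2_ge0.
rewrite -normL2Z scalerBr.
have -> : c *: F_ n + G_ n - (c *: F + G) = (c *: F_ n - c *: F) + (G_ n - G).
  by rewrite opprD addrACA.
exact: normL2D.
Unshelve. all: by end_near.
Qed.

Lemma eq_cvg_normL2 (F_ G_ : nat -> L2 mu) F G :
  (forall n, norm (F_ n - F) = norm (G_ n - G)) ->
  norm (G_ n - G) @[n --> \oo] --> (0 : R) -> norm (F_ n - F) @[n --> \oo] --> (0 : R).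
Proof. by move=> e; apply: cvg_trans; apply: near_eq_cvg; apply: nearW => n; rewrite e. Qed.

End hilbert.

Section linear_isometry.
Context d1 d2 (T1 : measurableType d1) (T2 : measurableType d2) (R : realType)
  (mu : {measure set T1 -> \bar R}) (nu : {measure set T2 -> \bar R}).
Variable V : L2 mu -> L2 nu.
Hypothesis V_linear : forall c F G, V (c *: F + G) = c *: V F + V G.
Hypothesis V_norm : forall F, normL2 (V F) = normL2 F.

(** Polarization: the norm of a sum gives the real part of the inner product, and replacing F by iF
    gives the imaginary part. *)
Lemma isometry_dot F G : dotL2 (V F) (V G) = dotL2 F G.
Proof.
have VD F' G' : V (F' + G') = V F' + V G'.
  by rewrite -[F' in LHS]scale1r V_linear scale1r.
have V0 : V 0 = 0 by apply: (addrI (V 0)); rewrite -VD !addr0.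
have VZ c F' : V (c *: F') = c *: V F' by rewrite -[c *: F' in LHS]addr0 V_linear V0 addr0.
have re F' G' : Re (dotL2 (V F') (V G')) = Re (dotL2 F' G').
  have := normL2_sqrD F' G'; rewrite -V_norm VD normL2_sqrD !V_norm; lra.
apply: complexP; first exact: re.
have := re ('i%C *: F) G; rewrite VZ !dotZl !Re_mulc/=; lra.
Qed.

End linear_isometry.

(** * Multiplication by bounded functions *)

Section multiplication.
Context d (T : measurableType d) (R : realType) (mu : {measure set T -> \bar R}).
Local Notation dot := (@dotL2 _ _ _ mu).
Local Notation norm := (@normL2 _ _ _ mu).
Implicit Types (a b f : T -> R[i]) (F G : L2 mu).

Definition bounded_cfun a := cmeasurable a /\ exists M : R, forall x, normc (a x) <= M.

Lemma bounded_cfun_cL2 a f : bounded_cfun a -> cL2 mu f -> cL2 mu (fun x => a x * f x).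
Proof. by move=> [ma [M aM]]; exact: cL2_bounded_mul ma aM. Qed.

Lemma mulL21 F : mulL2 mu (fun=> 1) F = F.
Proof.
by rewrite -[RHS]classL2_repr; congr classL2; apply/funext => x; rewrite mul1r.
Qed.

Lemma mulL2_class a f : bounded_cfun a -> cL2 mu f ->
  mulL2 mu a (classL2 mu f) = classL2 mu (fun x => a x * f x).
Proof.
move=> ba fL; apply: eq_classL2; [exact: bounded_cfun_cL2 (L2_cL2 _)|
  exact: bounded_cfun_cL2|].
by apply: ae_imp (classL2K fL) => x h _; rewrite h.
Qed.

Lemma mulL2_linear a (c : R[i]) F G : bounded_cfun a ->
  mulL2 mu a (c *: F + G) = c *: mulL2 mu a F + mulL2 mu a G.
Proof.
move=> ba; have hF := bounded_cfun_cL2 ba (L2_cL2 F).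
have hG := bounded_cfun_cL2 ba (L2_cL2 G).
rewrite -(classL2Z c hF) -(classL2D (cL2Z c hF) hG).
apply: eq_classL2; [exact: bounded_cfun_cL2 (L2_cL2 _)|exact: cL2D (cL2Z c hF) hG|].
apply: ae_imp2 (L2_addE (c *: F) G) (L2_scaleE c F) => x h1 h2 _.
by rewrite h1// h2//; ring.
Qed.

Lemma mulL2_linearl (c : R[i]) a b F : bounded_cfun a -> bounded_cfun b ->
  mulL2 mu (fun x => c * a x + b x) F = c *: mulL2 mu a F + mulL2 mu b F.
Proof.
move=> ba bb; have ha := bounded_cfun_cL2 ba (L2_cL2 F).
have hb := bounded_cfun_cL2 bb (L2_cL2 F).
rewrite -(classL2Z c ha) -(classL2D (cL2Z c ha) hb); congr classL2.
by apply/funext => x; ring.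
Qed.

Lemma mulL2M a b F : bounded_cfun a -> bounded_cfun b ->
  mulL2 mu a (mulL2 mu b F) = mulL2 mu (fun x => a x * b x) F.
Proof.
move=> ba bb; rewrite (mulL2_class ba (bounded_cfun_cL2 bb (L2_cL2 F))).
by congr classL2; apply/funext => x; rewrite mulrA.
Qed.

Lemma dot_mulL2 a F G : bounded_cfun a ->
  dot (mulL2 mu a F) G = cintegral mu (fun x => a x * (F x * (G x)^*)).
Proof.
move=> ba; rewrite -{1}(classL2_repr G).
rewrite (dot_classL2 (bounded_cfun_cL2 ba (L2_cL2 F)) (L2_cL2 G)).
by apply: eq_cintegral => x; rewrite mulrA.
Qed.

Lemma bounded_cfunJ a : bounded_cfun a -> bounded_cfun (fun x => (a x)^*).
Proof.
by move=> [ma [M aM]]; split; [exact: cmeasurableJ|exists M => x; rewrite normcJ].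
Qed.

Lemma mulL2_adjoint a F G : bounded_cfun a ->
  dot (mulL2 mu a F) G = dot F (mulL2 mu (fun x => (a x)^*) G).
Proof.
move=> ba; rewrite -{1}(classL2_repr G) -{2}(classL2_repr F).
rewrite (dot_classL2 (bounded_cfun_cL2 ba (L2_cL2 F)) (L2_cL2 G)).
rewrite (dot_classL2 (L2_cL2 F) (bounded_cfun_cL2 (bounded_cfunJ ba) (L2_cL2 G))).
by apply: eq_cintegral => x; rewrite conjcM conjCK; ring.
Qed.

Lemma norm_mulL2_le a F (M : R) : cmeasurable a -> 0 <= M ->
  (forall x, normc (a x) <= M) -> norm (mulL2 mu a F) <= M * norm F.
Proof.
move=> ma M0 aM; have ba : bounded_cfun a by split => //; exists M.
rewrite -(@ler_pXn2r _ 2) ?nnegrE ?mulr_ge0 ?normL2_ge0// exprMn -lee_fin (EFinM (M ^+ 2)).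
rewrite (sqr_norm_classL2 (bounded_cfun_cL2 ba (L2_cL2 F))) sqr_normL2E.
rewrite -ge0_integralZl//; last 3 first.
- by apply/measurable_EFinP/measurable_sqr_normc; case: (L2_cL2 F).
- by move=> x _; rewrite lee_fin sqr_ge0.
- by rewrite lee_fin sqr_ge0.
apply: ge0_le_integral => //.
- by move=> x _; rewrite lee_fin sqr_ge0.
- apply/measurable_EFinP/measurable_sqr_normc/cmeasurableM => //.
  by case: (L2_cL2 F).
- apply/measurable_EFinP/measurable_funM => //; apply: measurable_sqr_normc.
  by case: (L2_cL2 F).
- move=> x _; rewrite -EFinM lee_fin normcM exprMn ler_wpM2r ?sqr_ge0//.
  by rewrite ler_sqr ?nnegrE ?normc_ge0.
Qed.

End multiplication.

(** * The Fourier transform on L2 *)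

Section fourier_L2.
Context (R : realType).
Local Notation leb := (@lebesgue_measure R).
Local Notation dot := (@dotL2 _ _ _ leb).
Local Notation norm := (@normL2 _ _ _ leb).
Implicit Types (F G : L2 leb) (f g : R -> R[i]).

Lemma eq_fourierL1 f g : cL1 leb f -> cL1 leb g -> f = g %[ae leb] ->
  fourierL1 f = fourierL1 g.
Proof.
move=> f1 g1 fg; apply/funext => x; apply: ae_eq_cintegral.
- by case: (cL1_fourier x f1).
- by case: (cL1_fourier x g1).
- by apply: ae_imp fg => y h _; rewrite h.
Qed.

Definition truncate (n : nat) f (x : R) : R[i] := (\1_`[- n%:R, n%:R] x)%:C * f x.

Lemma cL1_truncate n F : cL1 leb (truncate n F).
Proof.
have h : (leb `[(- n%:R : R)%R, (n%:R : R)%R]%classic < +oo)%E.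
  by rewrite lebesgue_measure_itv/=; case: ifP => _; rewrite -?EFinB ltry.
by apply: cL2_cL1M; [exact: cL2_indic|exact: L2_cL2].
Qed.

Lemma normc_indic (A : set R) x : normc ((\1_A x)%:C : R[i]) <= 1.
Proof. by rewrite normc_real indicE; case: (x \in A); rewrite ?normr1 ?normr0. Qed.

Lemma cL2_truncate n F : cL2 leb (truncate n F).
Proof.
apply: (cL2_bounded_mul (M := 1)); last exact: L2_cL2.
- exact: cmeasurable_indic.
- exact: normc_indic.
Qed.

Lemma truncate_cvg F :
  norm (classL2 leb (truncate n F) - F) @[n --> \oo] --> (0 : R).
Proof.
rewrite -{2}(classL2_repr F).
apply: (@cvg_normL2_dominated _ _ _ _ _ _ (fun x => normc (F x) ^+ 2)).
- by move=> n; exact: cL2_truncate.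
- exact: L2_cL2.
- move=> x; apply: cvg_near_cst; near=> n.
  rewrite /truncate indicE mem_set ?mul1r ?subrr ?normc0//=.
  rewrite in_itv/= -ler_norml; near: n; exact: nbhs_infty_ger.
- move=> n x; rewrite /truncate -[X in _ - X]mul1r -mulrBl normcM exprMn.
  rewrite ler_piMl ?sqr_ge0// expr_le1 ?normc_ge0//.
  by rewrite indicE; case: (x \in _); rewrite ?subrr ?sub0r ?normcN ?normc0 ?normc1.
- by case: (L2_cL2 F).
Unshelve. all: by end_near.
Qed.

Lemma norm_fourierL1 f : cL1 leb f -> cL2 leb f ->
  norm (classL2 leb (fourierL1 f)) = norm (classL2 leb f).
Proof. by move=> f1 f2; have [] := plancherel_L1 f1 f2. Qed.

Lemma cL2_fourierL1 f : cL1 leb f -> cL2 leb f -> cL2 leb (fourierL1 f).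
Proof. by move=> f1 f2; have [] := plancherel_L1 f1 f2. Qed.

Lemma norm_fourierL1B f g : cL1 leb f -> cL2 leb f -> cL1 leb g -> cL2 leb g ->
  norm (classL2 leb (fourierL1 f) - classL2 leb (fourierL1 g)) =
  norm (classL2 leb f - classL2 leb g).
Proof.
move=> f1 f2 g1 g2.
rewrite -(classL2B f2 g2) -(norm_fourierL1 (cL1B f1 g1) (cL2B f2 g2)).
rewrite -(classL2B (cL2_fourierL1 f1 f2) (cL2_fourierL1 g1 g2)); congr (norm (classL2 _ _)).
apply/funext => x.
have := congr1 (fun h => h x) (fourierL1_linear (-1) g1 f1).
rewrite mulN1r addrC => <-; congr fourierL1.
by apply/funext => y; rewrite mulN1r addrC.
Qed.

(** Shows that the default of [xget] in [fourier] is never taken: by Plancherel the transforms of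
    the truncations are Cauchy because the truncations are. *)
Lemma fourier_cvg F :
  norm (classL2 leb (fourierL1 (truncate n F)) - fourier F) @[n --> \oo] --> (0 : R).
Proof.
rewrite /fourier; case: xgetP => [G _ //|noG].
have [] := @L2_complete _ _ _ leb (fun n => classL2 leb (fourierL1 (truncate n F))).
  move=> e e0; have [N hN] := cvg_normL2_cauchy (truncate_cvg F) e0.
  exists N => n m Nn Nm; rewrite norm_fourierL1B; first exact: hN.
  1,3: exact: cL1_truncate. 1,2: exact: cL2_truncate.
by move=> G /noG.
Qed.

Lemma norm_fourier F : norm (fourier F) = norm F.
Proof.
have h1 := cvg_normL2_norm (fourier_cvg F).
have h2 := cvg_normL2_norm (truncate_cvg F).
have e n : norm (classL2 leb (fourierL1 (truncate n F))) = norm (classL2 leb (truncate n F)).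
  exact: norm_fourierL1 (cL1_truncate n F) (cL2_truncate n F).
rewrite (funext e) in h1; exact: (cvg_unique _ h1 h2).
Qed.

(** By Plancherel the transforms of the truncations are as far from the Fourier integral of f as the
    truncations are from f, so both sides are limits of one sequence. *)
Lemma fourier_class f : cL1 leb f -> cL2 leb f ->
  fourier (classL2 leb f) = classL2 leb (fourierL1 f).
Proof.
move=> f1 f2; apply: cvg_normL2_unique (fourier_cvg _) _.
apply: eq_cvg_normL2 (truncate_cvg (classL2 leb f)) => n.
by apply: norm_fourierL1B => //; [exact: cL1_truncate|exact: cL2_truncate].
Qed.

Lemma fourier_linear (c : R[i]) F G : fourier (c *: F + G) = c *: fourier F + fourier G.
Proof.
apply: cvg_normL2_unique (fourier_cvg _) _.
apply: eq_cvg_normL2 (cvg_normL2_lin c (fourier_cvg F) (fourier_cvg G)) => n.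
suff -> : classL2 leb (fourierL1 (truncate n (c *: F + G : L2 leb))) =
    c *: classL2 leb (fourierL1 (truncate n F)) + classL2 leb (fourierL1 (truncate n G)).
  by [].
have F1 := cL1_truncate n F; have G1 := cL1_truncate n G.
have F2 := cL2_fourierL1 F1 (cL2_truncate n F).
have G2 := cL2_fourierL1 G1 (cL2_truncate n G).
rewrite -(classL2Z c F2) -(classL2D (cL2Z c F2) G2); congr classL2.
rewrite -(fourierL1_linear c F1 G1); apply: eq_fourierL1.
- exact: cL1_truncate.
- exact: cL1D (cL1Z c F1) G1.
apply: ae_imp2 (L2_addE (c *: F) G) (L2_scaleE c F) => x h1 h2 _.
by rewrite /truncate h1// h2//; ring.
Qed.

Lemma fourierB F G : fourier (F - G) = fourier F - fourier G.
Proof. by rewrite -scaleN1r addrC fourier_linear scaleN1r addrC. Qed.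

Lemma dot_fourier F G : dot (fourier F) (fourier G) = dot F G.
Proof. exact: (isometry_dot fourier_linear norm_fourier). Qed.

Definition conjL2 F : L2 leb := classL2 leb (fun x => (F x)^*).

Lemma conjL2_class f : cL2 leb f ->
  conjL2 (classL2 leb f) = classL2 leb (fun x => (f x)^*).
Proof.
move=> fL; apply: eq_classL2; [exact: cL2J (L2_cL2 _)|exact: cL2J|].
by apply: ae_imp (classL2K fL) => x h _; rewrite h.
Qed.

Lemma conjL2B F G : conjL2 (F - G) = conjL2 F - conjL2 G.
Proof.
rewrite -(classL2B (cL2J (L2_cL2 F)) (cL2J (L2_cL2 G))).
apply: eq_classL2; [exact: cL2J (L2_cL2 _)|exact: cL2B (cL2J (L2_cL2 F)) (cL2J (L2_cL2 G))|].
by apply: ae_imp (L2_subE F G) => x h _; rewrite h// conjcD conjcN.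
Qed.

Lemma norm_conjL2 F : norm (conjL2 F) = norm F.
Proof.
apply/eqP; rewrite -(@eqrXn2 _ 2) ?normL2_ge0//; apply/eqP/EFin_inj.
rewrite (sqr_norm_classL2 (cL2J (L2_cL2 F))) sqr_normL2E.
by apply: eq_integral => x _; rewrite normcJ.
Qed.

(** The inverse Fourier transform, written with two conjugations so that it inherits the isometry of
    [fourier]. *)
Definition fourier_adj G := conjL2 (fourier (conjL2 G)).

(** For truncations this is the multiplication formula; continuity of the inner product extends
    it. *)
Lemma dot_fourier_adj F G : dot (fourier F) G = dot F (fourier_adj G).
Proof.
have cG : norm (fourier_adj (classL2 leb (truncate n G)) - fourier_adj G)
    @[n --> \oo] --> (0 : R).
  apply: eq_cvg_normL2 (truncate_cvg G) => n.
  by rewrite -conjL2B norm_conjL2 -fourierB norm_fourier -conjL2B norm_conjL2.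
have h1 := cvg_normL2_dot (fourier_cvg F) (truncate_cvg G).
apply: cvg_normc_unique h1 _.
have := cvg_normL2_dot (truncate_cvg F) cG.
apply: cvg_trans; apply: near_eq_cvg; apply: nearW => n.
congr (normc (_ - _)).
have [F1 F2] := (cL1_truncate n F, cL2_truncate n F).
have [G1 G2] := (cL1_truncate n G, cL2_truncate n G).
rewrite (dot_classL2 (cL2_fourierL1 F1 F2) G2) (fourierL1_mult F1 (cL1J G1)).
rewrite /fourier_adj (conjL2_class G2) (fourier_class (cL1J G1) (cL2J G2)).
have GJ := cL2_fourierL1 (cL1J G1) (cL2J G2).
rewrite (conjL2_class GJ) (dot_classL2 F2 (cL2J GJ)).
by apply: eq_cintegral => x; rewrite conjCK.
Qed.

(** Since the transform V and its adjoint V' are both isometric, |V V' G - G|^2 = |V' G|^2 - 2 |V'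
    G|^2 + |G|^2 = 0. This is where surjectivity comes from. *)
Lemma fourier_adjK G : fourier (fourier_adj G) = G.
Proof.
have nadj : norm (fourier_adj G) = norm G.
  by rewrite norm_conjL2 norm_fourier norm_conjL2.
apply: normL2_sub_eq0; apply/eqP; rewrite -sqrf_eq0; apply/eqP.
rewrite normL2_sqrD normL2N norm_fourier dotNr dot_fourier_adj dot_normL2 nadj Re_oppc/=.
by ring.
Qed.

Definition modulation (b x : R) : R[i] := expi (2 * pi * b * x).

Lemma bounded_modulation b :
  bounded_cfun (modulation b : measurableTypeR R -> R[i]).
Proof.
split; last by exists 1 => x; rewrite normc_expi.
by apply: cmeasurable_expi; apply: measurable_funM.
Qed.

(** For truncations this is the rule [fourierL1_affine]; both sides are Lipschitz in F, so the
    identity passes to the L2 limit. *)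
Lemma fourier_affine a t F : a != 0 ->
  fourier (affL2 a t F) =
  (`|a|^-1)%:C *: mulL2 leb (modulation (t / a)) (affL2 a^-1 0 (fourier F)).
Proof.
move=> a0; have ai0 : a^-1 != 0 by rewrite invr_eq0.
pose V F := (`|a|^-1)%:C *: mulL2 leb (modulation (t / a)) (affL2 a^-1 0 (fourier F)).
rewrite -[RHS]/(V F).
pose F_ n := classL2 leb (truncate n F).
have VF n : fourier (affL2 a t (F_ n)) = V (F_ n).
  have [F1 F2] := (cL1_truncate n F, cL2_truncate n F).
  rewrite /V /F_ (affL2_class t a0 F2) (fourier_class (cL1_affine t a0 F1).1 (cL2_affine t a0 F2)).
  rewrite (fourier_class F1 F2) (affL2_class 0 ai0 (cL2_fourierL1 F1 F2)).
  have F2' := cL2_affine 0 ai0 (cL2_fourierL1 F1 F2).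
  rewrite (mulL2_class (bounded_modulation _) F2').
  rewrite -(classL2Z _ (bounded_cfun_cL2 (bounded_modulation _) F2')).
  congr classL2; apply/funext => x; rewrite (fourierL1_affine t x a0 F1) addr0.
  by rewrite /modulation -!mulrA (mulrC a^-1 x).
have Vlip G H : norm (V G - V H) <= `|a|^-1 * (Num.sqrt (`|a^-1|^-1) * norm (G - H)).
  rewrite /V -scalerBr normL2Z normc_real ger0_norm ?invr_ge0//.
  apply: ler_wpM2l; first by rewrite invr_ge0.
  rewrite -scaleN1r addrC -mulL2_linear; last exact: bounded_modulation.
  apply: le_trans (norm_mulL2_le _ _ ler01 _) _.
  - by case: (bounded_modulation (t / a)).
  - by move=> x; rewrite normc_expi.
  rewrite mul1r scaleN1r addrC -affL2B// norm_affL2// -fourierB norm_fourier.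
  exact: lexx.
have c1 : norm (fourier (affL2 a t (F_ n)) - fourier (affL2 a t F)) @[n --> \oo] --> (0 : R).
  have h : Num.sqrt (`|a|^-1) * norm (F_ n - F) @[n --> \oo] --> (0 : R).
    rewrite -(mulr0 (Num.sqrt (`|a|^-1))); apply: cvgM; first exact: cvg_cst.
    exact: truncate_cvg.
  apply: cvg_trans h; apply: near_eq_cvg; apply: nearW => n.
  by rewrite -fourierB norm_fourier -affL2B// norm_affL2.
apply: cvg_normL2_unique c1 _.
have h : `|a|^-1 * (Num.sqrt (`|a^-1|^-1) * norm (F_ n - F)) @[n --> \oo] --> (0 : R).
  rewrite -(mulr0 (`|a|^-1)); apply: cvgM; first exact: cvg_cst.
  rewrite -(mulr0 (Num.sqrt (`|a^-1|^-1))); apply: cvgM; first exact: cvg_cst.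
  exact: truncate_cvg.
apply: (squeeze_cvgr _ (cvg_cst 0) h).
near=> n; rewrite VF; apply/andP; split; first exact: normL2_ge0.
exact: Vlip.
Unshelve. all: by end_near.
Qed.

End fourier_L2.

(** * The scale measure *)

Section density_measure.
Context d (T : measurableType d) (R : realType) (mu nu : {measure set T -> \bar R}).
Variable w : T -> R.
Hypothesis (mw : measurable_fun setT w) (w0 : forall x, 0 <= w x).
Hypothesis nuE : forall A, measurable A -> (nu A = \int[mu]_(x in A) (w x)%:E)%E.
Import HBNNSimple.

Let integral_nnsfun (h : {nnsfun T >-> R}) :
  (\int[nu]_x (h x)%:E = \int[mu]_x (h x * w x)%:E)%E.
Proof.
under [LHS]eq_integral do rewrite fimfunE -fsumEFin//.
rewrite [LHS]ge0_integral_fsum//; last 2 first.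
- by move=> r; apply/measurable_EFinP/measurable_funM.
- by move=> n x _; rewrite nnfun_muleindic_ge0.
under [RHS]eq_integral.
  move=> x xD; rewrite fimfunE EFinM -fsumEFin// ge0_mule_fsuml; last first.
    by move=> r; rewrite nnfun_muleindic_ge0.
  over.
rewrite [RHS]ge0_integral_fsum//; last 2 first.
- by move=> r; apply: emeasurable_funM; apply/measurable_EFinP => //; exact/measurable_funM.
- by move=> n x _; rewrite mule_ge0 ?nnfun_muleindic_ge0 ?lee_fin.
apply: eq_fsbigr => r _; rewrite integralZl_indic_nnsfun// integral_indic// setIT nuE//.
have [r0|r0] := leP 0 r; last first.
  rewrite preimage_nnfun0// integral_set0 mule0.
  by apply/esym/integral0_eq => x _; rewrite indicE in_set0 mulr0 mul0e.
rewrite -ge0_integralZl//; last 2 first.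
- by apply/measurable_EFinP; exact: measurable_funTS.
- by move=> x _; rewrite lee_fin.
rewrite integral_mkcond; apply: eq_integral => x _.
by rewrite patchE indicE; case: ifPn => _; rewrite ?mulr1 ?mulr0 ?mul0e.
Qed.

Lemma ge0_integral_density (f : T -> \bar R) : measurable_fun setT f ->
  (forall x, 0 <= f x)%E -> (\int[nu]_x f x = \int[mu]_x (f x * (w x)%:E))%E.
Proof.
move=> mf f0; pose f_ := nnsfun_approx measurableT mf.
have nd x : nondecreasing_seq (fun n => f_ n x).
  by move=> m n mn; exact/lefP/nd_nnsfun_approx.
have cf x : (f_ n x)%:E @[n --> \oo] --> f x.
  by apply: (cvg_nnsfun_approx measurableT mf) => // y _; exact: f0.
transitivity (limn (fun n => \int[nu]_x (f_ n x)%:E))%E.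
  rewrite -monotone_convergence//=.
  - by apply: eq_integral => x _; apply/esym/cvg_lim.
  - by move=> n; exact/measurable_EFinP.
  - by move=> n x _; rewrite lee_fin.
  - by move=> x _ a b ab; rewrite lee_fin nd.
transitivity (limn (fun n => \int[mu]_x (f_ n x * w x)%:E))%E.
  by congr (limn _); apply/funext => n; exact: integral_nnsfun.
rewrite -monotone_convergence//=.
- apply: eq_integral => x _; apply/cvg_lim => //.
  by under eq_fun do rewrite EFinM; apply: cvgeZr.
- by move=> n; apply/measurable_EFinP/measurable_funM.
- by move=> n x _; rewrite lee_fin mulr_ge0.
- by move=> x _ a b ab; rewrite lee_fin ler_wpM2r// nd.
Qed.

End density_measure.

Section scale_density.
Context (R : realType).
Local Notation leb := (@lebesgue_measure R).

(** The density u^-2 cut to the positive half-line, so that integrals for [scale_measure] become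
    Lebesgue integrals over the whole line. *)
Definition scale_weight (u : R) : R := \1_`]0, +oo[ u * u ^- 2.

Lemma scale_weight_ge0 u : 0 <= scale_weight u.
Proof. by rewrite mulr_ge0// invr_ge0 sqr_ge0. Qed.

Lemma measurable_scale_weight : measurable_fun [set: measurableTypeR R] scale_weight.
Proof.
have h : measurable_fun (`]0%R, +oo[ : set (measurableTypeR R)) (fun u : R => u ^- 2).
  by apply/measurable_EFinP; exact: measurable_scale_density.
have -> : scale_weight = (fun u : R => u ^- 2) \_ `]0%R, +oo[.
  by apply/funext => u; rewrite /scale_weight patchE indicE; case: ifP; rewrite ?mul1r ?mul0r.
by apply/(measurable_restrictT _ _).1.
Qed.

Lemma ge0_integral_scale (f : R -> \bar R) :
  measurable_fun [set: measurableTypeR R] f -> (forall x, 0 <= f x)%E ->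
  (\int[@scale_measure R]_x f x = \int[leb]_x (f x * (scale_weight x)%:E))%E.
Proof.
move=> mf f0.
apply: (@ge0_integral_density _ (measurableTypeR R) R leb (@scale_measure R) scale_weight) => //.
- exact: measurable_scale_weight.
- exact: scale_weight_ge0.
move=> A mA; rewrite -[LHS]/(\int[leb]_(u in A `&` `]0%R, +oo[) (u ^- 2)%:E)%E.
rewrite [RHS]integral_mkcond [LHS]integral_mkcond.
apply: eq_integral => x _; rewrite !patchE in_setI /scale_weight indicE.
by case: (x \in A); case: (x \in `]0%R, +oo[%classic); rewrite //= ?mul1r ?mul0r.
Qed.

End scale_density.

(** * Strip transforms *)

Section product_measure.
Context d1 d2 (T1 : measurableType d1) (T2 : measurableType d2) (R : realType).
Variables (m1 : {sigma_finite_measure set T1 -> \bar R})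
  (m2 : {sigma_finite_measure set T2 -> \bar R}).

Lemma ae_product_fst (P : T1 -> Prop) : (\forall x \ae m1, P x) ->
  \forall z \ae (m1 \x m2)%E, P z.1.
Proof.
move=> [A [mA A0 PA]]; exists (A `*` setT); split.
- exact: measurableX.
- transitivity (m1 A * m2 setT)%E; first exact: product_measure1E.
  by rewrite -[m1 A]/(_ A) A0 mul0e.
- by move=> z /= Pz; split => //; exact: PA.
Qed.

Lemma cintegral_product (f : T1 * T2 -> R[i]) : cL1 (m1 \x m2)%E f ->
  cintegral (m1 \x m2)%E f = cintegral m1 (fun x => cintegral m2 (fun y => f (x, y))).
Proof.
have key (g : T1 * T2 -> R) : (m1 \x m2)%E.-integrable setT (EFin \o g) ->
    Rintegral (m1 \x m2)%E setT g =
    Rintegral m1 setT (fun x => Rintegral m2 setT (fun y => g (x, y))).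
  move=> gi; rewrite /Rintegral -(integral12_prod_meas1 gi); congr fine.
  apply: ae_eq_integral => //.
  - exact: measurable_int (integrable_fubini_F gi).
  - apply/measurable_EFinP; apply: measurable_Rintegral_prod.
    by apply/measurable_EFinP; exact: measurable_int gi.
  - have := integrable_ae measurableT (integrable_fubini_F gi).
    by apply: ae_imp => x h _; rewrite fineK//; exact: h.
move=> fi; apply: complexP => /=.
- by rewrite key//; exact: cL1_Re.
- by rewrite key//; exact: cL1_Im.
Qed.

Lemma ge0_ae_finite (f : T1 -> \bar R) : measurable_fun setT f ->
  (forall x, 0 <= f x)%E -> (\int[m1]_x f x < +oo)%E -> \forall x \ae m1, (f x < +oo)%E.
Proof.
move=> mf f0 foo; have fi : m1.-integrable setT f.
  by apply/integrableP; split => //; under eq_integral do rewrite gee0_abs//.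
have := integrable_ae measurableT fi.
by apply: ae_imp => x /(_ Logic.I); rewrite ge0_fin_numE.
Qed.

End product_measure.

(** * The isometry common to both settings *)

Section abstract_transform.
Context (R : realType).
Local Notation leb := (@lebesgue_measure R).
Local Notation mR := (measurableTypeR R).
Variable nu : {sigma_finite_measure set mR -> \bar R}.
Variable ell : R -> R -> R[i].
Variable sg : R.
Hypothesis m_ell : cmeasurable (fun z : mR * mR => ell z.1 z.2).
Hypothesis ell_cL2 : \forall z \ae nu, cL2 leb (ell z).
Hypothesis ell_norm : \forall w \ae leb, (\int[nu]_z (normc (ell z w) ^+ 2)%:E = 1)%E.
Hypothesis sg1 : `|sg| = 1.
Local Notation zeta := (nu \x leb)%E.
Implicit Types (F G : L2 leb).

(** Here [p.1] is the scale or the time shift, and [sg] is the sign mentioned in the overview. The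
    L1 integral is used instead of the L2 transform of each slice: it is a genuine function of the
    pair p, measurable jointly. *)
Definition strip_transform F (p : mR * mR) : R[i] :=
  fourierL1 (fun w => F w * ell p.1 w) (sg * p.2).

Let u := strip_transform.

Let sg0 : sg != 0. Proof. by rewrite -normr_gt0 sg1. Qed.

Let m_u F : cmeasurable (u F).
Proof.
pose f (z : (mR * mR) * mR) : R[i] :=
  F z.2 * ell z.1.1 z.2 * expi (- (2 * pi * z.2 * (sg * z.1.2))).
rewrite (_ : u F = fun p => cintegral leb (fun w => f (p, w)))//.
apply: cmeasurable_cintegral; apply: cmeasurableM; first apply: cmeasurableM.
- exact: cmeasurable_comp (L2_cmeasurable F) measurable_snd.
- have m : measurable_fun setT (fun z : (mR * mR) * mR => (z.1.1, z.2)).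
    apply: measurable_fun_pair; last exact: measurable_snd.
    exact: measurableT_comp measurable_fst measurable_fst.
  exact: cmeasurable_comp m_ell m.
- apply: cmeasurable_expi; apply: measurable_funN => //.
  apply: measurable_funM.
    by apply: measurable_funM => //; exact: measurable_snd.
  apply: measurable_funM => //.
  exact: measurableT_comp measurable_snd measurable_fst.
Qed.

Let m_Fell F : cmeasurable (fun z : mR * mR => F z.2 * ell z.1 z.2).
Proof.
by apply: cmeasurableM => //; exact: cmeasurable_comp (L2_cmeasurable F) measurable_snd.
Qed.

Let q F (z : mR * mR) : \bar R := (normc (F z.2 * ell z.1 z.2) ^+ 2)%:E.

Let m_q F : measurable_fun setT (q F).
Proof. by apply/measurable_EFinP; apply: measurable_sqr_normc. Qed.

Let q0 F z : (0 <= q F z)%E. Proof. by rewrite lee_fin sqr_ge0. Qed.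

Let m_sect z : cmeasurable (ell z : mR -> R[i]).
Proof.
have m : measurable_fun setT (fun w : mR => (z : mR, w)) by exact: measurable_fun_pair.
exact: (cmeasurable_comp m_ell m).
Qed.

Let m_sect2 w : cmeasurable (ell^~ w : mR -> R[i]).
Proof.
have m : measurable_fun setT (fun z : mR => (z, w : mR)) by exact: measurable_fun_pair.
exact: (cmeasurable_comp m_ell m).
Qed.

(** By Tonelli the variable z can be integrated first, where |ell(z, w)|^2 has total mass 1. *)
Let energy F : (\int[nu]_z \int[leb]_w q F (z, w) = (normL2 F ^+ 2)%:E)%E.
Proof.
rewrite (fubini_tonelli _ (m_q F) (q0 F)) sqr_normL2E.
apply: ae_eq_integral => //.
- have h : measurable_fun setT (fubini_G nu (q F)) by exact: measurable_fun_fubini_tonelli_G.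
  exact: h.
- by apply/measurable_EFinP/measurable_sqr_normc; exact: L2_cmeasurable.
apply: ae_imp ell_norm => w hw _.
transitivity (\int[nu]_z ((normc (F w) ^+ 2)%:E * (normc (ell z w) ^+ 2)%:E))%E.
  by apply: eq_integral => z _; rewrite /q /= normcM exprMn EFinM.
rewrite ge0_integralZl ?hw ?mule1//.
- by apply/measurable_EFinP/measurable_sqr_normc; exact: m_sect2.
- by move=> z _; rewrite lee_fin sqr_ge0.
- by rewrite lee_fin sqr_ge0.
Qed.

Let ae_cL2 F : \forall z \ae nu, cL2 leb (fun w => F w * ell z w).
Proof.
have mF : measurable_fun setT (fubini_F leb (q F)) by exact: measurable_fun_fubini_tonelli_F.
have h := @ge0_ae_finite _ _ R nu (fubini_F leb (q F)) mF.
have {}h := h (fun z => integral_ge0 _ (fun w _ => q0 F (z, w))).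
have {}h : \forall z \ae nu, (fubini_F leb (q F) z < +oo)%E.
  by apply: h; rewrite -[X in (X < _)%E]/(\int[nu]_z \int[leb]_w q F (z, w))%E energy ltry.
apply: ae_imp h => z hz; apply: cL2_lty => //.
exact: cmeasurableM (L2_cmeasurable F) (m_sect z).
Qed.

(** The slices on which Plancherel for L1 and L2 together applies; almost every z is good for a
    given F. *)
Let good z F := cL1 leb (fun w => F w * ell z w) /\ cL2 leb (fun w => F w * ell z w).

Let ae_good F : \forall z \ae nu, good z F.
Proof.
apply: ae_imp2 ell_cL2 (ae_cL2 F) => z h1 h2; split => //.
exact: cL2_cL1M (L2_cL2 F) h1.
Qed.

Let good_u z F : good z F -> cL2 leb (fun v => u F (z, v)).
Proof.
move=> [h1 h2]; have := cL2_affine 0 sg0 (cL2_fourierL1 h1 h2).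
by under eq_fun do rewrite addr0.
Qed.

Let good_dot z F G : good z F -> good z G ->
  cintegral leb (fun v => u F (z, v) * (u G (z, v))^*) =
  cintegral leb (fun w => (F w * ell z w) * (G w * ell z w)^*).
Proof.
move=> [F1 F2] [G1 G2]; rewrite -(dot_classL2 F2 G2) -dot_fourier.
rewrite (fourier_class F1 F2) (fourier_class G1 G2).
have [F3 G3] := (cL2_fourierL1 F1 F2, cL2_fourierL1 G1 G2).
rewrite (dot_classL2 F3 G3).
have [_] := cL1_affine 0 sg0 (cL2_cL1M F3 (cL2J G3)).
rewrite sg1 invr1 mul1r => <-.
by apply: eq_cintegral => v; rewrite addr0.
Qed.

Let good_norm z F : good z F ->
  (\int[leb]_v (normc (u F (z, v)) ^+ 2)%:E = \int[leb]_w q F (z, w))%E.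
Proof.
move=> [F1 F2]; have gu := good_u (conj F1 F2).
rewrite -(sqr_norm_classL2 F2) -(norm_fourierL1 F1 F2).
rewrite (sqr_norm_classL2 (cL2_fourierL1 F1 F2)).
have m : measurable_fun [set: mR]
    (fun x => (normc (fourierL1 (fun w => F w * ell z w) x) ^+ 2)%:E).
  by apply/measurable_EFinP/measurable_sqr_normc; exact: cmeasurable_fourierL1.
have := ge0_integral_affine 0 sg0 m (fun x => sqr_ge0 _).
rewrite sg1 invr1 mul1e => <-.
by apply: eq_integral => v _; rewrite addr0.
Qed.

Lemma cL2_strip_transform F : cL2 zeta (u F).
Proof.
apply: cL2_lty; first exact: m_u.
pose p (z : mR * mR) := (normc (u F z) ^+ 2)%:E.
have mp : measurable_fun setT p by apply/measurable_EFinP; exact: measurable_sqr_normc.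
have p0 z : (0 <= p z)%E by rewrite lee_fin sqr_ge0.
rewrite -[X in (X < _)%E]/(\int[zeta]_z p z)%E (fubini_tonelli1 _ mp p0).
have -> : (\int[nu]_z fubini_F leb p z = \int[nu]_z \int[leb]_w q F (z, w))%E.
  apply: ae_eq_integral => //.
  - exact: measurable_fun_fubini_tonelli_F.
  - have h : measurable_fun setT (fubini_F leb (q F)).
      exact: measurable_fun_fubini_tonelli_F.
    exact: h.
  - by apply: ae_imp (ae_good F) => z gz _; exact: good_norm.
by rewrite energy ltry.
Qed.

Definition strip_op F : L2 zeta := classL2 zeta (u F).

Lemma strip_op_linear (c : R[i]) F G :
  strip_op (c *: F + G) = c *: strip_op F + strip_op G.
Proof.
have [uF uG] := (cL2_strip_transform F, cL2_strip_transform G).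
rewrite -(classL2Z c uF) -(classL2D (cL2Z c uF) uG).
apply: eq_classL2.
- exact: cL2_strip_transform.
- exact: cL2D (cL2Z c uF) uG.
(* Linearity of the Fourier integral is available on the slices that are good for both F and G,
   hence on almost all of them. *)
apply: ae_imp2 (ae_product_fst _ (ae_good F)) (ae_product_fst _ (ae_good G)).
move=> z [F1 _] [G1 _] _.
rewrite -(congr1 (fun h => h _) (fourierL1_linear c F1 G1)).
apply: (congr1 (fun h => h (sg * z.2))).
have m : cmeasurable (fun w => (c *: F + G : L2 leb) w * ell z.1 w).
  exact: cmeasurableM (L2_cmeasurable _) (m_sect _).
have e : (fun w => c * (F w * ell z.1 w) + G w * ell z.1 w) =
    (fun w => (c *: F + G : L2 leb) w * ell z.1 w) %[ae leb].
  apply: ae_imp2 (L2_addE (c *: F) G) (L2_scaleE c F) => x h1 h2 _.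
  by rewrite h1// h2//; ring.
have h := cL1D (cL1Z c F1) G1.
apply/esym/eq_fourierL1 => //; exact: ae_eq_cL1 m e h.
Qed.

(** When al is the indicator of a set Y, this is the function gamma attached to Y. *)
Definition strip_symbol (al : mR -> R[i]) (w : R) : R[i] :=
  cintegral nu (fun z => al z * (normc (ell z w) ^+ 2)%:C).

Section strip_dot.
Variables (al : mR -> R[i]) (F G : L2 leb).
Hypothesis bal : bounded_cfun al.

Let h (x : mR * mR) : R[i] := al x.1 * (F x.2 * ell x.1 x.2 * (G x.2 * ell x.1 x.2)^*).

Let m_h : cmeasurable h.
Proof.
apply: cmeasurableM; first exact: cmeasurable_comp bal.1 measurable_fst.
by apply: cmeasurableM => //; exact: cmeasurableJ.
Qed.

Let h_fin : (\int[nu]_z \int[leb]_w (normc (h (z, w)))%:E < +oo)%E.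
Proof.
have [_ [M alM]] := bal.
have M0 : 0 <= M by apply: le_trans (alM 0); exact: normc_ge0.
pose k (x : mR * mR) : \bar R := (M%:E * (q F x + q G x))%E.
have mqq : measurable_fun setT (fun x => q F x + q G x)%E by exact: emeasurable_funD.
have mk : measurable_fun setT k by exact: emeasurable_funM.
have k0 x : (0 <= k x)%E by apply: mule_ge0; [rewrite lee_fin|exact: adde_ge0].
pose p (x : mR * mR) : \bar R := (normc (h x))%:E.
have mp : measurable_fun setT p by apply/measurable_EFinP; exact: measurable_normc.
have p0 x : (0 <= p x)%E by rewrite lee_fin normc_ge0.
have pk x : (p x <= k x)%E.
  rewrite /k /p -EFinD -EFinM lee_fin /h normcM; apply: ler_pM; rewrite ?normc_ge0//.
  by apply: le_trans (normc_mul_le _ _) _; rewrite normcJ.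
rewrite -[X in (X < _)%E]/(\int[nu]_z fubini_F leb p z)%E -(fubini_tonelli1 _ mp p0).
apply: (@le_lt_trans _ _ (\int[zeta]_x k x)%E); first exact: ge0_le_integral.
rewrite ge0_integralZl//; last by move=> x _; rewrite adde_ge0.
rewrite ge0_integralD// !(fubini_tonelli1 _ (m_q _) (q0 _)).
have e H : (\int[nu]_x fubini_F leb (q H) x)%E = (normL2 H ^+ 2)%:E := energy H.
by rewrite !e -EFinD -EFinM ltry.
Qed.

Let cL1_kernel : \forall w \ae leb, cL1 nu (fun z => al z * (normc (ell z w) ^+ 2)%:C).
Proof.
have [_ [M alM]] := bal.
apply: ae_imp ell_norm => w hw.
have m : measurable_fun setT (fun z : mR => normc (ell z w) ^+ 2).
  exact: measurable_sqr_normc.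
have i : nu.-integrable setT (EFin \o (fun z : mR => normc (ell z w) ^+ 2)).
  apply/integrableP; split; first exact/measurable_EFinP.
  rewrite (_ : (\int[nu]_x _)%E = 1%E) ?ltry// -hw.
  by apply: eq_integral => z _; rewrite abse_EFin ger0_norm ?sqr_ge0.
apply: le_cL1 (integrableRZ M i) => [|z].
  by apply: cmeasurableM; [exact: bal.1|exact: cmeasurableR].
by rewrite normcM normc_real ger0_norm ?sqr_ge0// ler_wpM2r ?sqr_ge0.
Qed.

Lemma cmeasurable_strip_symbol : @cmeasurable _ mR _ (strip_symbol al).
Proof.
pose f (x : mR * mR) : R[i] := al x.2 * (normc (ell x.2 x.1) ^+ 2)%:C.
rewrite (_ : strip_symbol al = fun w => cintegral nu (fun z => f (w, z)))//.
apply: cmeasurable_cintegral; apply: cmeasurableM.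
  exact: cmeasurable_comp bal.1 measurable_snd.
apply: cmeasurableR; apply: measurable_sqr_normc.
exact: cmeasurable_comp m_ell (measurable_fun_pair measurable_snd measurable_fst).
Qed.

(** On each slice al is constant and Plancherel removes the Fourier transform; exchanging the
    integrals then leaves the mean of al against |ell(., w)|^2. *)
Lemma dot_strip_op :
  dotL2 (mulL2 zeta (fun x => al x.1) (strip_op F)) (strip_op G) =
  cintegral leb (fun w => strip_symbol al w * (F w * (G w)^*)).
Proof.
have ba1 : bounded_cfun (fun x : mR * mR => al x.1).
  have [mal [M alM]] := bal; split; last by exists M => x; exact: alM.
  exact: cmeasurable_comp mal measurable_fst.
have [uF uG] := (cL2_strip_transform F, cL2_strip_transform G).
rewrite (mulL2_class ba1 uF) (dot_classL2 (bounded_cfun_cL2 ba1 uF) uG).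
rewrite cintegral_product; last first.
  exact: cL2_cL1M (bounded_cfun_cL2 ba1 uF) (cL2J uG).
have [h1 _ h2] := cfubini m_h h_fin.
transitivity (cintegral nu (fun z => cintegral leb (fun w => h (z, w)))).
  have mu_ : cmeasurable (fun x => al x.1 * u F x * (u G x)^*).
    by apply: cmeasurableM; [apply: cmeasurableM => //; case: ba1|exact: cmeasurableJ].
  apply: ae_eq_cintegral.
  - exact: cmeasurable_cintegral mu_.
  - exact: cmeasurable_cintegral m_h.
  apply: ae_imp2 (ae_good F) (ae_good G) => z gF gG _.
  have [F1 F2] := gF; have [G1 G2] := gG.
  transitivity (al z * cintegral leb (fun v => u F (z, v) * (u G (z, v))^*)).
    rewrite -cintegralZ; last exact: cL2_cL1M (good_u gF) (cL2J (good_u gG)).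
    by apply: eq_cintegral => v; rewrite mulrA.
  rewrite (good_dot gF gG) -cintegralZ; last exact: cL2_cL1M F2 (cL2J G2).
  by [].
rewrite h2; apply: ae_eq_cintegral.
- exact: cmeasurable_cintegral (cmeasurable_comp m_h (measurable_fun_pair measurable_snd measurable_fst)).
- apply: cmeasurableM; first exact: cmeasurable_strip_symbol.
  by apply: cmeasurableM; [exact: L2_cmeasurable|apply: cmeasurableJ; exact: L2_cmeasurable].
apply: ae_imp cL1_kernel => w hw _; rewrite mulrC /strip_symbol -cintegralZ//.
apply: eq_cintegral => z; rewrite /h /= conjcM -mulCJ; ring.
Qed.

End strip_dot.

End abstract_transform.

(** * The two settings *)

Section models.
Context (R : realType).
Local Notation leb := (@lebesgue_measure R).
Local Notation mR := (measurableTypeR R).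
Implicit Types (s : setting) (Psi F f : L2 leb).

Lemma measurable_sub_model : measurable_fun setT ((fun z : mR * mR => (z.2 : R) - (z.1 : R)) :
  mR * mR -> mR).
Proof.
have : measurable_fun [set: mR * mR] (fun z : mR * mR => (z.2 : R) - (z.1 : R)).
  by apply: measurable_funB; [exact: measurable_snd|exact: measurable_fst].
exact.
Qed.

Lemma measurable_mul_model : measurable_fun setT ((fun z : mR * mR => (z.1 : R) * (z.2 : R)) :
  mR * mR -> mR).
Proof.
have : measurable_fun [set: mR * mR] (fun z : mR * mR => (z.1 : R) * (z.2 : R)).
  by apply: measurable_funM; [exact: measurable_fst|exact: measurable_snd].
exact.
Qed.

Lemma measurable_sqrt_fst : measurable_fun setT (fun z : mR * mR => Num.sqrt (z.1 : R)).
Proof.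
have h : measurable_fun [set: mR] (fun x : R => Num.sqrt x).
  by apply: continuous_measurable_fun; exact: sqrt_continuous.
exact: measurableT_comp h measurable_fst.
Qed.

Lemma cmeasurable_ell s Psi : cmeasurable (fun z : mR * mR => ell s Psi z.1 z.2).
Proof.
case: s => /=.
- apply: cmeasurableM; first by apply: cmeasurableR; exact: measurable_sqrt_fst.
  apply: cmeasurableJ.
  exact: cmeasurable_comp (L2_cmeasurable (fourier Psi)) measurable_mul_model.
- apply: cmeasurableJ; exact: cmeasurable_comp (L2_cmeasurable Psi) measurable_sub_model.
Qed.

Lemma normc_ell_wavelet Psi z xi : 0 <= z ->
  normc (ell Wavelet Psi z xi) ^+ 2 = z * normc (fourier Psi (z * xi)) ^+ 2.
Proof. by move=> z0; rewrite /= normcM normc_real normcJ exprMn real_normK ?num_real// sqr_sqrtr. Qed.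

Lemma scale_measure_nonpos : @scale_measure R `]-oo, 0]%classic = 0%E.
Proof.
rewrite /scale_measure (_ : _ `&` _ = set0) ?integral_set0//.
by apply/seteqP; split => // x /= []; rewrite !in_itv/= andbT; lra.
Qed.

Lemma ae_G1 s : \forall z \ae zeta1 R s, G1 R s z.
Proof.
case: s; last exact: aeW.
exists `]-oo, 0]%classic; split => //; first exact: scale_measure_nonpos.
by move=> z /=; rewrite !in_itv/= andbT => /negP; rewrite -leNgt.
Qed.

Lemma ell_cL2 s Psi : \forall z \ae zeta1 R s, cL2 leb (ell s Psi z).
Proof.
apply: ae_imp (ae_G1 s) => z; case: s => /=.
- rewrite in_itv/= andbT => z0.
  apply: cL2Z; apply: cL2J.
  have := cL2_affine 0 (lt0r_neq0 z0) (L2_cL2 (fourier Psi)).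
  by under eq_fun do rewrite addr0.
- move=> _; apply: cL2J.
  have := cL2_affine (- z) (oner_neq0 R) (L2_cL2 Psi).
  by under eq_fun do rewrite mul1r.
Qed.

Lemma ae_frequencies s : \forall xi \ae leb, frequencies s xi.
Proof.
case: s; last exact: aeW.
exists [set 0]; split => //; first exact: lebesgue_measure_set1.
by move=> x /= /negP; rewrite negbK => /eqP.
Qed.

(** The transform of the wavelet atom carries exp(-2 pi i v w), which the inner product conjugates;
    v thus enters with the sign opposite to that of the Fourier kernel. In the time-frequency case
    the conjugated modulation already has the sign of the kernel. *)
Definition orientation s : R := if s is Wavelet then -1 else 1.

Lemma orientation1 s : `|orientation s| = 1.
Proof. by case: s; rewrite /= ?normrN normr1. Qed.

Definition frequency_side s f : L2 leb := if s is Wavelet then fourier f else f.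

(** Makes the range of the transform equal to the range of the isometry and not merely contained in
    it. *)
Lemma frequency_side_surj s G : exists f, frequency_side s f = G.
Proof. by case: s; [exists (fourier_adj G); exact: fourier_adjK|exists G]. Qed.

Lemma transformE s Psi f :
  transform s Psi f = strip_op (zeta1 R s) (ell s Psi) (orientation s) (frequency_side s f).
Proof.
congr classL2; apply/funext => -[u v]; rewrite /strip_transform.
case: s => /=.
(* Scales u <= 0 are not charged by the measure, but the identity holds there too: the conventions
   sqrt u = 0 and 0^-1 = 0 make both sides vanish. *)
- have [u0|u0] := leP u 0.
    have -> : classL2 leb (fun x => ((Num.sqrt u)^-1)%:C * Psi ((x - v) / u)) = 0.
      transitivity (classL2 leb (fun x => 0 * Psi x)).
        by congr classL2; apply/funext => x; rewrite ler0_sqrtr// invr0 !mul0r.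
      by rewrite (classL2Z 0 (L2_cL2 Psi)) scale0r.
    rewrite dot0r ler0_sqrtr// -[LHS](cintegral0 leb).
    by apply: eq_cintegral => x; rewrite mul0r mulr0 mul0r.
  have un0 : u != 0 by rewrite gt_eqF.
  have uV0 : u^-1 != 0 by rewrite invr_eq0.
  have -> : classL2 leb (fun x => ((Num.sqrt u)^-1)%:C * Psi ((x - v) / u)) =
      ((Num.sqrt u)^-1)%:C *: affL2 u^-1 (- v / u) Psi.
    rewrite -(classL2Z _ (cL2_affine (- v / u) uV0 (L2_cL2 Psi))); congr classL2.
    by apply/funext => x; rewrite mulrBl mulNr (mulrC x).
  rewrite dotZr conjcR -dot_fourier (fourier_affine _ _ uV0) invrK.
  have p2 : cL2 leb (fun x => fourier Psi (u * x)).
    have := cL2_affine 0 un0 (L2_cL2 (fourier Psi)).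
    by under eq_fun do rewrite addr0.
  have -> : affL2 u 0 (fourier Psi) = classL2 leb (fun x => fourier Psi (u * x)).
    by congr classL2; apply/funext => x; rewrite addr0.
  rewrite divfK// (mulL2_class (bounded_modulation _) p2) dotZr conjcR.
  have p3 := bounded_cfun_cL2 (bounded_modulation (- v)) p2.
  rewrite -{1}(classL2_repr (fourier f)) (dot_classL2 (L2_cL2 _) p3).
  rewrite mulrA -rmorphM -cintegralZ; last exact: cL2_cL1M (L2_cL2 _) (cL2J p3).
  apply: eq_cintegral => x; rewrite conjcM conj_expi.
  (* The normalization u^(-1/2) of the atom and the Jacobian u of the dilation combine into the
     factor sqrt u of [ell]. *)
  have -> : (Num.sqrt u)^-1 * `|u^-1|^-1 = Num.sqrt u.
    rewrite gtr0_norm ?invr_gt0// invrK -{2}(sqr_sqrtr (ltW u0)) expr2 mulKf//.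
    by rewrite gt_eqF// sqrtr_gt0.
  have -> : 2 * pi * x * (-1 * v) = 2 * pi * - v * x by ring.
  by ring.
- rewrite -{1}(classL2_repr f) dot_classL2; last 2 first.
  + exact: L2_cL2.
  + apply: (cL2_bounded_mul (M := 1)) => [|x|].
    * exact: (bounded_modulation v).1.
    * by rewrite normc_expi.
    * have := cL2_affine (- u) (oner_neq0 R) (L2_cL2 Psi).
      by under eq_fun do rewrite mul1r.
  apply: eq_cintegral => x; rewrite conjcM conj_expi.
  have -> : 2 * pi * x * (1 * v) = 2 * pi * v * x by ring.
  by ring.
Qed.

End models.

(** * The gamma functions *)

Section gamma_functions.
Context (R : realType).
Local Notation leb := (@lebesgue_measure R).
Local Notation mR := (measurableTypeR R).
Implicit Types (s : setting) (Psi : L2 leb).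

(** A null set contains no nondegenerate interval. This extracts from admissibility one actual
    frequency of each sign. *)
Lemma ae_itv_exists (a b : R) (P : R -> Prop) : a < b ->
  (\forall x \ae leb, P x) -> exists2 x, a < x < b & P x.
Proof.
move=> ab [N [mN N0 PN]]; apply: contrapT => h.
have sub : (`]a, b[%classic : set R) `<=` N.
  move=> x /=; rewrite in_itv/= => xab; apply: PN => /= Px.
  by apply: h; exists x.
have : (leb `]a, b[%classic <= leb N)%E by apply: le_measure => //; rewrite inE.
rewrite N0 lebesgue_measure_itv/= lte_fin ab -EFinB lee_fin; lra.
Qed.

Lemma near_dist_le (x0 d : R) : 0 < d -> \forall x \near x0, `|x - x0| <= d.
Proof.
by move=> d0; apply/nbhs_ballP; exists d => //= x; rewrite /ball/= distrC => /ltW.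
Qed.

Lemma near_frequencies s (x0 : R) : frequencies s x0 ->
  \forall x \near x0, frequencies s x.
Proof.
case: s => /= [x0n|_]; last by apply/nbhs_ballP; exists 1 => /=.
apply/nbhs_ballP; exists `|x0| => /= [|x]; first by rewrite normr_gt0.
by rewrite /ball/=; apply: contraTneq => ->; rewrite subr0 ltxx.
Qed.

Section wavelet.
Variable Psi : L2 leb.
Hypothesis adm : admissible Wavelet Psi.

Let psi w : R := normc (fourier Psi w) ^+ 2.

Let m_psi : measurable_fun [set: mR] psi.
Proof. by apply: measurable_sqr_normc; exact: L2_cmeasurable. Qed.

Let psi0 w : 0 <= psi w. Proof. exact: sqr_ge0. Qed.

Let m_inv : measurable_fun [set: mR] (fun w : R => `|w|^-1).
Proof.
have -> : (fun w : R => `|w|^-1) = (fun w : R => `|w| `^ (-1)).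
  by apply/funext => w; rewrite powR_inv1.
exact: measurableT_comp (measurable_powR (-1)) (@normr_measurable R setT).
Qed.

(** The density |psihat(w)|^2 / |w| on the half-line of the sign of b; its integral is the
    admissibility integral at any frequency of that sign. *)
Let side (b w : R) : R := \1_`]0, +oo[ (b * w) * (psi w * `|w|^-1).

Let side0 b w : 0 <= side b w.
Proof.
apply: mulr_ge0; first by rewrite indicE ler0n.
by apply: mulr_ge0 => //; rewrite invr_ge0.
Qed.

Let m_side b : measurable_fun [set: mR] (fun w => (side b w)%:E).
Proof.
apply/measurable_EFinP; apply: measurable_funM; last exact: measurable_funM.
have m := measurable_affine b 0.
have h : measurable_fun [set: mR] (\1_`]0, +oo[ : mR -> R) by exact: measurable_indic.
have := measurableT_comp h m.
by congr measurable_fun; apply/funext => x; rewrite /= addr0.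
Qed.

(** The substitution w = t xi, under which dt / t is invariant. *)
Let dilate xi : xi != 0 ->
  (\int[leb]_(t in `]0%R, +oo[) (psi (t * xi) / t)%:E = \int[leb]_w (side (Num.sg xi) w)%:E)%E.
Proof.
move=> xi0.
have h := ge0_integral_affine 0 xi0 (m_side (Num.sg xi)) (fun w => side0 _ w).
have xn0 : `|xi| != 0 by rewrite normr_eq0.
transitivity (`|xi|%:E * \int[leb]_t (side (Num.sg xi) (xi * t + 0))%:E)%E; last first.
  by rewrite h muleA -EFinM mulfV// mul1e.
rewrite -ge0_integralZl//; last 2 first.
- have := measurableT_comp (m_side (Num.sg xi)) (measurable_affine xi 0); exact.
- by move=> x _; rewrite lee_fin.
rewrite [LHS]integral_mkcond; apply: eq_integral => t _.
have sx : Num.sg xi * (xi * t) = `|xi| * t by rewrite mulrA -normrEsg.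
rewrite patchE -EFinM addr0 /side sx indicE.
rewrite /= mem_setE !in_itv/= !andbT pmulr_rgt0 ?normr_gt0//.
case: ifPn => t0; last by rewrite mul0r mulr0.
rewrite mul1r normrM (gtr0_norm t0) invfM (mulrC t); congr EFin.
by rewrite mulrCA (mulrA `|xi|) mulfV// mul1r.
Qed.

(** A single frequency of the sign of b at which admissibility holds is enough, and it is found in
    ]0, 1[ or in ]-1, 0[. *)
Let side1 b : (b == 1) || (b == -1) -> (\int[leb]_w (side b w)%:E = 1)%E.
Proof.
have [_ ha] := adm.
case/orP => /eqP ->.
- have [xi /andP[x0 x1] hx] := ae_itv_exists (@ltr01 R) ha.
  by have := dilate (lt0r_neq0 x0); rewrite (gtr0_sg x0) => <-.
- have [xi /andP[x0 x1] hx] := ae_itv_exists (@ltrN10 R) ha.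
  by have := dilate (ltr0_neq0 x1); rewrite (ltr0_sg x1) => <-.
Qed.

(** Valid at every nonzero xi and not just almost everywhere, because by [dilate] the integral sees
    only the sign of xi. The factor z of |ell|^2 against the density z^-2 leaves dz / z. *)
Lemma wavelet_reconstruction xi : xi != 0 ->
  (\int[@scale_measure R]_z (normc (ell Wavelet Psi z xi) ^+ 2)%:E = 1)%E.
Proof.
move=> xi0; rewrite ge0_integral_scale; last 2 first.
- have m : measurable_fun setT (fun z : mR => (z, xi : mR)) by exact: measurable_fun_pair.
  by apply/measurable_EFinP/measurable_sqr_normc; exact: (cmeasurable_comp (cmeasurable_ell Wavelet Psi) m).
- by move=> z; rewrite lee_fin sqr_ge0.
rewrite -(side1 (b := Num.sg xi)); last by case: sgrP xi0; rewrite ?eqxx ?orbT.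
rewrite -dilate// [RHS]integral_mkcond; apply: eq_integral => z _.
rewrite patchE -EFinM /scale_weight indicE mem_setE/= in_itv/= andbT.
case: ifPn => z0; last by rewrite mul0r mulr0.
rewrite normc_ell_wavelet ?ltW// -/(psi _) mul1r; congr EFin.
rewrite mulrAC mulrC; congr (_ * _); rewrite -exprVn expr2 mulrA mulfV ?mul1r ?(gt_eqF z0)//.
Qed.

(* At w = 0 the inverse gives 0; a null set is irrelevant. *)
Definition wavelet_profile (w : R) : R[i] := ((Num.sqrt `|w|)^-1)%:C * fourier Psi w.

Let sqr_profile w : normc (wavelet_profile w) ^+ 2 = psi w * `|w|^-1.
Proof.
by rewrite normcM normc_real exprMn real_normK ?num_real// exprVn sqr_sqrtr// mulrC.
Qed.

(** The squared norm splits over the two half-lines, and admissibility bounds each part by 1. *)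
Lemma cL2_wavelet_profile : cL2 leb wavelet_profile.
Proof.
apply: cL2_lty.
  apply: cmeasurableM; last exact: L2_cmeasurable.
  apply: cmeasurableR.
  have h : measurable_fun [set: mR] (fun x : R => Num.sqrt x).
    by apply: continuous_measurable_fun; exact: sqrt_continuous.
  have := measurableT_comp h m_inv; congr measurable_fun; apply/funext => x.
  by rewrite /= sqrtrV.
apply: (@le_lt_trans _ _ (\int[leb]_w ((side 1 w)%:E + (side (-1) w)%:E))%E); last first.
  rewrite ge0_integralD//; last 2 first.
  - by move=> w _; rewrite lee_fin.
  - by move=> w _; rewrite lee_fin.
  by rewrite !side1 ?eqxx ?orbT// -EFinD ltry.
apply: ae_ge0_le_integral => //.
- by move=> w _; rewrite lee_fin sqr_ge0.
- apply/measurable_EFinP; under eq_fun do rewrite sqr_profile; exact: measurable_funM.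
- by move=> w _; rewrite -EFinD lee_fin addr_ge0.
- exact: emeasurable_funD.
- apply: ae_imp (ae_frequencies R Wavelet) => w /= w0 _.
  rewrite sqr_profile -EFinD lee_fin /side !indicE !mem_setE/= !in_itv/= !andbT.
  rewrite mul1r mulN1r oppr_gt0.
  by case: (ltgtP w 0) w0; rewrite ?eqxx//= => *; rewrite ?mul1r ?mul0r ?addr0 ?add0r.
Qed.

(** For z > 0 the integrand |psihat(z xi)|^2 / z equals |xi| times the squared modulus of the
    profile at z xi. *)
Lemma wavelet_gammaE xi (A : set mR) : xi != 0 -> measurable A -> A `<=` `]0, +oo[ ->
  (\int[@scale_measure R]_(z in A) (normc (ell Wavelet Psi z xi) ^+ 2)%:E =
   (`|xi| * normL2 (mulL2 leb (fun z => (\1_A z)%:C)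
      (affL2 xi 0 (classL2 leb wavelet_profile))) ^+ 2)%:E)%E.
Proof.
move=> xi0 mA A0.
have p2 := cL2_affine 0 xi0 cL2_wavelet_profile.
have bA : bounded_cfun (fun z : mR => (\1_A z)%:C : R[i]).
  by split; [exact: cmeasurable_indic|exists 1; exact: normc_indic].
rewrite (affL2_class 0 xi0 cL2_wavelet_profile) (mulL2_class bA p2).
rewrite EFinM (sqr_norm_classL2 (bounded_cfun_cL2 bA p2)) -ge0_integralZl//; last 2 first.
- by apply/measurable_EFinP/measurable_sqr_normc; case: (bounded_cfun_cL2 bA p2).
- by move=> z _; rewrite lee_fin sqr_ge0.
have m : measurable_fun setT (fun z : mR => (z, xi : mR)) by exact: measurable_fun_pair.
have m2 : measurable_fun [set: mR] (fun z => (normc (ell Wavelet Psi z xi) ^+ 2)%:E).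
  apply/measurable_EFinP/measurable_sqr_normc.
  exact: (cmeasurable_comp (cmeasurable_ell Wavelet Psi) m).
rewrite [LHS]integral_mkcond ge0_integral_scale; last 2 first.
- by apply/(measurable_restrictT _ _).1 => //; exact: measurable_funS m2.
- by move=> z; rewrite patchE; case: ifP => // _; rewrite lee_fin sqr_ge0.
apply: eq_integral => z _; rewrite patchE -EFinM normcM exprMn normc_real.
rewrite [in RHS]indicE; case: ifPn => [/set_mem/A0 z0|_]; last first.
  by rewrite mul0e normr0 expr0n /= mul0r mulr0.
have {}z0 : 0 < z by move: z0; rewrite /= in_itv/= andbT.
rewrite normr1 expr1n mul1r addr0 sqr_profile -EFinM; congr EFin.
rewrite normc_ell_wavelet ?ltW// /scale_weight indicE mem_set/= ?in_itv/= ?z0// mul1r.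
rewrite normrM (gtr0_norm z0) -/(psi _) (mulrC xi) /psi.
have xn0 : `|xi| != 0 by rewrite normr_eq0.
by field; rewrite xn0 gt_eqF.
Qed.

End wavelet.

Section admissible_gamma.
Variables (s : setting) (Psi : L2 leb).
Hypothesis adm : admissible s Psi.

Let mell xi : @cmeasurable _ mR _ (ell s Psi ^~ xi).
Proof.
have m : measurable_fun setT (fun z : mR => (z, xi : mR)) by exact: measurable_fun_pair.
exact: (cmeasurable_comp (cmeasurable_ell s Psi) m).
Qed.

Let bounded_indic (A : set mR) : measurable A ->
  bounded_cfun (fun z : mR => (\1_A z)%:C : R[i]).
Proof.
by move=> mA; split; [exact: cmeasurable_indic|exists 1; exact: normc_indic].
Qed.

(** One shape for both settings, from which continuity follows: c = |xi|, slope xi, shift 0 and the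
    wavelet profile in one case; c = 1, slope -1, shift xi and the window itself in the other. *)
Lemma gamma_form : exists (c al be : R -> R) (eta : L2 leb),
  [/\ continuous c, (forall x y, `|al x - al y| <= `|x - y|),
      (forall x y, `|be x - be y| <= `|x - y|),
      (forall xi, frequencies s xi -> al xi != 0) &
      forall xi (A : set mR), frequencies s xi -> measurable A -> A `<=` G1 R s ->
  (\int[zeta1 R s]_(z in A) (normc (ell s Psi z xi) ^+ 2)%:E =
   (c xi * normL2 (mulL2 leb (fun z => (\1_A z)%:C) (affL2 (al xi) (be xi) eta)) ^+ 2)%:E)%E].
Proof.
move: adm; case: s => /= adms.
- exists Num.norm, id, (fun=> 0), (classL2 leb (wavelet_profile Psi)); split => //.
  + by move=> x; exact: norm_continuous.
  + by move=> x y; rewrite subrr normr0.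
  + exact: wavelet_gammaE.
- exists (fun=> 1), (fun=> -1), id, Psi; split => //.
  + by move=> x; exact: cvg_cst.
  + by move=> x y; rewrite subrr normr0.
  move=> xi A _ mA _.
  have m1 : (-1 : R) != 0 by rewrite oppr_eq0 oner_neq0.
  have p2 := cL2_affine xi m1 (L2_cL2 Psi).
  rewrite mul1r -{2}(classL2_repr Psi) (affL2_class xi m1 (L2_cL2 Psi)).
  rewrite (mulL2_class (bounded_indic mA) p2).
  rewrite (sqr_norm_classL2 (bounded_cfun_cL2 (bounded_indic mA) p2)).
  rewrite [LHS]integral_mkcond; apply: eq_integral => z _.
  rewrite patchE normcM exprMn normc_real [in RHS]indicE; case: ifPn => _.
    by rewrite normr1 expr1n mul1r normcJ mulN1r addrC.
  by rewrite normr0 expr0n/= mul0r.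
Qed.

Lemma reconstruction xi : frequencies s xi ->
  (\int[zeta1 R s]_z (normc (ell s Psi z xi) ^+ 2)%:E = 1)%E.
Proof.
move: adm; case: s => /= adms; first exact: wavelet_reconstruction.
move=> _; have m1 : (-1 : R) != 0 by rewrite oppr_eq0 oner_neq0.
have m : measurable_fun [set: mR] (fun x => (normc (Psi x) ^+ 2)%:E).
  by apply/measurable_EFinP/measurable_sqr_normc; exact: L2_cmeasurable.
have := ge0_integral_affine xi m1 m (fun x => sqr_ge0 _).
rewrite -sqr_normL2E adms expr1n normrN normr1 invr1 mul1e => <-.
by apply: eq_integral => z _; rewrite normcJ mulN1r addrC.
Qed.

(** [gamma_form] shows the integral to be finite, so nothing is lost by the [fine] inside
    [Rintegral]. *)
Lemma gammaE xi (A : set mR) : frequencies s xi -> measurable A -> A `<=` G1 R s ->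
  ((gamma s Psi A xi)%:E = \int[zeta1 R s]_(z in A) (normc (ell s Psi z xi) ^+ 2)%:E)%E.
Proof.
move=> fxi mA A1; have [c [al [be [eta [_ _ _ _ h]]]]] := gamma_form.
by rewrite /gamma /Rintegral h.
Qed.

Lemma gamma_ge0 xi A : 0 <= gamma s Psi A xi.
Proof. by apply: Rintegral_ge0 => z _; exact: sqr_ge0. Qed.

Lemma gamma_continuous xi0 (A : set mR) : frequencies s xi0 -> measurable A ->
  A `<=` G1 R s -> gamma s Psi A xi @[xi --> xi0] --> gamma s Psi A xi0.
Proof.
move=> f0 mA A1; have [c [al [be [eta [cc ca cb a0 h]]]]] := gamma_form.
pose N xi := normL2 (mulL2 leb (fun z => (\1_A z)%:C) (affL2 (al xi) (be xi) eta)).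
have e xi : frequencies s xi -> gamma s Psi A xi = c xi * N xi ^+ 2.
  by move=> fxi; apply: EFin_inj; rewrite (gammaE fxi mA A1) h.
have cN : N xi @[xi --> xi0] --> N xi0.
  apply/cvgrPdist_le => eps e0.
  have [d d0 hd] := affL2_continuous eta (be xi0) (a0 _ f0) e0.
  near=> xi.
  have xd : `|xi - xi0| <= d.
    by near: xi; exact: near_dist_le.
  apply: le_trans (dist_normL2 _ _) _; rewrite normL2BC.
  rewrite -scaleN1r addrC -(mulL2_linear _ _ _ (bounded_indic mA)).
  apply: le_trans (norm_mulL2_le _ (bounded_indic mA).1 ler01 (normc_indic _)) _.
  rewrite mul1r scaleN1r addrC; apply: hd; first exact: le_trans (ca _ _) xd.
  exact: le_trans (cb _ _) xd.
rewrite (e _ f0); apply: (@cvg_trans _ ((fun xi => c xi * N xi ^+ 2) @ xi0)).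
  apply: near_eq_cvg; near=> xi; apply/esym/e.
  by near: xi; exact: near_frequencies.
have c1 : c xi @[xi --> xi0] --> c xi0 by exact: cc.
exact: (cvgM c1 (cvgM cN cN)).
Unshelve. all: by end_near.
Qed.

End admissible_gamma.

End gamma_functions.

(** * The Stone-Weierstrass theorem *)

Section sqrt_iteration.
Context (R : realType).

(* Polynomials in t increasing to |t| on [-1, 1]. *)
Fixpoint abs_iter (t : R) (n : nat) : R :=
  if n is k.+1 then abs_iter t k + (t ^+ 2 - abs_iter t k ^+ 2) / 2 else 0.

(** With a = |t| and q the n-th iterate, one step multiplies the error a - q by 1 - (a + q) / 2 <= 1
    - a / 2, while (1 - a / 2) (1 + (n + 1) a / 2) <= 1 + n a / 2. The second bound is thus
    preserved, and it yields an error 2 / n uniform in t. *)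
Lemma abs_iter_bounds t n : `|t| <= 1 -> 0 <= abs_iter t n <= `|t| /\
  (`|t| - abs_iter t n) * (1 + n%:R * `|t| / 2) <= `|t|.
Proof.
move=> t1; have t0 := normr_ge0 t.
have t2 : t ^+ 2 = `|t| ^+ 2 by rewrite real_normK ?num_real.
elim: n => [|n [/andP[q0 q1] q2]] /=; first by rewrite lexx t0 mul0r mul0r addr0 subr0 mulr1.
have -> : n.+1%:R = n%:R + 1 :> R by rewrite natr1.
rewrite t2; move: (abs_iter t n) q0 q1 q2 => q q0 q1 q2.
have n0 : 0 <= n%:R :> R by [].
move: `|t| n%:R t0 t1 n0 q1 q2 => a k a0 a1 k0 q1 q2.
have e : a - (q + (a ^+ 2 - q ^+ 2) / 2) = (a - q) * (1 - (a + q) / 2) by field.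
have d0 : 0 <= (a - q) * (1 - (a + q) / 2) by apply: mulr_ge0; lra.
split; first by apply/andP; split; nra.
rewrite e; apply: le_trans q2; rewrite -mulrA; apply: ler_wpM2l; first lra.
apply: (@le_trans _ _ ((1 - a / 2) * (1 + (k + 1) * a / 2))).
  by apply: ler_wpM2r; [nra|lra].
nra.
Qed.

Lemma abs_iter_cvg t n : `|t| <= 1 -> `| `|t| - abs_iter t n.+1| <= 2 / n.+1%:R.
Proof.
move=> t1; have [/andP[q0 q1] q2] := abs_iter_bounds n.+1 t1.
rewrite ger0_norm ?subr_ge0// ler_pdivlMr//.
have n0 : 1 <= n.+1%:R :> R by rewrite ler1n.
have [t0|t0] := eqVneq `|t| 0; first by rewrite t0 in q1 *; nra.
have {}t0 : 0 < `|t| by rewrite lt0r t0 normr_ge0.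
rewrite -(ler_pM2r t0); move: q2 q1 q0 t0 n0.
by move: `|t| (abs_iter t n.+1) n.+1%:R => a q k; nra.
Qed.

End sqrt_iteration.

Section stone_weierstrass.
Context (R : realType) (m : nat) (N : set 'rV[R]_m).
Hypothesis cN : compact N.
Variable A : set (N -> R).
Hypothesis A_cst : forall c, A (fun=> c).
Hypothesis A_D : forall f g, A f -> A g -> A (fun x => f x + g x).
Hypothesis A_M : forall f g, A f -> A g -> A (fun x => f x * g x).
Hypothesis A_coord : forall k, A (fun x : N => set_val x ord0 k).
Hypothesis A_bounded : forall f, A f -> exists C, forall x, `|f x| <= C.
Hypothesis A_lim : forall f, (forall e, 0 < e ->
  exists2 g, A g & forall x, `|f x - g x| <= e) -> A f.

Let A_Z c f : A f -> A (fun x => c * f x). Proof. exact: A_M. Qed.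

Let A_B f g : A f -> A g -> A (fun x => f x - g x).
Proof. by move=> Af /(A_Z (-1)) Ag; under eq_fun do rewrite -mulN1r; exact: A_D. Qed.

Let A_abs f : A f -> A (fun x => `|f x|).
Proof.
move=> Af; have [C fC] := A_bounded Af.
pose K := `|C| + 1; have K0 : 0 < K by rewrite /K ltr_wpDl.
have fK x : `|f x / K| <= 1.
  rewrite normrM normfV (gtr0_norm K0) ler_pdivrMr// mul1r.
  by apply: le_trans (fC x) _; rewrite /K ler_wpDr// ler_norm.
have Ait n : A (fun x => abs_iter (f x / K) n).
  have Af' : A (fun x => f x / K) by under eq_fun do rewrite mulrC; exact: A_Z.
  elim: n => [|n ih] /=; first exact: A_cst.
  apply: A_D => //; under eq_fun do rewrite mulrC !expr2.
  by apply: A_Z; apply: A_B; exact: A_M.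
apply: A_lim => e e0; pose n := Num.bound (2 * K / e).
exists (fun x => K * abs_iter (f x / K) n.+1); first exact: A_Z.
move=> x; have -> : `|f x| = K * `|f x / K|.
  by rewrite normrM normfV (gtr0_norm K0) mulrCA mulfV ?mulr1// gt_eqF.
rewrite -mulrBr normrM (gtr0_norm K0).
apply: (@le_trans _ _ (K * (2 / n.+1%:R))).
  by apply: ler_wpM2l; [exact: ltW|exact: abs_iter_cvg].
have Ke0 : 0 <= 2 * K / e by rewrite divr_ge0 ?mulr_ge0// ltW.
have h : 2 * K <= n.+1%:R * e.
  rewrite -ler_pdivrMr//; apply: ltW; apply: lt_le_trans (archi_boundP Ke0) _.
  by rewrite ler_nat.
rewrite mulrA ler_pdivrMr//; lra.
Qed.

Let A_min f g : A f -> A g -> A (fun x => Num.min (f x) (g x)).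
Proof.
move=> Af Ag.
have -> : (fun x => Num.min (f x) (g x)) = (fun x => 2^-1 * (f x + g x - `|f x - g x|)).
  apply/funext => x; have [fg|fg] := leP (f x) (g x).
    by rewrite ler0_norm ?subr_le0//; field.
  by rewrite gtr0_norm ?subr_gt0//; field.
by apply: A_Z; apply: A_B; [exact: A_D|apply: A_abs; exact: A_B].
Qed.

Let A_pos f : A f -> A (fun x => Num.max 0 (f x)).
Proof.
move=> Af; have -> : (fun x => Num.max 0 (f x)) = (fun x => 2^-1 * (f x + `|f x|)).
  apply/funext => x; have [fg|fg] := leP 0 (f x).
    by rewrite ger0_norm//; field.
  by rewrite ltr0_norm//; field.
by apply: A_Z; apply: A_D => //; exact: A_abs.
Qed.

Let A_sum (I : Type) (r : seq I) (f : I -> N -> R) :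
  (forall i, A (f i)) -> A (fun x => \sum_(i <- r) f i x).
Proof.
move=> Af; elim: r => [|i r ih]; first by under eq_fun do rewrite big_nil; exact: A_cst.
by under eq_fun do rewrite big_cons; exact: A_D.
Qed.

(** A lattice polynomial in the coordinates that vanishes on the ball of radius d around y and is at
    least 1 outside the ball of radius 2 d. *)
Let moat (y : N) (d : R) (x : N) : R :=
  \sum_(k < m) Num.max 0 (d^-1 * `|set_val x ord0 k - set_val y ord0 k| - 1).

Let A_moat y d : A (moat y d).
Proof.
apply: A_sum => k; apply: A_pos; apply: A_B; last exact: A_cst.
by apply: A_Z; apply: A_abs; apply: A_B; [exact: A_coord|exact: A_cst].
Qed.

Let moat_ge0 y d x : 0 <= moat y d x.
Proof. by apply: sumr_ge0 => k _; rewrite le_max lexx. Qed.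

Let moat_near y d x : 0 < d -> ball (set_val y) d (set_val x) -> moat y d x = 0.
Proof.
move=> d0 b; apply: big1 => k _; apply/max_idPl.
have := b.2 ord0 k; rewrite /ball/= distrC => /ltW.
by rewrite subr_le0 ler_pdivrMl// mulr1.
Qed.

Let moat_far y d x : 0 < d -> ~ ball (set_val y) (2 * d) (set_val x) -> 1 <= moat y d x.
Proof.
move=> d0 nb.
have [k hk] : exists k, 2 * d <= `|set_val x ord0 k - set_val y ord0 k|.
  apply: contrapT => h; apply: nb; split=> [|i k]; first by rewrite mulr_gt0.
   rewrite (ord1 i) /ball/=.
  rewrite ltNge; apply/negP => hk; apply: h; exists k; by rewrite distrC.
rewrite /moat (bigD1 k)//= ler_wpDr//.
  by apply: sumr_ge0 => j _; rewrite le_max lexx.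
rewrite le_max; apply/orP; right.
by rewrite lerBrDr ler_pdivlMl// mulrC.
Qed.

Let A_inf (C : R) (I : Type) (r : seq I) (h : I -> N -> R) : (forall i, A (h i)) ->
  A (fun x => foldr (fun i t => Num.min (h i x) t) C r).
Proof. by move=> Ah; elim: r => [|i r ih] /=; [exact: A_cst|exact: A_min]. Qed.

(* f is within e of the minimum of the functions f y + 2 B moat y, where y ranges
   over the centers of a finite cover by balls on which f oscillates by at most e
   and B bounds f. *)
Theorem stone_weierstrass (f : N -> R) : continuous f -> A f.
Proof.
move=> cf; apply: A_lim => e e0.
have dex (y : N) : exists2 d, 0 < d &
    forall x : N, ball (set_val y) (2 * d) (set_val x) -> `|f y - f x| <= e.
  have /cvgr_dist_le/(_ _ e0)/nbhs_ballP[d /= d0 hd] := cf y.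
  exists (d / 2); first by rewrite divr_gt0.
  move=> x; rewrite mulrC divfK// => b; exact: hd.
pose dd y := projT1 (cid2 (dex y)).
have dd0 y : 0 < dd y by rewrite /dd; case: cid2.
have ddP y x : ball (set_val y) (2 * dd y) (set_val x) -> `|f y - f x| <= e.
  by rewrite /dd; case: cid2 => d /= _; exact.
have [D _ Dcov] : finite_subset_cover setT (fun y : N => ball (set_val y) (dd y)) N.
  move: cN; rewrite compact_cover; apply.
  - by move=> y _; exact: ball_open.
  - by move=> x Nx; exists (SigSub (mem_set Nx)) => //=; exact: ballxx.
(* Every x is in the ball of a center y with |f x| <= |f y| + e, and |f y| is one term of the sum;
   hence B bounds |f| everywhere. *)
pose B := \sum_(y <- finmap.enum_fset D) `|f y| + e.
have near_center (x : N) : exists2 y, y \in finmap.enum_fset D & ball (set_val y) (dd y) (set_val x).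
  by have [y yD b] := Dcov _ (set_valP x); exists y.
have widen (y x : N) : ball (set_val y) (dd y) (set_val x) ->
    ball (set_val y) (2 * dd y) (set_val x).
  by apply: le_ball; have := dd0 y; lra.
have fB x : `|f x| <= B.
  have [y yD b] := near_center x.
  have h : `|f y| <= \sum_(y <- finmap.enum_fset D) `|f y|.
    by rewrite (big_rem y yD)/= ler_wpDr// sumr_ge0.
  have := ddP _ _ (widen _ _ b); have := ler_distD 0 (f x) (f y); rewrite /B.
  rewrite -(distrC (f x) (f y)) => _ hd.
  have := ler_normD (f x - f y) (f y); rewrite subrK.
  by move: hd; lra.
pose h y x := f y + 2 * B * moat y (dd y) x.
(* The minimum starts from B, which is above f and so respects the lower estimate; the upper one
   comes from a center close to x. *)
exists (fun x => foldr (fun y t => Num.min (h y x) t) B (finmap.enum_fset D)).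
  apply: A_inf => y; apply: A_D; first exact: A_cst.
  exact: A_Z.
move=> x.
have lower y : f x - e <= h y x.
  have [b|nb] := pselect (ball (set_val y) (2 * dd y) (set_val x)).
    have t0 : 0 <= 2 * B * moat y (dd y) x.
      by rewrite mulr_ge0 ?moat_ge0// mulr_ge0// (le_trans (normr_ge0 (f y))).
    have := ddP _ _ b; rewrite /h ler_norml; lra.
  (* Outside the larger ball h y x is at least f y + 2 B, hence at least B, which is above f x. *)
  have := moat_far (dd0 y) nb; have := fB y; have := fB x; rewrite /h !ler_norml.
  move: (moat _ _ _) => t; nra.
have [y yD b] := near_center x.
have upper : h y x <= f x + e.
  rewrite /h (moat_near (dd0 y) b) mulr0 addr0.
  by have := ddP _ _ (widen _ _ b); rewrite ler_norml; lra.
have foldl_ge r : f x - e <= foldr (fun y t => Num.min (h y x) t) B r.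
  elim: r => [|z r ih] /=; last by rewrite le_min lower.
  have := fB x; rewrite ler_norml; lra.
have foldl_le r : y \in r -> foldr (fun y t => Num.min (h y x) t) B r <= f x + e.
  elim: r => //= z r ih; rewrite inE => /orP[/eqP <-|/ih h1]; rewrite ge_min.
    by rewrite upper.
  by rewrite h1 orbT.
rewrite distrC ler_norml; have := foldl_ge (finmap.enum_fset D); have := foldl_le _ yD; lra.
Qed.

End stone_weierstrass.

(** * Continuous complex functions and the supremum norm *)

Section continuous_functions.
Context (R : realType) (X : topologicalType).
Implicit Types g h : X -> R[i].

Lemma cont_funP g : @cont_fun R X g <->
  forall x (e : R), 0 < e -> \forall y \near x, normc (g x - g y) <= e.
Proof.
have nE (z : (R[i])^o) : `|z| = (normc z)%:C by case: z => a b; rewrite normc_def.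
split=> [cg x e e0|h x].
  have ec0 : 0 < e%:C :> R[i] by rewrite ltcR.
  have /cvgrPdist_le/(_ _ ec0) := cg x; apply: filterS => y.
  by rewrite nE lecR.
apply/cvgrPdist_le => e e0.
(* The order of [R[i]] compares only numbers with equal imaginary parts, so a positive radius is
   real. *)
have eR : e = (Re e)%:C.
  by apply: complexP => //=; move: e0; rewrite ltcE /= => /andP[/eqP].
have : 0 < Re e by move: e0; rewrite {1}eR ltcR.
by move=> /(h x); apply: filterS => y; rewrite nE eR lecR.
Qed.

Lemma cont_fun_lin (c : R[i]) g h : cont_fun g -> cont_fun h ->
  @cont_fun R X (fun x => c * g x + h x).
Proof.
move=> /cont_funP cg /cont_funP ch; apply/cont_funP => x e e0.
have K0 : 0 < normc c + 1 by have := normc_ge0 c; lra.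
have e1 : 0 < e / 2 / (normc c + 1) by rewrite !divr_gt0.
have e2 : 0 < e / 2 by rewrite divr_gt0.
apply: filterS2 (cg x _ e1) (ch x _ e2) => y h1 h2.
have -> : c * g x + h x - (c * g y + h y) = c * (g x - g y) + (h x - h y) by ring.
apply: le_trans (normcD _ _) _; rewrite normcM.
have : normc c * normc (g x - g y) <= (normc c + 1) * (e / 2 / (normc c + 1)).
  by apply: ler_pM; rewrite ?normc_ge0 ?lerDl.
rewrite mulrCA mulfV ?gt_eqF// mulr1; move: h2.
by move: (normc (h x - h y)) (normc c * _) => a b; lra.
Qed.

Lemma cont_fun_cst (c : R[i]) : @cont_fun R X (fun=> c).
Proof. by apply/cont_funP => x e e0; apply: nearW => y; rewrite subrr normc0 ltW. Qed.

Lemma cont_funJ g : cont_fun g -> @cont_fun R X (fun x => (g x)^*).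
Proof.
move=> /cont_funP cg; apply/cont_funP => x e e0.
by apply: filterS (cg x e e0) => y; rewrite -[in X in _ -> X]normcJ conjcD conjcN !conjCK.
Qed.

Lemma cont_fun_unif g : (forall e : R, 0 < e ->
  exists2 h, cont_fun h & forall x, normc (g x - h x) <= e) -> @cont_fun R X g.
Proof.
move=> gl; apply/cont_funP => x e e0.
have e3 : 0 < e / 3 by rewrite divr_gt0.
have [h /cont_funP ch gh] := gl _ e3.
apply: filterS (ch x _ e3) => y hxy.
have -> : g x - g y = (g x - h x) + (h x - h y) + (h y - g y) by ring.
have h1 := normcD (g x - h x + (h x - h y)) (h y - g y).
have h2 := normcD (g x - h x) (h x - h y).
have h3 : normc (h y - g y) <= e / 3 by rewrite -normcN opprB.
by have := gh x; lra.
Qed.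

Lemma cont_funM g h (C D : R) : cont_fun g -> cont_fun h ->
  (forall x, normc (g x) <= C) -> (forall x, normc (h x) <= D) ->
  @cont_fun R X (fun x => g x * h x).
Proof.
move=> /cont_funP cg /cont_funP ch gC hD; apply/cont_funP => x e e0.
have C0 : 0 <= C := le_trans (normc_ge0 _) (gC x).
have D0 : 0 <= D := le_trans (normc_ge0 _) (hD x).
have K0 : 0 < C + D + 1 by lra.
have e1 : 0 < e / (C + D + 1) by rewrite divr_gt0.
apply: filterS2 (cg x _ e1) (ch x _ e1) => y h1 h2.
have -> : g x * h x - g y * h y = g x * (h x - h y) + (g x - g y) * h y by ring.
apply: le_trans (normcD _ _) _; rewrite !normcM.
apply: (@le_trans _ _ (C * (e / (C + D + 1)) + e / (C + D + 1) * D)).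
  by apply: lerD; apply: ler_pM; rewrite ?normc_ge0.
rewrite mulrC -mulrDr mulrAC ler_pdivrMr//; nra.
Qed.

Lemma cont_fun_real (f : X -> R) : continuous f <-> @cont_fun R X (fun x => (f x)%:C).
Proof.
split=> [cf|/cont_funP cf x].
  apply/cont_funP => x e e0.
  have /cvgrPdist_le/(_ _ e0) := cf x; apply: filterS => y.
  by rewrite -rmorphB normc_real.
apply/cvgrPdist_le => e e0; apply: filterS (cf x e e0) => y.
by rewrite -rmorphB normc_real.
Qed.

Lemma cont_fun_Re g : cont_fun g -> continuous (fun x => Re (g x)).
Proof.
move=> /cont_funP cg x; apply/cvgrPdist_le => e e0.
apply: filterS (cg x e e0) => y; apply: le_trans.
by rewrite -Re_oppc -Re_addc normr_Re_le.
Qed.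

Lemma cont_fun_Im g : cont_fun g -> continuous (fun x => Im (g x)).
Proof.
move=> /cont_funP cg x; apply/cvgrPdist_le => e e0.
apply: filterS (cg x e e0) => y; apply: le_trans.
by rewrite -Im_oppc -Im_addc normr_Im_le.
Qed.

Lemma cont_fun_normc g : cont_fun g -> continuous (fun x => normc (g x)).
Proof.
move=> /cont_funP cg x; apply/cvgrPdist_le => e e0.
apply: filterS (cg x e e0) => y; apply: le_trans; exact: dist_normc.
Qed.

Lemma supnorm_ub g (C : R) x : (forall x, normc (g x) <= C) -> normc (g x) <= supnorm g.
Proof.
move=> gC; apply: ub_le_sup; last by exists x.
by exists C => _ [y _ <-].
Qed.

End continuous_functions.

(** * The algebra of multiplication operators *)

Section multiplication_algebra.
Context (R : realType) d (T : measurableType d) (zeta : {measure set T -> \bar R}).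
Local Notation leb := (@lebesgue_measure R).
Local Notation mR := (measurableTypeR R).
Variable U : L2 leb -> L2 zeta.
Hypothesis U_linear : forall c F G, U (c *: F + G) = c *: U F + U G.
Hypothesis U_norm : forall F, normL2 (U F) = normL2 F.
Variable K : set (L2 zeta).
Hypothesis K_range : forall F, K F <-> exists f, U f = F.
Variables (Om : set R) (m : nat) (gam : 'I_m -> R -> R).
Hypothesis Om_near : forall xi, Om xi -> \forall x \near xi, Om x.
Hypothesis Om_nonempty : Om !=set0.
Hypothesis gam_continuous : forall k xi, Om xi -> gam k x @[x --> xi] --> gam k xi.
Hypothesis gam_ge0 : forall k xi, 0 <= gam k xi.
Hypothesis gam_sum : forall xi, Om xi -> \sum_(k < m) gam k xi = 1.

Definition spectrum : set 'rV[R]_m := closure [set \row_k gam k xi | xi in Om].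
Local Notation N := spectrum.
Implicit Types (g h : N -> R[i]) (f : L2 leb) (F G H : K).

Lemma gam_in_spectrum xi : Om xi -> \row_k gam k xi \in N.
Proof. by move=> Oxi; apply/mem_set/subset_closure; exists xi. Qed.

Definition spectral_point xi (Oxi : Om xi) : N := SigSub (gam_in_spectrum Oxi).

Lemma gam_le1 k xi : Om xi -> gam k xi <= 1.
Proof.
by move=> Oxi; rewrite -(gam_sum Oxi) (bigD1 k)//= ler_wpDr// sumr_ge0.
Qed.

Lemma spectrum_dense (P : set N) : closed P ->
  (forall xi (Oxi : Om xi), P (spectral_point Oxi)) -> forall x, P x.
Proof.
move=> cP PO x; apply: contrapT => nPx.
have : nbhs x (~` P) by apply: open_nbhs_nbhs; split => //; exact: closed_openC.
move=> /nbhs_ballP[e /= e0 he].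
have /= := set_valP x; rewrite /N /closure /= => /(_ (ball (set_val x) e)).
case=> [|_ [[xi Oxi <-] b]]; first exact: nbhsx_ballx.
exact: (he (spectral_point Oxi) b).
Qed.

Lemma coord_cont k : @cont_fun R N (fun z => (set_val z ord0 k)%:C).
Proof.
apply/cont_funP => x e e0; apply/nbhs_ballP; exists e => // y b.
rewrite -rmorphB normc_real; apply: ltW; exact: (b.2 ord0 k).
Qed.

Lemma coord_bounds k (z : N) : 0 <= set_val z ord0 k <= 1.
Proof.
pose P := (fun z : N => set_val z ord0 k) @^-1` `[0, 1]%classic.
have cP : closed P.
  apply: preimage_closed; last exact: itv_closed.
  by move=> x _; have /cont_fun_real h := @coord_cont k; exact: h.
suff : P z by rewrite /P /= in_itv.
apply: spectrum_dense => // xi Oxi.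
by rewrite /P /= in_itv/= set_valE /= mxE gam_ge0 gam_le1.
Qed.

Lemma compact_spectrum : compact N.
Proof.
have c01 (k : 'I_m) : compact (`[0, 1]%classic : set R) by exact: segment_compact.
apply: subclosed_compact (rV_compact c01) _; first exact: closed_closure.
by move=> v Nv k; have := coord_bounds k (SigSub (mem_set Nv)); rewrite /= in_itv.
Qed.

(** The Stone-Weierstrass theorem is applied to the class of all bounded functions, which satisfies
    its closure conditions and therefore contains every continuous function. *)
Lemma cont_fun_bounded g : cont_fun g -> exists C, forall x, normc (g x) <= C.
Proof.
move=> cg.
suff [C hC] : [set f : N -> R | exists C, forall x, `|f x| <= C] (fun x => normc (g x)).
  by exists C => x; have := hC x; rewrite ger0_norm ?normc_ge0.
apply: (stone_weierstrass compact_spectrum) (cont_fun_normc cg).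
- by move=> c; exists `|c|.
- move=> f1 f2 [C1 h1] [C2 h2]; exists (C1 + C2) => x.
  exact: le_trans (ler_normD _ _) (lerD (h1 x) (h2 x)).
- move=> f1 f2 [C1 h1] [C2 h2]; exists (C1 * C2) => x.
  by rewrite normrM; apply: ler_pM.
- by move=> k; exists 1 => x; have /andP[? ?] := coord_bounds k x; rewrite ger0_norm.
- by [].
- move=> f1 /(_ 1 ltr01)[f2 [C h2] h]; exists (1 + C) => x.
  by rewrite -(subrK (f2 x) (f1 x)); exact: le_trans (ler_normD _ _) (lerD (h x) (h2 x)).
Qed.

(* Om is conull in the application, so the value off Om is irrelevant. *)
Definition pullback g (xi : R) : R[i] :=
  if pselect (Om xi) is left Oxi then g (spectral_point Oxi) else 0.

Lemma pullbackE g xi (Oxi : Om xi) : pullback g xi = g (spectral_point Oxi).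
Proof.
rewrite /pullback; case: pselect => // Oxi'; congr g; exact: val_inj.
Qed.

Lemma pullback_off g xi : ~ Om xi -> pullback g xi = 0.
Proof. by rewrite /pullback; case: pselect. Qed.

Lemma pullback_le g (C : R) xi : (forall x, normc (g x) <= C) -> normc (pullback g xi) <= C.
Proof.
move=> gC; rewrite /pullback; case: pselect => [Oxi|_]; first exact: gC.
have [x Ox] := Om_nonempty.
by rewrite normc0; exact: le_trans (normc_ge0 _) (gC (spectral_point Ox)).
Qed.

Lemma pullback_near g xi (e : R) : cont_fun g -> Om xi -> 0 < e ->
  \forall x \near xi, normc (pullback g xi - pullback g x) <= e.
Proof.
move=> /cont_funP cg Oxi e0.
have /nbhs_ballP[r /= r0 hr] := cg (spectral_point Oxi) e e0.
have hk : \forall x \near xi, forall k, `|gam k xi - gam k x| < r.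
  apply: (@filter_forall _ _ (fun k x => `|gam k xi - gam k x| < r) (nbhs xi)) => k.
  by have /cvgrPdist_lt/(_ _ r0) := @gam_continuous k _ Oxi.
apply: filterS2 (Om_near Oxi) hk => x Ox hx.
rewrite (pullbackE g Oxi) (pullbackE g Ox); apply: hr; split => // i k.
by rewrite !set_valE/= !mxE; exact: hx.
Qed.

Lemma measurable_Om : measurable (Om : set mR).
Proof.
apply: open_measurable; rewrite openE => xi Oxi; exact: Om_near.
Qed.

(** The pullback is continuous on the open set [Om] and 0 elsewhere, hence Borel. *)
Lemma bounded_pullback g : cont_fun g -> bounded_cfun (pullback g : mR -> R[i]).
Proof.
move=> cg; split; last first.
  by have [C gC] := cont_fun_bounded cg; exists C => xi; exact: pullback_le.
have oOm : open Om by rewrite openE => xi Oxi; exact: Om_near.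
have key (p : R -> R) : (forall xi, Om xi -> {for xi, continuous p}) ->
    (forall xi, ~ Om xi -> p xi = 0) -> measurable_fun [set: mR] p.
  move=> cp p0.
  have m1 : measurable_fun (Om : set mR) p.
    by apply: open_continuous_measurable_fun => // xi /set_mem; exact: cp.
  have -> : p = p \_ Om.
    by apply/funext => xi; rewrite patchE; case: ifPn => // /negP nO; apply: p0 => /mem_set.
  by apply/(measurable_restrictT _ _).1 => //; exact: measurable_Om.
split; apply: key => xi Oxi.
- apply/cvgrPdist_le => e e0; apply: filterS (pullback_near cg Oxi e0) => x.
  by apply: le_trans; rewrite -Re_oppc -Re_addc normr_Re_le.
- by rewrite pullback_off.
- apply/cvgrPdist_le => e e0; apply: filterS (pullback_near cg Oxi e0) => x.
  by apply: le_trans; rewrite -Im_oppc -Im_addc normr_Im_le.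
- by rewrite pullback_off.
Qed.

(** If |g| exceeded c at some frequency it would do so, by continuity, with a margin on an interval,
    and the indicator of that interval would violate the bound. Density of the frequencies then
    covers all of the spectrum. *)
Lemma pullback_lower_bound g (c : R) : cont_fun g ->
  (forall f, normL2 (mulL2 leb (pullback g) f) <= c * normL2 f) ->
  forall x, normc (g x) <= c.
Proof.
move=> cg h.
pose P := (fun x => normc (g x)) @^-1` [set y | y <= c].
have cP : closed P.
  by apply: preimage_closed; [move=> x _; exact: cont_fun_normc|exact: closed_le].
apply: (spectrum_dense cP) => xi Oxi; rewrite /P /= leNgt; apply/negP => gc.
(* Half of the gap: where the function moves by at most e its modulus stays above c + e. *)
pose e := (normc (g (spectral_point Oxi)) - c) / 2.
have e0 : 0 < e by rewrite divr_gt0// subr_gt0.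
have /nbhs_ballP[r /= r0 hr] := pullback_near cg Oxi e0.
pose I : set mR := `]xi - r, xi + r[%classic.
have lI : leb I = (2 * r)%:E.
  rewrite /I lebesgue_measure_itv/= lte_fin ltrD2l gtrN// -EFinB.
  by congr EFin; ring.
have mI : measurable I by exact: measurable_itv.
have Ioo : (leb I < +oo)%E by rewrite lI ltry.
have iL : cL2 leb (fun x => (\1_I x)%:C) by apply: cL2_indic => //; exact: Ioo.
pose f := classL2 leb (fun x => (\1_I x)%:C).
have bg := bounded_pullback cg.
have i2 x : normc ((\1_I x)%:C : R[i]) ^+ 2 = \1_I x.
  by rewrite normc_real indicE; case: (x \in I); rewrite ?normr1 ?normr0 ?expr1n ?expr0n.
have nf : normL2 f ^+ 2 = 2 * r.
  apply: EFin_inj; rewrite (sqr_norm_classL2 iL) -lI.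
  transitivity (\int[leb]_x (\1_I x)%:E)%E; last by rewrite integral_indic ?setIT.
  by apply: eq_integral => x _; rewrite i2.
have nf0 : 0 < normL2 f.
  rewrite lt0r normL2_ge0 andbT; apply/eqP => n0.
  by move: nf; rewrite n0 expr0n /=; lra.
have lower : (c + e) ^+ 2 * normL2 f ^+ 2 <= normL2 (mulL2 leb (pullback g) f) ^+ 2.
  rewrite -lee_fin EFinM (mulL2_class bg iL) (sqr_norm_classL2 iL).
  rewrite (sqr_norm_classL2 (bounded_cfun_cL2 bg iL)) -ge0_integralZl//; last 3 first.
  - by apply/measurable_EFinP/measurable_sqr_normc; case: iL.
  - by move=> x _; rewrite lee_fin sqr_ge0.
  - by rewrite lee_fin sqr_ge0.
  apply: ge0_le_integral => //.
  - by move=> x _; rewrite mule_ge0// lee_fin sqr_ge0.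
  - apply: emeasurable_funM => //.
    by apply/measurable_EFinP/measurable_sqr_normc; case: iL.
  - by apply/measurable_EFinP/measurable_sqr_normc; case: (bounded_cfun_cL2 bg iL).
  - move=> x _; rewrite -EFinM lee_fin normcM exprMn i2 indicE.
    case: (boolP (x \in I)) => [/set_mem xI|_]; last by rewrite !mulr0.
    rewrite !mulr1.
    have /hr : ball xi r x by move: xI; rewrite /I /= in_itv/= /ball/= ltr_distlC.
    have := dist_normc (pullback g xi) (pullback g x); rewrite ler_norml => /andP[_ d1] d2.
    have c0 : 0 <= c by rewrite -(pmulr_lge0 _ nf0); apply: le_trans (h f); exact: normL2_ge0.
    rewrite ler_sqr ?nnegrE ?normc_ge0//; last by rewrite addr_ge0// ltW.
    have := pullbackE g Oxi; rewrite /e in d2 * => pe; rewrite pe in d1 d2; lra.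
have := h f; have := normL2_ge0 (mulL2 leb (pullback g) f).
move: lower nf0; rewrite -exprMn; move: (normL2 (mulL2 _ _ _)) (normL2 f) => a b.
move=> h1 b0 a0 h2.
have cb0 : 0 <= c * b := le_trans a0 h2.
have eb : 0 < e * b by rewrite mulr_gt0.
by move: h1; rewrite mulrDl; nra.
Qed.

Lemma U_B f1 f2 : U (f1 - f2) = U f1 - U f2.
Proof. by rewrite -scaleN1r addrC U_linear scaleN1r addrC. Qed.

Lemma U_inj f1 f2 : U f1 = U f2 -> f1 = f2.
Proof.
by move=> e; apply: normL2_sub_eq0; rewrite -U_norm U_B e subrr normL2_0.
Qed.

(** A chosen inverse image, unique because U is injective; together with [embed] it identifies K
    with L2 of the line. *)
Definition preimage F : L2 leb := projT1 (cid ((K_range (set_val F)).1 (set_valP F))).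

Lemma preimageE F : U (preimage F) = set_val F.
Proof. by rewrite /preimage; case: cid. Qed.

Definition embed f : K := SigSub (mem_set ((K_range (U f)).2 (ex_intro _ f erefl))).

Lemma embedE f : set_val (embed f) = U f. Proof. by []. Qed.

Lemma preimage_unique F f : set_val F = U f -> preimage F = f.
Proof. by move=> e; apply: U_inj; rewrite preimageE. Qed.

Lemma norm_preimage F : normL2 (preimage F) = normL2 (set_val F).
Proof. by rewrite -U_norm preimageE. Qed.

Lemma op_ext (A B : K -> K) : (forall F, set_val (A F) = set_val (B F)) -> A = B.
Proof. by move=> e; apply/funext => F; apply: val_inj; exact: e. Qed.

Definition mulop g F : K := embed (mulL2 leb (pullback g) (preimage F)).

Lemma pullback_lin (c : R[i]) g h :
  pullback (fun x => c * g x + h x) = (fun xi => c * pullback g xi + pullback h xi).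
Proof.
by apply/funext => xi; rewrite /pullback; case: pselect => // _; rewrite mulr0 addr0.
Qed.

Lemma cont_fun_mul g h : cont_fun g -> cont_fun h -> @cont_fun R N (fun x => g x * h x).
Proof.
move=> cg ch; have [C gC] := cont_fun_bounded cg; have [D hD] := cont_fun_bounded ch.
exact: cont_funM cg ch gC hD.
Qed.

Lemma mulop_lin (c : R[i]) g h : cont_fun g -> cont_fun h ->
  lincomb_op c (mulop g) (mulop h) (mulop (fun x => c * g x + h x)).
Proof.
move=> cg ch F; rewrite !embedE pullback_lin mulL2_linearl ?U_linear//;
  exact: bounded_pullback.
Qed.

Lemma mulop_comp g h : cont_fun g -> cont_fun h ->
  mulop g \o mulop h = mulop (fun x => g x * h x).
Proof.
move=> cg ch; apply: op_ext => F /=; rewrite !embedE; congr U.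
rewrite (preimage_unique (embedE _)) mulL2M; [|exact: bounded_pullback..].
congr mulL2; apply/funext => xi; rewrite /pullback; case: pselect => // _.
by rewrite mul0r.
Qed.

Lemma pullbackJ g : pullback (fun x => (g x)^*) = (fun xi => (pullback g xi)^*).
Proof. by apply/funext => xi; rewrite /pullback; case: pselect => // _; rewrite conjC0. Qed.

Lemma mulop_adjoint g : cont_fun g -> adjoint_op (mulop g) (mulop (fun x => (g x)^*)).
Proof.
move=> cg F G; rewrite !embedE -(preimageE F) -(preimageE G).
rewrite !(isometry_dot U_linear U_norm) pullbackJ.
by apply: mulL2_adjoint; exact: bounded_pullback.
Qed.

Lemma adjoint_unique (A B C : K -> K) : adjoint_op A B -> adjoint_op A C -> B = C.
Proof.
move=> AB AC; apply: op_ext => G; rewrite -!preimageE; congr U; apply: dot_sqr_inj => h.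
rewrite dotC [RHS]dotC -!(isometry_dot U_linear U_norm) !preimageE -(embedE h).
by rewrite -AB -AC.
Qed.

Lemma spectrum_bound_ge0 g (C : R) : (forall x, normc (g x) <= C) -> 0 <= C.
Proof.
by have [x Ox] := Om_nonempty; move=> /(_ (spectral_point Ox)); apply: le_trans; exact: normc_ge0.
Qed.

Lemma norm_mulop_le g (C : R) F : cont_fun g -> (forall x, normc (g x) <= C) ->
  normL2 (set_val (mulop g F)) <= C * normL2 (set_val F).
Proof.
move=> cg gC; rewrite embedE U_norm -norm_preimage.
apply: norm_mulL2_le; first by case: (bounded_pullback cg).
- exact: spectrum_bound_ge0 gC.
- by move=> x; exact: pullback_le.
Qed.

Lemma mulop_lower_bound g (c : R) : cont_fun g ->
  (forall F, normL2 (set_val (mulop g F)) <= c * normL2 (set_val F)) ->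
  forall x, normc (g x) <= c.
Proof.
move=> cg h; apply: pullback_lower_bound => // f.
by have := h (embed f); rewrite !embedE !U_norm (preimage_unique (embedE f)).
Qed.

Lemma mulopB g h F : cont_fun g -> cont_fun h ->
  set_val (mulop g F) - set_val (mulop h F) = set_val (mulop (fun x => -1 * h x + g x) F).
Proof. by move=> cg ch; rewrite (mulop_lin (-1) ch cg F) scaleN1r addrC. Qed.

Lemma mulop_dist g h (c : R) : cont_fun g -> cont_fun h ->
  (forall F, normL2 (set_val (mulop g F) - set_val (mulop h F)) <= c * normL2 (set_val F)) ->
  forall x, normc (g x - h x) <= c.
Proof.
move=> cg ch e x; have -> : g x - h x = -1 * h x + g x by rewrite mulN1r addrC.
have := @mulop_lower_bound _ c (cont_fun_lin (c := -1) ch cg) _ x; apply => F.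
by rewrite -(mulopB F cg ch).
Qed.

Lemma mulop_inj g h : cont_fun g -> cont_fun h -> mulop g = mulop h -> g = h.
Proof.
move=> cg ch e; apply/funext => x; apply/eqP; rewrite -subr_eq0; apply/eqP/normc_eq0.
apply/eqP; rewrite eq_le normc_ge0 andbT.
by apply: (mulop_dist cg ch) => F; rewrite e subrr normL2_0 mul0r.
Qed.

Lemma mulop_linear g : cont_fun g -> linear_op (mulop g).
Proof.
move=> cg c F G H HFG; rewrite !embedE -U_linear -mulL2_linear; last exact: bounded_pullback.
by congr (U (mulL2 _ _ _)); apply: preimage_unique; rewrite HFG U_linear !preimageE.
Qed.

Lemma mulop_bounded_linear g : cont_fun g -> bounded_linear_ops (mulop g).
Proof.
move=> cg; split; first exact: mulop_linear.
by have [C gC] := cont_fun_bounded cg; exists C => F; exact: norm_mulop_le.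
Qed.

Lemma supnormP g x : cont_fun g -> normc (g x) <= supnorm g.
Proof. by move=> cg; have [C gC] := cont_fun_bounded cg; exact: supnorm_ub gC. Qed.

Lemma norm_mulop_sup g F : cont_fun g ->
  normL2 (set_val (mulop g F)) <= supnorm g * normL2 (set_val F).
Proof. by move=> cg; apply: norm_mulop_le => // x; exact: supnormP. Qed.

Lemma supnorm_le g (C : R) : (forall x, normc (g x) <= C) -> supnorm g <= C.
Proof.
move=> gC; have [xi Ox] := Om_nonempty.
by apply: ge_sup; [exists (normc (g (spectral_point Ox))), (spectral_point Ox)|
  move=> _ [x _ <-]].
Qed.

(** [mulop_lower_bound] wants an estimate for every vector whereas [opnorm] sees only the unit ball;
    normalizing a nonzero vector bridges the two. *)
Lemma opnorm_mulop g : cont_fun g -> opnorm (mulop g) = supnorm g.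
Proof.
move=> cg; have s0 : 0 <= supnorm g by apply: spectrum_bound_ge0 => x; exact: supnormP.
pose B := [set normL2 (set_val (mulop g F)) | F in [set F : K | normL2 (set_val F) <= 1]].
have B_le F : normL2 (set_val F) <= 1 -> normL2 (set_val (mulop g F)) <= supnorm g.
  move=> F1; apply: le_trans (norm_mulop_sup _ cg) _.
  by rewrite ler_piMr.
have B0 : B !=set0.
  by exists (normL2 (set_val (mulop g (embed 0)))), (embed 0) => //=; rewrite embedE U_norm normL2_0.
have Bub : has_ubound B by exists (supnorm g) => _ [F F1 <-]; exact: B_le.
apply/eqP; rewrite eq_le; apply/andP; split.
  by apply: ge_sup => // _ [F F1 <-]; exact: B_le.
apply: supnorm_le; apply: (mulop_lower_bound cg) => F.
have [F0|F0] := eqVneq (normL2 (set_val F)) 0.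
  apply: le_trans (norm_mulop_sup F cg) _.
  by rewrite F0 !mulr0.
have Fpos : 0 < normL2 (set_val F) by rewrite lt0r F0 normL2_ge0.
pose c : R[i] := ((normL2 (set_val F))^-1)%:C.
pose G := embed (c *: preimage F).
(* [linear_op] speaks of c F + G, so a pure scaling is written with a zero second summand. *)
have GF : set_val G = c *: set_val F + set_val (embed 0).
  by rewrite -(preimageE F) !embedE -U_linear addr0.
have U0 : set_val (embed 0) = 0.
  by apply: normL2_eq0; rewrite embedE U_norm normL2_0.
have MG : normL2 (set_val (mulop g G)) = (normL2 (set_val F))^-1 * normL2 (set_val (mulop g F)).
  rewrite (mulop_linear cg GF).
  have -> : set_val (mulop g (embed 0)) = 0.
    apply: normL2_eq0; apply/eqP; rewrite eq_le normL2_ge0 andbT.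
    by apply: le_trans (norm_mulop_sup _ cg) _; rewrite U0 normL2_0 mulr0.
  by rewrite addr0 normL2Z normc_real ger0_norm// invr_ge0 normL2_ge0.
have G1 : normL2 (set_val G) <= 1.
  by rewrite GF U0 addr0 normL2Z normc_real ger0_norm ?invr_ge0 ?normL2_ge0// mulVf.
have : normL2 (set_val (mulop g G)) <= opnorm (mulop g) by apply: ub_le_sup => //; exists G.
by rewrite MG ler_pdivrMl// mulrC.
Qed.

Definition mulops : set (K -> K) := [set mulop g | g in @cont_fun R N].

Lemma mulops_mulop g : cont_fun g -> mulops (mulop g).
Proof. by exists g. Qed.

Lemma le_half_pow0 (x C : R) : (forall k, x <= C / 2 ^+ k) -> x <= 0.
Proof.
move=> h; rewrite leNgt; apply/negP => x0.
have /cvgr0Pnorm_lt/(_ _ x0)[n _ hn] := cvg_half_pow C.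
have := hn n (leqnn n); rewrite /= ltNge; apply/negP/negPn.
by apply: le_trans (h n) _; rewrite ler_norm.
Qed.

(** Norm closure is the substantial condition: by [mulop_dist], operators that are close have
    uniformly close symbols, so the symbols of approximants converge uniformly. *)
Lemma mulops_Cstar : Cstar_subalgebra mulops.
Proof.
split.
- by move=> _ [g cg <-]; exact: mulop_bounded_linear.
- by exists (mulop (fun=> 0)); exists (fun=> 0) => //; exact: cont_fun_cst.
- move=> c _ _ C [g cg <-] [h ch <-] hC.
  exists (fun x => c * g x + h x); first exact: (cont_fun_lin cg ch).
  by apply: op_ext => F; rewrite (hC F) (mulop_lin c cg ch F).
- move=> _ _ [g cg <-] [h ch <-]; exists (fun x => g x * h x).
    exact: (cont_fun_mul cg ch).
  exact: (esym (mulop_comp cg ch)).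
- move=> _ B [g cg <-] hB; exists (fun x => (g x)^*); first exact: cont_funJ.
  exact: adjoint_unique (mulop_adjoint cg) hB.
move=> A _ Alim.
have hk k : exists g, cont_fun g /\ forall F,
    normL2 (set_val (A F) - set_val (mulop g F)) <= (1 / 2 ^+ k) * normL2 (set_val F).
  have e0 : (0 : R) < 1 / 2 ^+ k by rewrite divr_gt0// exprn_gt0.
  by have [_ [g cg <-] hg] := Alim _ e0; exists g.
have [g_ hg_] := choice hk.
have cg k : cont_fun (g_ k) by case: (hg_ k).
have Ag k F := (hg_ k).2 F.
(* Twice 1 / 2^k: both [g_ k] and [g_ k.+1] define operators within that distance of A. *)
have step k x : normc (g_ k.+1 x - g_ k x) <= 2 / 2 ^+ k.
  apply: (mulop_dist (cg _) (cg _)) => F.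
  apply: le_trans (normL2_dist _ (set_val (A F)) _) _.
  rewrite normL2BC.
  have hp : 1 / 2 ^+ k.+1 * normL2 (set_val F) <= 1 / 2 ^+ k * normL2 (set_val F).
    apply: ler_wpM2r; first exact: normL2_ge0.
    by rewrite !mul1r lef_pV2 ?posrE ?exprn_gt0// ler_eXn2l ?ltr1n.
  rewrite (_ : 2 / 2 ^+ k * _ = 1 / 2 ^+ k * normL2 (set_val F) +
    1 / 2 ^+ k * normL2 (set_val F)); last by ring.
  by apply: lerD; [apply: le_trans (Ag k.+1 F) hp|exact: Ag].
(* 8 is 4 times the constant 2 of [step]; the constant 9 below adds the distance 1 / 2^k from A to
   the k-th operator. *)
have lim x : exists l, forall k, normc (g_ k x - l) <= 8 / 2 ^+ k.
  have [l hl] := geometric_ccauchy_cvg (ler0n R 2) (step^~ x).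
  by exists l => k; have := hl k; rewrite -natrM.
have [g gl] := choice lim.
have cgg : cont_fun g.
  apply: cont_fun_unif => e e0.
  have /cvgr0Pnorm_lt/(_ _ e0)[n _ hn] := cvg_half_pow (8 : R).
  exists (g_ n) => // x; rewrite -normcN opprB; apply: le_trans (gl x n) _.
  by apply: le_trans (ltW (hn n (leqnn n))); exact: ler_norm.
exists g => //; apply: op_ext => F; apply: normL2_sub_eq0; apply/eqP.
rewrite eq_le normL2_ge0 andbT; apply: (@le_half_pow0 _ (9 * normL2 (set_val F))) => k.
apply: le_trans (normL2_dist _ (set_val (mulop (g_ k) F)) _) _.
rewrite [X in _ + X]normL2BC (mulopB F cgg (cg k)).
have b2 x : normc (-1 * g_ k x + g x) <= 8 / 2 ^+ k.
  by rewrite mulN1r addrC -normcN opprB; exact: gl.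
rewrite (_ : 9 * _ / _ = 1 / 2 ^+ k * normL2 (set_val F) +
  8 / 2 ^+ k * normL2 (set_val F)); last by ring.
rewrite [leLHS]addrC; exact: lerD (Ag k F) (norm_mulop_le F (cont_fun_lin (c := -1) (cg k) cgg) b2).
Qed.

Definition coord_comb (a : 'I_m -> R[i]) (z : N) : R[i] :=
  \sum_(k < m) a k * (set_val z ord0 k)%:C.

Lemma cont_coord_comb a : cont_fun (coord_comb a).
Proof.
rewrite /coord_comb; elim: (index_enum _) => [|k r ih].
  by under eq_fun do rewrite big_nil; exact: cont_fun_cst.
under eq_fun do rewrite big_cons.
exact: (cont_fun_lin (c := a k) (@coord_cont k) ih).
Qed.

(** The functions [gam k] sum to 1 on [Om], which is all that the pullback sees. *)
Lemma coord_comb_cst (c : R[i]) : mulop (coord_comb (fun=> c)) = mulop (fun=> c).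
Proof.
rewrite /mulop; suff -> : pullback (coord_comb (fun=> c)) = pullback (fun=> c) by [].
apply/funext => xi; rewrite /pullback; case: pselect => // Oxi.
rewrite /coord_comb -mulr_sumr -rmorph_sum /=.
under eq_bigr do rewrite set_valE /= mxE.
by rewrite gam_sum// mulr1.
Qed.

Lemma coord_comb_delta k :
  coord_comb (fun j => (j == k)%:R) = (fun z => (set_val z ord0 k)%:C).
Proof.
apply/funext => z; rewrite /coord_comb (bigD1 k)//= eqxx mul1r big1 ?addr0// => j jk.
by rewrite (negbTE jk) mul0r.
Qed.

(** Stone-Weierstrass applied to the real functions whose operators lie in S; a complex symbol is
    then Re g + i Im g, a linear combination in S. *)
Lemma mulops_minimal (S : set (K -> K)) : Cstar_subalgebra S ->
  (forall a, S (mulop (coord_comb a))) -> mulops `<=` S.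
Proof.
move=> CS SG.
pose A := [set f : N -> R | continuous f /\ S (mulop (fun x => (f x)%:C))].
have AC (p : N -> R) : A p -> cont_fun (fun x => (p x)%:C) by case=> cp _; apply/cont_fun_real.
have real (p : N -> R) : continuous p -> S (mulop (fun x => (p x)%:C)).
  suff: continuous p -> A p by move=> h /h [].
  apply: (stone_weierstrass compact_spectrum).
  - move=> c; split; last by rewrite -coord_comb_cst.
    by apply/cont_fun_real; exact: cont_fun_cst.
  - move=> f1 f2 A1 A2; have [c1 c2] := (AC _ A1, AC _ A2).
    have e : (fun x => (f1 x + f2 x)%:C) = (fun x => 1 * (f1 x)%:C + (f2 x)%:C).
      by apply/funext => x; rewrite mul1r rmorphD.
    split; first by apply/cont_fun_real; rewrite e; exact: (cont_fun_lin c1 c2).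
    rewrite e; exact: (Cstar_lincomb CS A1.2 A2.2 (mulop_lin 1 c1 c2)).
  - move=> f1 f2 A1 A2; have [c1 c2] := (AC _ A1, AC _ A2).
    have e : (fun x => (f1 x * f2 x)%:C) = (fun x => (f1 x)%:C * (f2 x)%:C).
      by apply/funext => x; rewrite rmorphM.
    split; first by apply/cont_fun_real; rewrite e; exact: (cont_fun_mul c1 c2).
    rewrite e -(mulop_comp c1 c2); exact: (Cstar_comp CS A1.2 A2.2).
  - move=> k; split; first by apply/cont_fun_real; exact: coord_cont.
    by rewrite -coord_comb_delta.
  - move=> f1 A1; have [C fC] := cont_fun_bounded (AC _ A1).
    by exists C => x; have := fC x; rewrite normc_real.
  - move=> f1 f1lim.
    have c1 : cont_fun (fun x => (f1 x)%:C).
      apply: cont_fun_unif => e e0; have [f2 A2 h] := f1lim _ e0.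
      exists (fun x => (f2 x)%:C); first exact: AC.
      by move=> x; rewrite -rmorphB normc_real.
    split; first exact/cont_fun_real.
    apply: (Cstar_closed CS); first exact: mulop_bounded_linear.
    move=> e e0; have [f2 A2 h] := f1lim _ e0.
    exists (mulop (fun x => (f2 x)%:C)) => [|F]; first exact: A2.2.
    rewrite (mulopB F c1 (AC _ A2)).
    apply: (norm_mulop_le F (cont_fun_lin (c := -1) (AC _ A2) c1)) => x.
    by rewrite mulN1r addrC -rmorphB normc_real.
move=> _ [g cg <-].
have [cR cI] := (cont_fun_Re cg, cont_fun_Im cg).
have e : g = (fun x => 'i%C * (Im (g x))%:C + (Re (g x))%:C).
  by apply/funext => x; rewrite [LHS]complexE addrC mulrC.
rewrite e; have [cR' cI'] := ((cont_fun_real _).1 cR, (cont_fun_real _).1 cI).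
exact: (Cstar_lincomb CS (real _ cI) (real _ cR) (mulop_lin 'i%C cI' cR')).
Qed.

(** * The isomorphism and its uniqueness *)

Section generators.
Variable toep : ('I_m -> R[i]) -> K -> K.
Hypothesis toepE : forall a, toep a = mulop (coord_comb a).

Lemma generatedE : Cstar_generated (range toep) = mulops.
Proof.
apply/seteqP; split=> A.
  apply; split; first exact: mulops_Cstar.
  move=> _ [a _ <-]; rewrite toepE; exact: mulops_mulop (@cont_coord_comb a).
move=> SA S [CS SG]; apply: mulops_minimal SA => // a.
by rewrite -toepE; apply: SG; exists a.
Qed.

(** The inverse of [mulop] on its image, well defined by [mulop_inj]. *)
Definition symbol_map (A : K -> K) : N -> R[i] :=
  xget (fun=> 0) [set g | cont_fun g /\ mulop g = A].

Lemma symbol_mapK g : cont_fun g -> symbol_map (mulop g) = g.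
Proof.
move=> cg; rewrite /symbol_map; case: xgetP => [h _ [ch e]|/(_ g) []//].
exact: mulop_inj e.
Qed.

Lemma symbol_map_iso : isometric_star_iso mulops symbol_map.
Proof.
split.
- split.
  + by move=> _ [g cg <-]; rewrite symbol_mapK.
  + move=> _ _ /set_mem[g cg <-] /set_mem[h ch <-].
    by rewrite (symbol_mapK cg) (symbol_mapK ch) => ->.
  + by move=> g cg; exists (mulop g); [exists g|exact: symbol_mapK].
- move=> c _ _ C [g cg <-] [h ch <-] [k ck <-] hC.
  have -> : mulop k = mulop (fun x => c * g x + h x).
    by apply: op_ext => F; rewrite (hC F) (mulop_lin c cg ch F).
  by rewrite (symbol_mapK cg) (symbol_mapK ch) (symbol_mapK (cont_fun_lin cg ch)).
- move=> _ _ [g cg <-] [h ch <-]; rewrite (mulop_comp cg ch) (symbol_mapK cg).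
  by rewrite (symbol_mapK ch) (symbol_mapK (cont_fun_mul cg ch)).
- move=> _ _ [g cg <-] [h ch <-] adj.
  rewrite (adjoint_unique adj (mulop_adjoint cg)) (symbol_mapK cg).
  exact: symbol_mapK (cont_funJ cg).
- by move=> _ [g cg <-]; rewrite (symbol_mapK cg) (opnorm_mulop cg).
Qed.

(** The operators on which the two maps agree form a C*-subalgebra that contains the generators, so
    minimality gives all of [mulops]. *)
Lemma symbol_map_unique (tau : (K -> K) -> N -> R[i]) : isometric_star_iso mulops tau ->
  (forall a, tau (toep a) = symbol_map (toep a)) -> {in mulops, tau =1 symbol_map}.
Proof.
move=> iso gen.
(* The given isomorphism is isometric, hence contractive on differences; this settles the
   norm-closure condition for the set E of agreement. *)
have sub (g h : N -> R[i]) : cont_fun g -> cont_fun h -> forall x,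
    normc (tau (mulop g) x - tau (mulop h) x) <= supnorm (fun x => g x - h x).
  move=> cg ch x; have cd := cont_fun_lin (c := -1) ch cg.
  have [Sg [Sh Sd]] := (mulops_mulop cg, (mulops_mulop ch, mulops_mulop cd)).
  have e := iso_lincomb iso Sh Sg Sd (mulop_lin (-1) ch cg).
  have -> : tau (mulop g) x - tau (mulop h) x = tau (mulop (fun x => -1 * h x + g x)) x.
    by rewrite e mulN1r addrC.
  have -> : supnorm (fun x => g x - h x) = opnorm (mulop (fun x => -1 * h x + g x)).
    rewrite (opnorm_mulop cd); congr supnorm; apply/funext => y.
    by rewrite mulN1r addrC.
  rewrite -(iso_norm iso Sd); apply: supnormP.
  by have [tfun _ _] := iso_bij iso; exact: tfun.
pose E := [set A | mulops A /\ tau A = symbol_map A].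
have CE : Cstar_subalgebra E.
  split.
  - by move=> A [SA _]; exact: (Cstar_bounded mulops_Cstar).
  - exists (toep (fun=> 0)); split => //; rewrite toepE; exact: mulops_mulop (@cont_coord_comb _).
  - move=> c A B C [SA eA] [SB eB] hC.
    have SC := Cstar_lincomb mulops_Cstar SA SB hC; split => //.
    by rewrite (iso_lincomb iso SA SB SC hC) (iso_lincomb symbol_map_iso SA SB SC hC) eA eB.
  - move=> A B [SA eA] [SB eB]; split; first exact: (Cstar_comp mulops_Cstar).
    by rewrite (iso_comp iso SA SB) (iso_comp symbol_map_iso SA SB) eA eB.
  - move=> A B [SA eA] hB; have SB := Cstar_adjoint mulops_Cstar SA hB; split => //.
    by rewrite (iso_adjoint iso SA SB hB) (iso_adjoint symbol_map_iso SA SB hB) eA.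
  - move=> A bA Alim.
    have SA : mulops A.
      apply: (Cstar_closed mulops_Cstar) => // e e0.
      by have [B [SB _] h] := Alim e e0; exists B.
    split => //; have [g cg gA] := SA; rewrite -gA (symbol_mapK cg); apply/funext => x.
    apply/eqP; rewrite -subr_eq0; apply/eqP/normc_eq0/eqP; rewrite eq_le normc_ge0 andbT.
    apply: (@le_half_pow0 _ 2) => k.
    have e0 : (0 : R) < 1 / 2 ^+ k by rewrite divr_gt0// exprn_gt0.
    have [_ [[h ch <-] eB] hB] := Alim _ e0.
    rewrite (symbol_mapK ch) in eB.
    have d1 : supnorm (fun x => g x - h x) <= 1 / 2 ^+ k.
      by apply: supnorm_le; apply: (mulop_dist cg ch) => F; rewrite gA; exact: hB.
    have d2 : normc (h x - g x) <= 1 / 2 ^+ k.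
      have -> : h x - g x = - (g x - h x) by rewrite opprB.
      by rewrite normcN; apply: (mulop_dist cg ch) => F; rewrite gA.
    have -> : tau (mulop g) x - g x = (tau (mulop g) x - tau (mulop h) x) + (h x - g x).
      by rewrite eB; ring.
    rewrite (_ : 2 / 2 ^+ k = 1 / 2 ^+ k + 1 / 2 ^+ k); last by ring.
    apply: le_trans (normcD _ _) (lerD _ d2).
    exact: le_trans (sub _ _ cg ch x) d1.
move=> A /set_mem SA; have [_ ->] // : E A.
apply: (mulops_minimal CE) => // a; rewrite -toepE; split => //.
by rewrite toepE; exact: mulops_mulop (@cont_coord_comb a).
Qed.

Theorem generated_algebra_iso : exists tau : (K -> K) -> N -> R[i], [/\
  isometric_star_iso (Cstar_generated (range toep)) tau,
  (forall a, tau (toep a) = coord_comb a) &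
  (forall tau' : (K -> K) -> N -> R[i],
    isometric_star_iso (Cstar_generated (range toep)) tau' ->
    (forall a, tau' (toep a) = tau (toep a)) ->
    {in Cstar_generated (range toep), tau' =1 tau})].
Proof.
rewrite generatedE; exists symbol_map; split.
- exact: symbol_map_iso.
- by move=> a; rewrite toepE; exact: symbol_mapK (@cont_coord_comb a).
- exact: symbol_map_unique.
Qed.

End generators.

End multiplication_algebra.

(** * Toeplitz localization operators *)

Section localization_model.
Context (R : realType) (s : setting).
Local Notation leb := (@lebesgue_measure R).
Local Notation mR := (measurableTypeR R).
Variables (Psi : L2 leb) (m : nat) (Y : 'I_m -> set R).
Hypothesis adm : admissible s Psi.
Hypothesis Y_measurable : forall k, measurable (Y k : set mR).
Hypothesis Y_disjoint : trivIset setT Y.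
Hypothesis Y_cover : \bigcup_k Y k = G1 R s.
Implicit Types (a : 'I_m -> R[i]) (f : L2 leb).

Let YG1 k : Y k `<=` G1 R s.
Proof. by rewrite -Y_cover => z Yz; exists k. Qed.

Definition scale_symbol a (z : mR) : R[i] := \sum_(k < m) a k * (\1_(Y k) z)%:C.

Lemma symbolE a : symbol s Y a = (fun z => scale_symbol a z.1).
Proof.
apply/funext => z; apply: eq_bigr => k _; congr (_ * _%:C).
rewrite !indicE; congr (_ _)%:R; apply/idP/idP => /set_mem; rewrite /strip /=.
  by case=> _ Yz; exact/mem_set.
by move=> Yz; apply/mem_set; split => //; exact: YG1 Yz.
Qed.

Lemma bounded_scale_symbol a : bounded_cfun (scale_symbol a).
Proof.
rewrite /scale_symbol; elim: (index_enum _) => [|k r [mr [M hM]]].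
  under eq_fun do rewrite big_nil.
  by split; [exact: cmeasurable_cst|exists 0 => x; rewrite normc0].
under eq_fun do rewrite big_cons; split.
  apply: cmeasurableD => //; apply: cmeasurableM; first exact: cmeasurable_cst.
  exact: cmeasurable_indic.
exists (normc (a k) + M) => x; apply: le_trans (normcD _ _) (lerD _ (hM x)).
by rewrite normcM ler_piMr ?normc_ge0// normc_indic.
Qed.

Let integrable_energy xi : frequencies s xi ->
  (zeta1 R s).-integrable setT (EFin \o (fun z : mR => normc (ell s Psi z xi) ^+ 2)).
Proof.
move=> fxi; apply/integrableP; split.
  have mz : measurable_fun setT (fun z : mR => (z, xi : mR)) by exact: measurable_fun_pair.
  apply/measurable_EFinP/measurable_sqr_normc.
  exact: (cmeasurable_comp (cmeasurable_ell s Psi) mz).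
rewrite (_ : (\int[zeta1 R s]_x _)%E = 1%E) ?ltry// -(reconstruction adm fxi).
by apply: eq_integral => z _; rewrite /= ger0_norm ?sqr_ge0.
Qed.

Lemma strip_symbolE a xi : frequencies s xi ->
  strip_symbol (zeta1 R s) (ell s Psi) (scale_symbol a) xi =
  \sum_(k < m) a k * (gamma s Psi (Y k) xi)%:C.
Proof.
move=> fxi; pose n2 (z : mR) := normc (ell s Psi z xi) ^+ 2.
have ik k : (zeta1 R s).-integrable setT (EFin \o (fun z : mR => \1_(Y k) z * n2 z)).
  have mi := integrable_energy fxi.
  apply: (le_ge0_integrable _ _ mi) => [|z].
    apply: measurable_funM; first exact: measurable_indic.
    by apply/measurable_EFinP; exact: measurable_int mi.
  by rewrite indicE; case: (z \in Y k); rewrite ?mul1r ?mul0r ?normr0 ?ger0_norm ?sqr_ge0.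
have gE k : Rintegral (zeta1 R s) setT (fun z => \1_(Y k) z * n2 z) = gamma s Psi (Y k) xi.
  rewrite /gamma /Rintegral [in RHS]integral_mkcond; congr fine.
  apply: eq_integral => z _; rewrite patchE indicE.
  by case: (z \in Y k); rewrite ?mul1r ?mul0r.
rewrite /strip_symbol /scale_symbol.
suff [] : cL1 (zeta1 R s) (fun z => (\sum_(k < m) a k * (\1_(Y k) z)%:C) * (n2 z)%:C) /\
    cintegral (zeta1 R s) (fun z => (\sum_(k < m) a k * (\1_(Y k) z)%:C) * (n2 z)%:C) =
    \sum_(k < m) a k * (gamma s Psi (Y k) xi)%:C by [].
elim: (index_enum _) => [|k r [ih1 ih2]].
  under eq_fun do rewrite big_nil mul0r; rewrite big_nil.
  by split; [exact: cL1_0|exact: cintegral0].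
have e : (fun z => (\sum_(j <- k :: r) a j * (\1_(Y j) z)%:C) * (n2 z)%:C) =
    (fun z => a k * (\1_(Y k) z * n2 z)%:C +
      (\sum_(j <- r) a j * (\1_(Y j) z)%:C) * (n2 z)%:C).
  by apply/funext => z; rewrite big_cons mulrDl -mulrA -rmorphM.
have c1 := cL1R (ik k).
rewrite e big_cons; split; first exact: cL1D (cL1Z _ c1) ih1.
by rewrite (cintegralD (cL1Z _ c1) ih1) ih2 (cintegralZ _ c1) cintegralR gE.
Qed.

Lemma scale_symbol1 z : G1 R s z -> scale_symbol (fun=> 1) z = 1.
Proof.
rewrite -Y_cover => -[k _ Yz]; rewrite /scale_symbol (bigD1 k)//= big1 ?addr0.
  by rewrite indicE mem_set// mulr1.
move=> j jk; rewrite indicE memNset ?mulr0// => Yj.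
by move/eqP: jk; apply; apply: Y_disjoint => //; exists z.
Qed.

(** The strip symbol of the coefficients a = 1 is computed twice: by linearity it is the sum, and
    since the cells cover [G1] it is the reconstruction integral. *)
Lemma gamma_sum xi : frequencies s xi -> \sum_(k < m) gamma s Psi (Y k) xi = 1.
Proof.
move=> fxi; have mi := integrable_energy fxi.
have mn : measurable_fun setT (fun z : mR => normc (ell s Psi z xi) ^+ 2).
  by apply/measurable_EFinP; exact: measurable_int mi.
have : strip_symbol (zeta1 R s) (ell s Psi) (scale_symbol (fun=> 1)) xi = 1.
  transitivity (cintegral (zeta1 R s) (fun z => (normc (ell s Psi z xi) ^+ 2)%:C)).
    apply: ae_eq_cintegral.
    - apply: cmeasurableM; first by case: (bounded_scale_symbol (fun=> 1)).
      exact: cmeasurableR.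
    - exact: cmeasurableR.
    - by apply: ae_imp (ae_G1 R s) => z Gz _; rewrite scale_symbol1// mul1r.
  by rewrite cintegralR /Rintegral reconstruction.
rewrite strip_symbolE// => /(congr1 (fun z => Re z)).
under eq_bigr do rewrite mul1r.
by rewrite -rmorph_sum.
Qed.

Local Notation U := (strip_op (zeta1 R s) (ell s Psi) (orientation R s)).
Local Notation K := (@transform_range R s Psi).

Let ell_norm : \forall w \ae leb,
  (\int[zeta1 R s]_z (normc (ell s Psi z w) ^+ 2)%:E = 1)%E.
Proof. by apply: ae_imp (ae_frequencies R s) => xi; exact: reconstruction. Qed.

Let mell := cmeasurable_ell s Psi.
Let ell2 := ell_cL2 s Psi.
Let or1 := orientation1 R s.

Lemma strip_op_lin c f1 f2 : U (c *: f1 + f2) = c *: U f1 + U f2.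
Proof. exact: strip_op_linear. Qed.

(** The function p is prescribed only at the frequencies, which are conull; this accommodates the
    pullback, whose value elsewhere is a default. *)
Lemma dot_symbol_strip a f1 f2 (p : mR -> R[i]) : bounded_cfun p ->
  (forall xi, frequencies s xi -> p xi = \sum_(k < m) a k * (gamma s Psi (Y k) xi)%:C) ->
  dotL2 (mulL2 (@zeta R s) (symbol s Y a) (U f1)) (U f2) = dotL2 (mulL2 leb p f1) f2.
Proof.
move=> bp pE; rewrite symbolE (dot_mulL2 _ _ bp).
have -> := dot_strip_op mell ell2 ell_norm or1 f1 f2 (bounded_scale_symbol a).
apply: ae_eq_cintegral.
- apply: cmeasurableM; first exact: (cmeasurable_strip_symbol _ mell (bounded_scale_symbol a)).
  by apply: cmeasurableM; [exact: L2_cmeasurable|apply: cmeasurableJ; exact: L2_cmeasurable].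
- apply: cmeasurableM; first by case: bp.
  by apply: cmeasurableM; [exact: L2_cmeasurable|apply: cmeasurableJ; exact: L2_cmeasurable].
by apply: ae_imp (ae_frequencies R s) => xi fxi _; rewrite strip_symbolE// pE.
Qed.

(** The case of the constant symbol 1, where the mean against |ell|^2 is the reconstruction
    integral. *)
Lemma norm_strip_op f : normL2 (U f) = normL2 f.
Proof.
have b1 : bounded_cfun ((fun=> 1) : mR -> R[i]).
  by split; [exact: cmeasurable_cst|exists 1 => _; rewrite normc1].
suff e : dotL2 (U f) (U f) = dotL2 f f by rewrite /normL2 e.
rewrite -{1}(mulL21 (U f)).
have -> := dot_strip_op mell ell2 ell_norm or1 f f b1.
apply: ae_eq_cintegral.
- apply: cmeasurableM; first exact: (cmeasurable_strip_symbol _ mell b1).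
  by apply: cmeasurableM; [exact: L2_cmeasurable|apply: cmeasurableJ; exact: L2_cmeasurable].
- by apply: cmeasurableM; [exact: L2_cmeasurable|apply: cmeasurableJ; exact: L2_cmeasurable].
apply: ae_imp (ae_frequencies R s) => xi fxi _; rewrite /strip_symbol.
under eq_cintegral do rewrite mul1r.
by rewrite cintegralR /Rintegral reconstruction// mul1r.
Qed.

Lemma transform_rangeE (F : L2 (@zeta R s)) : K F <-> exists f, U f = F.
Proof.
split=> [[f _ <-]|[f <-]].
  by exists (frequency_side s f); rewrite transformE.
have [g <-] := frequency_side_surj s f.
by exists g => //; rewrite transformE.
Qed.

Let gam k := gamma s Psi (Y k).

Lemma frequencies_nonempty : (frequencies s : set R) !=set0.
Proof. by exists 1; case: (s) => //=; rewrite oner_neq0. Qed.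

Lemma cell_gamma_continuous k (xi : R) : frequencies s xi ->
  gamma s Psi (Y k) x @[x --> xi] --> gamma s Psi (Y k) xi.
Proof. by move=> fxi; apply: gamma_continuous => //; exact: YG1. Qed.

(** The multiplication operator satisfies the orthogonality relation that defines the projection of
    a F: tested against the range, a F and the multiplied vector have the same inner products. *)
Lemma toeplitzE a : toeplitz s Psi (symbol s Y a) =
  mulop transform_rangeE (@coord_comb R (frequencies s) m gam a).
Proof.
apply/funext => F; rewrite /toeplitz /orth_proj.
set M := mulop _ _ F.
have bp := bounded_pullback (@near_frequencies R s) frequencies_nonempty
  cell_gamma_continuous (fun k xi => gamma_ge0 s Psi xi (Y k)) gamma_sum
  (@cont_coord_comb R (frequencies s) m gam a).
have MP (H : K) : dotL2 (mulL2 (@zeta R s) (symbol s Y a) (set_val F) - set_val M) (set_val H) = 0.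
  rewrite -(preimageE transform_rangeE F) -(preimageE transform_rangeE H) embedE.
  rewrite dotBl (isometry_dot strip_op_lin norm_strip_op) (dot_symbol_strip _ _ bp) ?subrr//.
  by move=> xi fxi; rewrite (pullbackE _ fxi) /coord_comb; apply: eq_bigr => k _; rewrite set_valE /= mxE.
(* The relation has at most one solution in K, so the element selected by [xget] is M. *)
case: xgetP => [G _ GP|/(_ M) []//].
suff e : preimage transform_rangeE G = preimage transform_rangeE M.
  apply: val_inj; rewrite -[val G]/(set_val G) -[val M]/(set_val M).
  by rewrite -(preimageE transform_rangeE G) e preimageE.
apply: dot_sqr_inj => h.
have := GP (embed transform_rangeE h); have := MP (embed transform_rangeE h).
rewrite !dotBl => /eqP; rewrite subr_eq0 => /eqP -> /eqP; rewrite subr_eq0 => /eqP.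
rewrite -(preimageE transform_rangeE G) -(preimageE transform_rangeE M) embedE.
by rewrite !(isometry_dot strip_op_lin norm_strip_op).
Qed.

End localization_model.

Local Open Scope complex_scope.

Theorem theorem3p6 (R : realType) (s : setting)
    (Psi : L2 (@lebesgue_measure R)) (Psi_admissible : admissible s Psi)
    (m : nat) (Y : 'I_m -> set R)
    (Y_measurable : forall k, measurable (Y k : set (measurableTypeR R)))
    (Y_positive : forall k, (0 < zeta1 R s (Y k))%E)
    (Y_disjoint : trivIset setT Y)
    (Y_cover : \bigcup_k Y k = G1 R s) :
  exists tau, [/\
    isometric_star_iso (toeplitz_algebra s Psi Y) tau,
    (forall a : 'I_m -> R[i],
      tau (toeplitz s Psi (symbol s Y a)) =
        (fun z : nabla s Psi Y => \sum_(k < m) a k * (set_val z ord0 k)%:C)) &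
    (forall tau' : _ -> nabla s Psi Y -> R[i],
      isometric_star_iso (toeplitz_algebra s Psi Y) tau' ->
      (forall a : 'I_m -> R[i],
        tau' (toeplitz s Psi (symbol s Y a)) =
          tau (toeplitz s Psi (symbol s Y a))) ->
      {in toeplitz_algebra s Psi Y, tau' =1 tau})].
Proof.
have -> : toeplitz_algebra s Psi Y =
    Cstar_generated (range (fun a => toeplitz s Psi (symbol s Y a))).
  congr Cstar_generated; apply/seteqP; split=> [_ [_ [a _ <-] <-]|_ [a _ <-]].
    by exists a.
  by exists (symbol s Y a) => //; exists a.
exact: (generated_algebra_iso (strip_op_lin Psi_admissible)
  (norm_strip_op Psi_admissible) (@near_frequencies R s) (frequencies_nonempty R s)
  (cell_gamma_continuous Psi_admissible Y_measurable Y_cover)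
  (fun k xi => gamma_ge0 s Psi xi (Y k))
  (gamma_sum Psi_admissible Y_measurable Y_disjoint Y_cover)
  (toeplitzE Psi_admissible Y_measurable Y_disjoint Y_cover)).
Qed.
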